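(* Let $(\Omega,\mathcal F,\mathbb P)$ be a probability space, $f_1,f_2,\dots$ real-valued measurable functions on it, and $\mathcal T=\bigcap_{n\in\mathbb N}\sigma(f_n,f_{n+1},\dots)$ their tail $\sigma$-algebra. The following are equivalent: (i) There exist real-valued $\mathcal T$-measurable functions $D_1,D_2,\dots$ with $\mathbb P(|D_N|\le N\ \forall N\in\mathbb N)=1$ and a subsequence $(f_{k_n})_n$ such that, along $(f_{k_n})_n$ and along every subsequence $(f_{m_n})_n$ of it, $\frac1N\sum_{n=1}^N f_{m_n}-D_N\to0$ in $\mathbb P$-probability as $N\to\infty$. (i)$'$ There exist real-valued $\mathcal T$-measurable $D_1,D_2,\dots$ with $\mathbb P(|D_N|\le N\ \forall N)=1$ and a subsequence $(f_{k_n})_n$ such that, along it and along every subsequence $(f_{m_n})_n$ of it, for every $\varepsilon>0$, $\mathbb P\big(\big|\frac1N\sum_{n=1}^N f_{m_n}-D_N\big|>\varepsilon\,\big|\,\mathcal T\big)\to0$ in $\mathbb P$-probability as $N\to\infty$. (ii) $(f_n)$ contains a determining subsequence $(f_{k_n})_n$ whose limiting random probability measure $\boldsymbol\mu$ satisfies, in $\mathbb P$-probability, $\lim_{N\to\infty} N\,\boldsymbol\mu\big(\mathbb R\setminus[-N,N]\big)=0$ and $\lim_{N\to\infty}\frac1N\int_{[-N,N]}x^2\,\boldsymbol\mu(dx,\cdot)=0$. Moreover, each $D_N$ in (i), (i)$'$ can be taken as the weak-$L^2$ limit, as $n\to\infty$, of $\mathbb E\big(f_{k_n}\mathbf 1_{\{|f_{k_n}|\le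 N\}}\,\big|\,\mathcal T\big)$; and $D_N/\sqrt N\to0$ in $\mathbb P$-probability as $N\to\infty$.
   Context: A subsequence $(f_{k_n})_n$ is called determining if there are a countable dense set $\mathbf D\subset\mathbb R$ and a function $\mathbf H:\mathbb R\times\Omega\to[0,1]$ which, for $\mathbb P$-a.e. $\omega$, is a probability distribution function in $x$, such that $\lim_{n\to\infty}\mathbb P(f_{k_n}\le x,\,B)=\int_B\mathbf H(x,\omega)\,\mathbb P(d\omega)$ for all $B\in\mathcal F$ and all $x\in\mathbf D$ (stable convergence). The limiting random probability measure $\boldsymbol\mu_\omega=\boldsymbol\mu(\cdot,\omega)$ is the Borel probability measure on $\mathbb R$ with distribution function $\mathbf H(\cdot,\omega)$; $\omega\mapsto\boldsymbol\mu_\omega$ is measurable with respect to the tail $\sigma$-algebra $\mathcal T$. *)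

(* Defs.v *)
From HB Require Import structures.
From mathcomp Require Import all_boot all_order all_algebra.
From mathcomp Require Import all_classical all_reals all_analysis.
Set Implicit Arguments. Unset Strict Implicit. Unset Printing Implicit Defensive.
Import Order.TTheory GRing.Theory Num.Theory.
Import numFieldNormedType.Exports.
Local Open Scope classical_set_scope.
Local Open Scope ring_scope.

Section defs.
Context {d : measure_display} {Omega : measurableType d} {R : realType}.
Variable P : probability Omega R.

Definition sigma_from (f : nat -> Omega -> R) (n : nat) : set (set Omega) :=
  <<s \bigcup_(m in [set m | (n <= m)%N])
        preimage_set_system setT (f m) measurable >>.

Definition tail_sigma (f : nat -> Omega -> R) : set (set Omega) :=
  \bigcap_(n in setT) sigma_from f n.

Definition measurable_wrt (T : set (set Omega)) (g : Omega -> R) : Prop :=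
  forall Y : set R, measurable Y -> T (g @^-1` Y).

Definition cond_exp_version (T : set (set Omega)) (X g : Omega -> R) : Prop :=
  [/\ measurable_wrt T g,
      P.-integrable setT (EFin \o g) &
      forall B, T B ->
        (\int[P]_(w in B) (g w)%:E = \int[P]_(w in B) (X w)%:E)%E].

Definition cond_prob_version (T : set (set Omega)) (A : set Omega)
    (g : Omega -> R) : Prop :=
  [/\ measurable_wrt T g,
      P.-integrable setT (EFin \o g) &
      forall B, T B -> (\int[P]_(w in B) (g w)%:E = P (A `&` B))%E].

Definition conv_in_prob (X : nat -> Omega -> R) : Prop :=
  forall eps : R, 0 < eps ->
    (P [set w | eps < `|X N w|]) @[N --> \oo] --> 0%E.

Definition strict_incr (k : nat -> nat) : Prop :=
  forall a b, (a < b)%N -> (k a < k b)%N.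

(* m is a subsequence of k (m = k \o phi with phi strictly increasing);
   in particular k is a subsequence of itself *)
Definition subseq_of (m k : nat -> nat) : Prop :=
  exists phi, strict_incr phi /\ m = k \o phi.

(* (1/N) \sum_{n=1}^N f_{m_n}  (indices shifted to start at 0) *)
Definition avg (f : nat -> Omega -> R) (m : nat -> nat) (N : nat) (w : Omega) : R :=
  (N%:R)^-1 * \sum_(n < N) f (m n) w.

Definition good_centering (f : nat -> Omega -> R) (D : nat -> Omega -> R) : Prop :=
  (forall N, measurable_wrt (tail_sigma f) (D N)) /\
  {ae P, forall w, forall N : nat, (0 < N)%N -> `|D N w| <= N%:R}.

Definition prop_i (f : nat -> Omega -> R) (k : nat -> nat) (D : nat -> Omega -> R) : Prop :=
  [/\ strict_incr k, good_centering f D &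
      forall m, subseq_of m k ->
        conv_in_prob (fun N w => avg f m N w - D N w)].

Definition prop_i' (f : nat -> Omega -> R) (k : nat -> nat) (D : nat -> Omega -> R) : Prop :=
  [/\ strict_incr k, good_centering f D &
      forall m, subseq_of m k ->
      forall eps : R, 0 < eps ->
      forall g : nat -> Omega -> R,
        (forall N, cond_prob_version (tail_sigma f)
                     [set w | eps < `|avg f m N w - D N w|] (g N)) ->
        conv_in_prob g].

Definition cond_i (f : nat -> Omega -> R) : Prop := exists k D, prop_i f k D.
Definition cond_i' (f : nat -> Omega -> R) : Prop := exists k D, prop_i' f k D.

Definition distribution_function (F : R -> R) : Prop :=
  [/\ {homo F : x y / x <= y},
      (forall x, F y @[y --> x^'+] --> F x),
      F x @[x --> -oo] --> (0 : R) &
      F x @[x --> +oo] --> (1 : R)].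

Definition determining (f : nat -> Omega -> R) (k : nat -> nat)
    (Dset : set R) (H : R -> Omega -> R) : Prop :=
  [/\ strict_incr k, countable Dset /\ dense Dset,
      (forall x w, 0 <= H x w <= 1) /\ (forall x, measurable_fun setT (H x)),
      {ae P, forall w, distribution_function (H ^~ w)} &
      forall x, Dset x -> forall B, measurable B ->
        P ([set w | f (k n) w <= x] `&` B) @[n --> \oo] -->
          (\int[P]_(w in B) (H x w)%:E)%E].

Definition limiting_measure (H : R -> Omega -> R) (mu : R.-pker Omega ~> R) : Prop :=
  {ae P, forall w, forall x : R, mu w `]-oo, x]%classic = (H x w)%:E}.

Definition cond_ii (f : nat -> Omega -> R) : Prop :=
  exists (k : nat -> nat) (Dset : set R) (H : R -> Omega -> R)
         (mu : R.-pker Omega ~> R),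
    [/\ determining f k Dset H, limiting_measure H mu,
        conv_in_prob (fun N w => N%:R * fine (mu w (~` `[- N%:R, N%:R]%classic))) &
        conv_in_prob (fun N w => (N%:R)^-1 *
                        fine (\int[mu w]_(x in `[- N%:R, N%:R]%classic) (x ^+ 2)%:E))].

Definition weak_L2_conv (X : nat -> Omega -> R) (Y : Omega -> R) : Prop :=
  forall h : Omega -> R, measurable_fun setT h ->
    P.-integrable setT (fun w => (h w ^+ 2)%:E) ->
    (\int[P]_w (X n w * h w)%:E)%E @[n --> \oo] --> (\int[P]_w (Y w * h w)%:E)%E.

Definition moreover_part (f : nat -> Omega -> R) : Prop :=
  exists k D, [/\ prop_i f k D, prop_i' f k D,
    (forall N : nat, (0 < N)%N ->
       forall c : nat -> Omega -> R,
         (forall n, cond_exp_version (tail_sigma f)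
            (fun w => if `|f (k n) w| <= N%:R then f (k n) w else 0) (c n)) ->
         weak_L2_conv c (D N)) &
    conv_in_prob (fun N w => D N w / Num.sqrt N%:R)].

End defs.

(* Main.v *)
Require Import Defs.
From HB Require Import structures.
From mathcomp Require Import all_boot all_order all_algebra.
From mathcomp Require Import all_classical all_reals all_analysis.
From mathcomp Require Import measurable_realfun ring lra.
Set Implicit Arguments. Unset Strict Implicit. Unset Printing Implicit Defensive.
Import Order.TTheory GRing.Theory Num.Theory.
Import numFieldNormedType.Exports.
Local Open Scope classical_set_scope.
Local Open Scope ring_scope.

(** Let [V_N] be 1/N times the integral of min(x^2, N^2) with respect to the random
    measure mu; the two conditions in (ii) together say that [V_N] tends to 0 in
    probability.

    If they hold, pass to a subsequence along which every truncation f 1_{|f| <= N} has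
    a weak limit [D_N], which is tail measurable. The differences with [D_N] are then
    asymptotically orthogonal, so a sparse subsequence can be chosen such that for all
    its subsequences the centered averages of the truncated variables have, on the set
    [V_N <= 1], second moment O(E[V_N; V_N <= 1]) + o(1); tightness removes the
    truncation.

    Conversely, the law of large numbers along all subsequences is uniform far out.
    Choosing one term out of each of N consecutive pairs produces Rademacher averages of
    the differences X_j within the pairs, so by Paley-Zygmund the sum of the X_j^2 is
    small compared with N^2 with high probability, and the expectation of the product of
    the 1 - min(1, X_j^2 / N^2) is near 1. Sending the indices to infinity one after the
    other turns this product into the N-th power of a random variable bounded above by
    about 1 - c V_N / N, which forces [V_N] to tend to 0. *)

(** * Bounded random variables *)

Section bounded.
Context {d : measure_display} {Omega : measurableType d} {R : realType}.
Variable P : probability Omega R.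
Implicit Types (X Y Z : Omega -> R) (A B : set Omega).

(** Convergence in probability of V_N does not control its expectation, and the [f n] are merely
    measurable; hence the restriction to the set V_N <= 1, and the use of bounded functions of the
    [f n] throughout. Weak limits are taken along one ultrafilter, at all levels at once, and
    realised afterwards by a subsequence whose deviations from the limits are almost orthogonal. For
    the converse, weak convergence handles one index at a time, whereas a difference x - y involves
    two. For |y| <= M one has min((x - y)^2, N^2) >= min(x^2, N^2) / 2 - M^2, which bounds each
    factor of the product by one minus a function of y times a function of x. By tightness, the
    indicator of |y| <= M has a weak limit with expectation close to 1 for large M, and the error
    M^2 / N^2 disappears in the N-th power since N times it tends to 0. Tightness itself comes from
    comparing the averages along a subsequence and along its shift by one. *)

Definition bdd X := measurable_fun setT X /\ exists C : R, forall w, `|X w| <= C.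

Definition expect X : R := Rintegral P setT X.

Definition prob A : R := fine (P A).

Lemma bddP X (C : R) : measurable_fun setT X -> (forall w, `|X w| <= C) -> bdd X.
Proof. by move=> mX XC; split=> //; exists C. Qed.

Lemma bdd_cst (c : R) : bdd (fun=> c).
Proof. by apply: (@bddP _ `|c|) => //; exact: measurable_cst. Qed.

Lemma bddD X Y : bdd X -> bdd Y -> bdd (fun w => X w + Y w).
Proof.
move=> [mX [C XC]] [mY [D YD]]; apply: (@bddP _ (C + D)).
  exact: measurable_funD.
by move=> w; rewrite (le_trans (ler_normD _ _))// lerD.
Qed.

Lemma bddN X : bdd X -> bdd (fun w => - X w).
Proof.
move=> [mX [C XC]]; apply: (@bddP _ C); first exact: measurableT_comp.
by move=> w; rewrite normrN.
Qed.

Lemma bddB X Y : bdd X -> bdd Y -> bdd (fun w => X w - Y w).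
Proof. by move=> bX bY; apply: bddD => //; exact: bddN. Qed.

Lemma bddM X Y : bdd X -> bdd Y -> bdd (fun w => X w * Y w).
Proof.
move=> [mX [C XC]] [mY [D YD]]; apply: (@bddP _ (C * D)).
  exact: measurable_funM.
by move=> w; rewrite normrM ler_pM.
Qed.

Lemma bddX X n : bdd X -> bdd (fun w => X w ^+ n).
Proof.
move=> bX; elim: n => [|n ih].
  by under eq_fun do rewrite expr0; exact: bdd_cst.
by under eq_fun do rewrite exprS; exact: bddM.
Qed.

Lemma bdd_indic A : measurable A -> bdd (\1_A : Omega -> R).
Proof.
move=> mA; apply: (@bddP _ 1) => [|w]; first exact: measurable_indic.
by rewrite indicE; case: (_ \in _); rewrite ?normr1 ?normr0.
Qed.

Lemma bdd_norm X : bdd X -> bdd (fun w => `|X w|).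
Proof.
move=> [mX [C XC]]; apply: (@bddP _ C); first exact: measurableT_comp.
by move=> w; rewrite normr_id.
Qed.

Lemma bdd_sum (I : Type) (s : seq I) (Q : pred I) (X : I -> Omega -> R) :
  (forall i, bdd (X i)) -> bdd (fun w => \sum_(i <- s | Q i) X i w).
Proof.
move=> bX; elim: s => [|i s ih].
  by under eq_fun do rewrite big_nil; exact: bdd_cst.
under eq_fun do rewrite big_cons; case: (Q i) => //; exact: bddD.
Qed.

Lemma bdd_prod (I : Type) (s : seq I) (Q : pred I) (X : I -> Omega -> R) :
  (forall i, bdd (X i)) -> bdd (fun w => \prod_(i <- s | Q i) X i w).
Proof.
move=> bX; elim: s => [|i s ih].
  by under eq_fun do rewrite big_nil; exact: bdd_cst.
under eq_fun do rewrite big_cons; case: (Q i) => //; exact: bddM.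
Qed.

Lemma bdd_comp (u : R -> R) X (C : R) : measurable_fun setT u ->
  (forall x, `|u x| <= C) -> measurable_fun setT X -> bdd (fun w => u (X w)).
Proof. by move=> mu uC mX; apply: (@bddP _ C) => //; exact: measurableT_comp. Qed.

Lemma bdd_int X : bdd X -> P.-integrable setT (EFin \o X).
Proof.
move=> [mX [C XC]]; apply: measurable_bounded_integrable => //.
  by rewrite ltey_eq fin_num_measure.
by exists C; split; rewrite ?num_real// => M CM w _ /=; rewrite (le_trans (XC w))// ltW.
Qed.
Hint Resolve bdd_int : core.

Lemma Ex_cst c : expect (fun=> c) = c.
Proof.
rewrite /expect Rintegral_cst// -[RHS]mulr1; congr (_ * _).
by rewrite -[RHS]/(fine 1%E); congr fine; exact: probability_setT.
Qed.

Lemma ExD X Y : bdd X -> bdd Y -> expect (fun w => X w + Y w) = expect X + expect Y.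
Proof. by move=> bX bY; rewrite /expect RintegralD//; exact: bdd_int. Qed.

Lemma ExB X Y : bdd X -> bdd Y -> expect (fun w => X w - Y w) = expect X - expect Y.
Proof. by move=> bX bY; rewrite /expect RintegralB//; exact: bdd_int. Qed.

Lemma ExZ c X : bdd X -> expect (fun w => c * X w) = c * expect X.
Proof. by move=> bX; rewrite /expect RintegralZl//; exact: bdd_int. Qed.

Lemma Ex_sum (I : Type) (s : seq I) (Q : pred I) (X : I -> Omega -> R) :
  (forall i, bdd (X i)) ->
  expect (fun w => \sum_(i <- s | Q i) X i w) = \sum_(i <- s | Q i) expect (X i).
Proof.
move=> bX; elim: s => [|i s ih].
  by under eq_fun do rewrite big_nil; rewrite big_nil Ex_cst.
under eq_fun do rewrite big_cons; rewrite big_cons.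
by case: (Q i) => //; rewrite ExD// ?ih//; exact: bdd_sum.
Qed.

Lemma Ex_le X Y : bdd X -> bdd Y -> (forall w, X w <= Y w) -> expect X <= expect Y.
Proof. by move=> bX bY XY; apply: le_Rintegral => //; exact: bdd_int. Qed.

Lemma Ex_ge0 X : (forall w, 0 <= X w) -> 0 <= expect X.
Proof. by move=> X0; apply: Rintegral_ge0. Qed.

Lemma Ex_abs X : bdd X -> `|expect X| <= expect (fun w => `|X w|).
Proof. by move=> bX; apply: le_normr_Rintegral => //; exact: bdd_int. Qed.

Lemma Ex_bnd X (C : R) : measurable_fun setT X -> (forall w, `|X w| <= C) -> `|expect X| <= C.
Proof.
move=> mX XC; have bX : bdd X by exact: bddP XC.
rewrite (le_trans (Ex_abs bX))// -[leRHS]Ex_cst; apply: Ex_le => //.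
  exact: bdd_norm.
exact: bdd_cst.
Qed.

Lemma Ex_indic A : measurable A -> expect \1_A = prob A.
Proof. by move=> mA; rewrite /expect /Rintegral integral_indic// setIT. Qed.

Lemma PrE A : measurable A -> P A = (prob A)%:E.
Proof. by move=> mA; rewrite /prob fineK// fin_num_measure. Qed.

Lemma Pr_ge0 A : 0 <= prob A.
Proof. by rewrite /prob fine_ge0. Qed.

Lemma Pr_le A B : measurable A -> measurable B -> A `<=` B -> prob A <= prob B.
Proof. by move=> mA mB AB; rewrite -lee_fin -!PrE// le_measure// inE. Qed.

Lemma Pr_U A B : measurable A -> measurable B -> prob (A `|` B) <= prob A + prob B.
Proof.
move=> mA mB; rewrite -lee_fin EFinD -!PrE//; last exact: measurableU.
exact: measureU2.
Qed.

Lemma Pr_C A : measurable A -> prob (~` A) = 1 - prob A.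
Proof.
move=> mA; apply: EFin_inj; rewrite EFinB -!PrE//; last exact: measurableC.
exact: probability_setC.
Qed.

Lemma Pr_bigU (I : Type) (s : seq I) (A : I -> set Omega) :
  (forall i, measurable (A i)) ->
  prob (\big[setU/set0]_(i <- s) A i) <= \sum_(i <- s) prob (A i).
Proof.
move=> mA; elim: s => [|i s ih]; first by rewrite !big_nil /prob measure0.
rewrite !big_cons (le_trans (Pr_U _ _))//; last by rewrite lerD2l.
by elim: s {ih} => [|j s ih]; rewrite ?big_nil// big_cons; exact: measurableU.
Qed.

Lemma Pr_markov A X (c : R) : 0 < c -> measurable A -> bdd X ->
  (forall w, 0 <= X w) -> (forall w, A w -> c <= X w) -> prob A <= expect X / c.
Proof.
move=> c0 mA bX X0 XA; rewrite ler_pdivlMr// mulrC -Ex_indic// -ExZ//; last exact: bdd_indic.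
apply: Ex_le => // [|w]; first by apply: bddM; [exact: bdd_cst|exact: bdd_indic].
rewrite indicE; case: (boolP (w \in A)) => [/set_mem/XA|_]; rewrite ?mulr1//.
by rewrite mulr0.
Qed.

Lemma Ex_ae X Y : measurable_fun setT X -> measurable_fun setT Y ->
  ae_eq P setT X Y -> expect X = expect Y.
Proof.
move=> mX mY XY; congr fine; apply: ae_eq_integral => //.
- exact/measurable_EFinP.
- exact/measurable_EFinP.
- by move: XY; apply: filterS => w /= + _; move=> /(_ I) ->.
Qed.

Lemma Ex_le_ae X Y : bdd X -> bdd Y -> {ae P, forall w, X w <= Y w} -> expect X <= expect Y.
Proof.
move=> bX bY XY.
have bm : bdd (fun w => Num.min (X w) (Y w)).
  have [mX [C XC]] := bX; have [mY [D YD]] := bY; apply: (@bddP _ (C + D)).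
    exact: measurable_minr.
  move=> w; have C0 : 0 <= C by exact: le_trans (XC w).
  have D0 : 0 <= D by exact: le_trans (YD w).
  by rewrite minEle; case: ifP => _; [rewrite (le_trans (XC w))// lerDl|rewrite (le_trans (YD w))// lerDr].
rewrite (@Ex_ae X (fun w => Num.min (X w) (Y w))).
- by apply: Ex_le => // w; rewrite ge_min lexx orbT.
- by case: bX.
- by case: bm.
- by move: XY; apply: filterS => w XYw _; apply/esym/min_idPl.
Qed.

Lemma Ex0_ae X : bdd X -> (forall w, 0 <= X w) -> expect X = 0 -> {ae P, forall w, X w = 0}.
Proof.
move=> bX X0 EX.
have E0 : (\int[P]_w (X w)%:E = 0)%E.
  by rewrite -[LHS]fineK ?[fine _]EX//; apply: integrable_fin_num => //; exact: bdd_int.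
have : (\int[P]_w abse (X w)%:E = 0)%E.
  by rewrite -[RHS]E0; apply: eq_integral => w _; rewrite gee0_abs// lee_fin.
have mE : measurable_fun setT (EFin \o X) by apply/measurable_EFinP; case: bX.
move/(ae_eq_integral_abs P measurableT mE).
by apply: filterS => w /= /(_ I) [].
Qed.

(** Meant for the set [A] on which a density or a conditional expectation violates a bound, [h]
    being the amount of the violation. *)
Lemma integral_le0_null A (h : Omega -> R) : measurable A ->
  P.-integrable setT (EFin \o h) -> (forall w, A w -> 0 < h w) ->
  Rintegral P A h <= 0 -> P A = 0%E.
Proof.
move=> mA ih hA; have iA : P.-integrable A (EFin \o h).
  exact: integrableS ih.
have E0 : (0 <= \int[P]_(w in A) (h w)%:E)%E.
  by apply: integral_ge0 => w /hA/ltW; rewrite lee_fin.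
rewrite /Rintegral => h0.
have : (\int[P]_(w in A) abse (h w)%:E = 0)%E.
  transitivity (\int[P]_(w in A) (h w)%:E)%E.
    by apply: eq_integral => w /set_mem/hA/ltW w0; rewrite gee0_abs// lee_fin.
  apply/eqP; rewrite eq_le E0 andbT -[leLHS]fineK ?lee_fin//.
  exact: integrable_fin_num.
have mh : measurable_fun A (EFin \o h) by case/integrableP : iA.
move/(ae_eq_integral_abs P mA mh) => hae.
apply: measure_negligible => //; apply: negligibleS hae => w Aw /=.
by move/(_ Aw) => [] /eqP; rewrite gt_eqF// hA.
Qed.

End bounded.

(** * Weak convergence of bounded random variables *)

Section step_approximation.
Context {R : realType}.

Lemma step_approx (C e : R) : 0 < e -> exists n (c : nat -> R) (I : nat -> set R),
  (forall i, measurable (I i)) /\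
  forall x, `|x| <= C -> `|x - \sum_(i < n) c i * \1_(I i) x| <= e.
Proof.
move=> e0; pose c i : R := - C + i%:R * e.
exists (Num.truncn (2 * C / e)).+1, c, (fun i => `[c i, c i.+1[%classic).
split=> [i|x]; first exact: measurable_itv.
rewrite ler_norml => /andP[Cx xC].
pose k := Num.truncn ((x + C) / e).
have xC0 : 0 <= (x + C) / e by apply: divr_ge0; [lra|exact: ltW].
have /andP[k1 k2] : k%:R <= (x + C) / e < k.+1%:R by apply: truncn_itv.
move: k1 k2; rewrite ler_pdivlMr// ltr_pdivrMr// => k1 k2.
have kn : (k < (Num.truncn (2 * C / e)).+1)%N.
  rewrite ltnS; apply: le_truncn; rewrite ler_pM2r ?invr_gt0//; lra.
have inI i : \1_`[c i, c i.+1[%classic x = (i == k)%:R :> R.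
  rewrite indicE mem_setE in_itv/=; congr (nat_of_bool _)%:R.
  apply/idP/eqP => [/andP[c1 c2]|->]; last first.
    by apply/andP; split; rewrite /c; lra.
  rewrite /c in c1 c2; apply/eqP; rewrite eqn_leq; apply/andP; split.
    by rewrite -ltnS -(@ltr_nat R) -(ltr_pM2r e0) (le_lt_trans _ k2)//; lra.
  by rewrite -ltnS -(@ltr_nat R) -(ltr_pM2r e0) (le_lt_trans k1)//; lra.
rewrite (bigD1 (Ordinal kn))//= inI eqxx mulr1 big1 ?addr0; last first.
  move=> i ik; rewrite inI; case: eqP => [ik'|_]; last by rewrite mulr0.
  by move: ik; rewrite -val_eqE/= ik' eqxx.
rewrite /c ler_norml -natr1 mulrDl mul1r in k2 *; apply/andP; split; lra.
Qed.

End step_approximation.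

Lemma cvg_rsum {R : realType} {T I : Type} (U : set_system T) (s : seq I) (X : I -> T -> R)
  (l : I -> R) : Filter U -> (forall i, X i x @[x --> U] --> l i) ->
  \sum_(i <- s) X i x @[x --> U] --> \sum_(i <- s) l i.
Proof.
move=> FU Xl; elim: s => [|i s ih].
  by under eq_fun do rewrite big_nil; rewrite big_nil; exact: cvg_cst.
by under eq_fun do rewrite big_cons; rewrite big_cons; exact: cvgD.
Qed.

Section weak_convergence.
Context {d : measure_display} {Omega : measurableType d} {R : realType}.
Variable P : probability Omega R.
Local Notation Ex := (expect P).

Lemma Ex_indicM (X : Omega -> R) A : measurable A -> Ex (fun w => X w * \1_A w) = Rintegral P A X.
Proof.
move=> mA; rewrite /expect [RHS]Rintegral_mkcond; apply: eq_Rintegral => w _.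
by rewrite patchE indicE; case: ifP; rewrite ?mulr1 ?mulr0.
Qed.

Lemma indic_preimage (T U : Type) (h : T -> U) (A : set U) w :
  \1_(h @^-1` A) w = \1_A (h w) :> R.
Proof. by rewrite !indicE; congr (nat_of_bool _)%:R; apply/idP/idP; rewrite !inE. Qed.

Lemma bdd_cmp (I : set R) (h : Omega -> R) : measurable I -> measurable_fun setT h ->
  measurable (h @^-1` I).
Proof. by move=> mI mh; rewrite -[X in measurable X]setTI; exact: mh. Qed.

(** A bounded [S]-measurable test function is uniformly close to a step function over sets of [S],
    and convergence against indicators is linear in the indicator. The filter is left general so as
    to cover both sequences and ultrafilters. *)
Lemma wcv_test (S : set (set Omega)) (U : set_system nat) (X : nat -> Omega -> R)
    (Y h : Omega -> R) (C : R) :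
  ProperFilter U -> bdd h -> measurable_wrt S h ->
  (forall n, measurable_fun setT (X n)) -> (forall n w, `|X n w| <= C) ->
  measurable_fun setT Y -> (forall w, `|Y w| <= C) ->
  (forall B, S B -> measurable B -> Ex (fun w => X n w * \1_B w) @[n --> U] -->
     Ex (fun w => Y w * \1_B w)) ->
  Ex (fun w => X n w * h w) @[n --> U] --> Ex (fun w => Y w * h w).
Proof.
move=> FU bh Sh mX XC mY YC cv.
have [mh [D hD]] := bh.
have C0 : 0 <= C by rewrite (le_trans _ (YC point)).
apply/cvgrPdist_le => /= e e0.
(* [C + 1] instead of [C] keeps the quotient meaningful when [C = 0]. *)
pose e' : R := e / (4 * (C + 1)).
have e'0 : 0 < e' by rewrite divr_gt0// mulr_gt0// ltr_wpDl.
have eE : e = e' * (4 * (C + 1)).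
  by rewrite /e' mulfVK// gt_eqF// mulr_gt0// ltr_wpDl.
have Ce' : C * e' <= e / 4 by rewrite eE; lra.
have [n [c [I [mI hI]]]] := step_approx D e'0.
pose s (w : Omega) : R := \sum_(i < n) c i * \1_(I i) (h w).
have sE (Z : Omega -> R) : (forall w, `|Z w| <= C) -> measurable_fun setT Z ->
    Ex (fun w => Z w * s w) = \sum_(i < n) c i * Ex (fun w => Z w * \1_(h @^-1` I i) w).
  move=> ZC mZ; have bZ : bdd Z by exact: bddP ZC.
  have bi i : bdd (fun w => Z w * \1_(h @^-1` I i) w).
    by apply: bddM => //; apply: bdd_indic; exact: bdd_cmp.
  under [RHS]eq_bigr do rewrite -ExZ//.
  rewrite -Ex_sum; last by move=> i; apply: bddM => //; exact: bdd_cst.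
  congr (Ex _); apply/funext => w; rewrite /s mulr_sumr.
  by apply: eq_bigr => i _; rewrite mulrCA indic_preimage.
have bs : bdd s.
  apply: bdd_sum => i; apply: bddM; first exact: bdd_cst.
  rewrite (_ : (fun w => _) = \1_(h @^-1` I i)); last first.
    by apply/funext => w; rewrite indic_preimage.
  by apply: bdd_indic; exact: bdd_cmp.
have near_s (Z : Omega -> R) : (forall w, `|Z w| <= C) -> measurable_fun setT Z ->
    `|Ex (fun w => Z w * h w) - Ex (fun w => Z w * s w)| <= e / 4.
  move=> ZC mZ; have bZ : bdd Z by exact: bddP ZC.
  rewrite -ExB; [|exact: bddM..].
  have -> : (fun w => Z w * h w - Z w * s w) = (fun w => Z w * (h w - s w)).
    by apply/funext => w; rewrite mulrBr.
  apply: Ex_bnd => [|w].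
    by have [] : bdd (fun w => Z w * (h w - s w)) by apply: bddM => //; exact: bddB.
  rewrite normrM (le_trans _ Ce')// ler_pM//; exact: hI.
have cs : Ex (fun w => X n w * s w) @[n --> U] --> Ex (fun w => Y w * s w).
  under eq_fun do rewrite sE//.
  rewrite sE//; apply: cvg_rsum => i; apply: cvgM; first exact: cvg_cst.
  by apply: cv; [exact: Sh|exact: bdd_cmp].
move/cvgrPdist_le : cs => /(_ (e / 2)); rewrite divr_gt0// => /(_ isT).
apply: filterS => k; have := near_s _ (XC k) (mX k); have := near_s _ YC mY.
rewrite !ler_norml; lra.
Qed.

End weak_convergence.

(** * Conditional expectations of bounded random variables *)

Section radon_nikodym_bounded.
Context {d : measure_display} {T : measurableType d} {R : realType}.
Variables (Q : probability T R) (nu : set T -> R) (C : R).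
Hypothesis nuD : forall A B, measurable A -> measurable B -> A `&` B = set0 ->
  nu (A `|` B) = nu A + nu B.
Hypothesis nuC : forall A, measurable A -> `|nu A| <= C * prob Q A.

Let nu0 : (nu set0)%:E = 0%E.
Proof.
congr EFin; apply/eqP; rewrite -normr_le0 (le_trans (nuC measurable0))//.
by rewrite /prob measure0 mulr0.
Qed.

Let nu_fin A : measurable A -> (nu A)%:E \is a fin_num.
Proof. by []. Qed.

Let nu_bigsetU (F : nat -> set T) n : (forall i, measurable (F i)) -> trivIset setT F ->
  nu (\big[setU/set0]_(i < n) F i) = \sum_(i < n) nu (F i).
Proof.
move=> mF tF; elim: n => [|n ih].
  by rewrite !big_ord0; have [] := nu0.
rewrite !big_ord_recr/= nuD ?ih//; first exact: bigsetU_measurable.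
by apply: (@trivIset_bigsetUI _ predT) => // i j _ _; exact: tF.
Qed.

(** Finite additivity suffices: the domination by [C] times [Q] makes [nu] of the remainder of a
    union small along with its [Q]-measure. Set functions obtained as ultrafilter limits come with
    no more than finite additivity and this domination. *)
Let nu_sigma : semi_sigma_additive (fun A => (nu A)%:E).
Proof.
move=> F mF tF mUF; rewrite [X in X @ _ --> _](_ : _ =
    EFin \o (fun n => nu (\big[setU/set0]_(i < n) F i))); last first.
  by apply/funext => n/=; rewrite nu_bigsetU// big_mkord sumEFin.
apply/fine_cvgP; split; first by near=> n.
have mU n : measurable (\big[setU/set0]_(i < n) F i) by exact: bigsetU_measurable.
have cQ : prob Q (\big[setU/set0]_(i < n) F i) @[n --> \oo] --> prob Q (\bigcup_n F n).
  apply: fine_cvg; rewrite -PrE//.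
  have := @measure_semi_sigma_additive _ _ _ Q F mF tF mUF.
  apply: cvg_trans; apply: near_eq_cvg; near=> n.
  by rewrite big_mkord -measure_bigsetU.
apply/cvgrPdist_le => /= e e0; have C0 : 0 <= C.
  have := nuC measurableT; rewrite /prob probability_setT mulr1; exact: le_trans.
have e1 : 0 < e / (C + 1) by rewrite divr_gt0// ltr_wpDl.
move/cvgrPdist_le : cQ => /(_ _ e1); apply: filterS => n.
have sub : \big[setU/set0]_(i < n) F i `<=` \bigcup_n F n.
  by move=> x; rewrite -bigcup_mkord => -[i _ Fi]; exists i.
have mD : measurable ((\bigcup_n F n) `\` \big[setU/set0]_(i < n) F i) by exact: measurableD.
have dis : \big[setU/set0]_(i < n) F i `&`
    ((\bigcup_n F n) `\` \big[setU/set0]_(i < n) F i) = set0.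
  by rewrite setDE setICA setICr setI0.
have e2 : nu (\bigcup_n F n) = nu (\big[setU/set0]_(i < n) F i) +
    nu ((\bigcup_n F n) `\` \big[setU/set0]_(i < n) F i).
  by rewrite -nuD// setDUK.
have e3 : prob Q (\bigcup_n F n) = prob Q (\big[setU/set0]_(i < n) F i) +
    prob Q ((\bigcup_n F n) `\` \big[setU/set0]_(i < n) F i).
  apply: EFin_inj; rewrite EFinD -!PrE// -measureU ?setDUK//.
rewrite e2 e3 !(addrC (_ (\big[setU/set0]_(i < n) F i))) !addrK ger0_norm ?Pr_ge0// => h.
rewrite (le_trans (nuC mD))//; move: h.
have C1 : 0 < 1 + C by lra.
rewrite ler_pdivlMr// => h; have := Pr_ge0 Q ((\bigcup_n F n) `\` \big[setU/set0]_(i < n) F i).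
lra.
Unshelve. all: by end_near. Qed.

Lemma radon_nikodym_bounded : exists g : T -> R,
  [/\ measurable_fun setT g, (forall w, `|g w| <= C) &
      forall A, measurable A -> nu A = expect Q (fun w => g w * \1_A w)].
Proof.
have C0 : 0 <= C.
  have := nuC measurableT; rewrite /prob probability_setT mulr1; exact: le_trans.
pose nuc : {charge set T -> \bar R} := HB.pack (fun A : set T => (nu A)%:E)
  (isCharge.Build _ _ _ (fun A : set T => (nu A)%:E) nu0 nu_fin nu_sigma).
have dom : nuc `<< Q.
  apply/null_content_dominatesP => A mA QA; congr EFin; apply/eqP.
  by rewrite -normr_le0 (le_trans (nuC mA))// /prob QA mulr0.
pose g0 := Radon_Nikodym nuc Q.
have g0fin w : g0 w \is a fin_num by exact: Radon_Nikodym_fin_num.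
pose g w := fine (g0 w).
have gE : EFin \o g = g0 by apply/funext => w /=; rewrite fineK.
have ig : Q.-integrable setT (EFin \o g).
  by rewrite gE; exact: Radon_Nikodym_integrable.
have mg : measurable_fun setT g by apply/measurable_EFinP; case/integrableP : ig.
have nug A : measurable A -> (nu A)%:E = (\int[Q]_(w in A) (g w)%:E)%E.
  move=> mA; rewrite -[LHS]/(nuc A) (Radon_Nikodym_integral dom mA).
  by apply: eq_integral => w _; rewrite -/g0 -gE.
pose B1 := [set w | C < g w]; pose B2 := [set w | g w < - C].
have mB1 : measurable B1.
  by rewrite (_ : B1 = g @^-1` `]C, +oo[); [exact: bdd_cmp|apply/seteqP; split=> w; rewrite /= in_itv/= andbT].
have mB2 : measurable B2.
  by rewrite (_ : B2 = g @^-1` `]-oo, - C[); [exact: bdd_cmp|apply/seteqP; split=> w; rewrite /= in_itv/=].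
have Rg A : measurable A -> Rintegral Q A g = nu A by move=> mA; rewrite /Rintegral -nug.
have ic c : Q.-integrable setT (EFin \o (fun=> c : R)).
  by apply: bdd_int; exact: bdd_cst.
have Q1 : Q B1 = 0%E.
  apply: (@integral_le0_null _ _ _ _ _ (fun w => g w - C)) => // [|w|].
  - exact: (integrableB measurableT ig (ic C)).
  - by rewrite /B1/= subr_gt0.
  - rewrite RintegralB//; [|exact: integrableS ig|exact: integrableS (ic C)].
    rewrite Rg// Rintegral_cst// subr_le0; exact: le_trans (ler_norm _) (nuC _).
have Q2 : Q B2 = 0%E.
  apply: (@integral_le0_null _ _ _ _ _ (fun w => - C - g w)) => // [|w|].
  - exact: (integrableB measurableT (ic (- C)) ig).
  - by rewrite /B2/= subr_gt0.
  - rewrite RintegralB//; [|exact: integrableS (ic (- C))|exact: integrableS ig].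
    rewrite Rg// Rintegral_cst// subr_le0 mulNr lerNl.
    by apply: le_trans (nuC mB2); rewrite -normrN ler_norm.
(* The density lies in [[- C, C]] outside a null set; clamping makes the bound hold at every
   point. *)
pose g' w := Num.max (- C) (Num.min C (g w)).
have g'C w : `|g' w| <= C.
  by rewrite /g' ler_norml le_max lexx/= ge_max ge_min lexx/= andbT; lra.
have mg' : measurable_fun setT g'.
  by apply: measurable_maxr => //; exact: measurable_minr.
exists g'; split => // A mA; rewrite -Rg// -Ex_indicM//.
rewrite /expect [LHS]/Rintegral [RHS]/Rintegral; congr fine.
apply: ae_eq_integral => //.
- by apply/measurable_EFinP; apply: measurable_funM => //; exact: measurable_indic.
- by apply/measurable_EFinP; apply: measurable_funM => //; exact: measurable_indic.
have : Q.-negligible (B1 `|` B2).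
  by apply: negligibleU; apply/negligibleP.
apply: negligibleS => w /= /not_implyP[_]; apply: contra_notP => /not_orP[].
rewrite /B1/B2/= => /negP; rewrite -leNgt => gC /negP; rewrite -leNgt => Cg.
by congr (_ * _)%:E; rewrite /g' (min_idPr gC) (max_idPr Cg).
Qed.

End radon_nikodym_bounded.

(** * Densities on sub-sigma-algebras, conditional expectations and ultrafilter limits *)

Section sub_sigma_algebra.
Context {d : measure_display} {Omega : measurableType d} {R : realType}.
Variable P : probability Omega R.
Local Notation Ex := (expect P).
Implicit Types S : set (set Omega).

Lemma measurable_wrt_fun S (g : Omega -> R) : S `<=` measurable ->
  measurable_wrt S g -> measurable_fun setT g.
Proof. by move=> Sm Sg _ Y mY; rewrite setTI; apply: Sm; exact: Sg. Qed.

(** [S] is made the measurable structure of a second copy of [Omega]. The identity map into that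
    copy is measurable and pushes [P] forward to its restriction to [S]. *)
Lemma radon_nikodym_sub S (nu : set Omega -> R) (C : R) :
  sigma_algebra setT S -> S `<=` measurable ->
  (forall A B, S A -> S B -> A `&` B = set0 -> nu (A `|` B) = nu A + nu B) ->
  (forall A, S A -> `|nu A| <= C * prob P A) ->
  exists g : Omega -> R, [/\ measurable_wrt S g, (forall w, `|g w| <= C) &
    forall A, S A -> nu A = Ex (fun w => g w * \1_A w)].
Proof.
move=> aS Sm nuD nuC.
pose T' : measurableType _ := g_sigma_algebraType S.
have mS (A : set T') : measurable A -> S A.
  by rewrite -[X in X A -> _]/(<<s S >>) sigma_algebra_id.
have Sm' (A : set T') : S A -> measurable A by exact: sub_sigma_algebra.
pose idS : Omega -> T' := id.
have mid : measurable_fun setT idS by move=> _ Y mY; rewrite setTI; apply: Sm; exact: mS.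
pose X : {RV P >-> T'} := HB.pack idS (isMeasurableFun.Build _ _ _ _ idS mid).
pose Q : probability T' R := distribution P X.
have [|A mA|g [mg gC gE]] := @radon_nikodym_bounded _ _ _ Q nu C.
- by move=> A B mA mB AB; apply: nuD => //; exact: mS.
- by apply: nuC; exact: mS.
exists g; split=> // [Y mY|A SA].
  by apply: mS; rewrite -[X in measurable X]setTI; exact: mg.
have mA := Sm' _ SA; rewrite gE//.
have bgA : bdd (fun w : T' => g w * \1_A w).
  by apply: bddM; [exact: bddP gC|exact: bdd_indic].
congr fine; have [mgA [D gAD]] := bgA.
rewrite integral_pushforward//; first exact/measurable_EFinP.
apply: bdd_int; apply: (@bddP _ _ _ _ D) => //.
apply: (@measurable_comp _ _ _ _ _ _ setT (fun w : T' => g w * \1_A w) _ idS) => //.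
Qed.

Lemma cond_exp_exists S (X : Omega -> R) (C : R) :
  sigma_algebra setT S -> S `<=` measurable ->
  measurable_fun setT X -> (forall w, `|X w| <= C) ->
  exists g : Omega -> R, [/\ measurable_wrt S g, (forall w, `|g w| <= C) &
    forall A, S A -> Ex (fun w => X w * \1_A w) = Ex (fun w => g w * \1_A w)].
Proof.
move=> aS Sm mX XC; have bX : bdd X by exact: bddP XC.
have bXA A : S A -> bdd (fun w => X w * \1_A w).
  by move=> SA; apply: bddM => //; apply: bdd_indic; exact: Sm.
apply: (radon_nikodym_sub (nu := fun A => Ex (fun w => X w * \1_A w))) => //.
- move=> A B SA SB AB; rewrite -ExD; [|exact: bXA..].
  congr (Ex _); apply/funext => w; rewrite -mulrDr; congr (_ * _).
  rewrite !indicE in_setU; case: (boolP (w \in A)) => wA; case: (boolP (w \in B)) => wB /=;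
    rewrite ?addr0 ?add0r//.
  by move: AB; rewrite -subset0 => /(_ w); case; split; exact: set_mem.
- move=> A SA; rewrite (le_trans (Ex_abs P (bXA _ SA)))// -Ex_indic; last exact: Sm.
  rewrite -ExZ; last by apply: bdd_indic; exact: Sm.
  apply: Ex_le => [||w].
  + exact/bdd_norm/bXA.
  + by apply: bddM; [exact: bdd_cst|apply: bdd_indic; exact: Sm].
  + by rewrite normrM [X in _ * X]ger0_norm// ler_wpM2r// indicE.
Qed.

Lemma ultra_cvg (U : set_system nat) (a : nat -> R) (C : R) : UltraFilter U ->
  (forall n, `|a n| <= C) -> exists2 l, `|l| <= C & a n @[n --> U] --> l.
Proof.
move=> UU aC.
have Ua : (a @ U) [set` `[- C, C]].
  by apply: (@filterS _ U _ setT) => [n _|]; [rewrite /= in_itv/= -ler_norml; exact: aC|exact: filterT].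
have [l [Cl cl]] := @segment_compact _ (- C) C (a @ U) _ Ua.
exists l; first by move: Cl; rewrite /= in_itv/= -ler_norml.
move=> V Vl; have [//|UV] := in_ultra_setVsetC (a @^-1` V) UU.
by have [x [/= nVx Vx]] := cl (~` V) V UV Vl.
Qed.

(** For each [B] the bounded numbers [Ex (X n * \1_B)] converge along [U]; their limits are additive
    in [B] and dominated by [C] times the probability of [B], so they have a density. *)
Lemma wlim_ultra_exists (U : set_system nat) (X : nat -> Omega -> R) (C : R) :
  UltraFilter U -> (forall n, measurable_fun setT (X n)) -> (forall n w, `|X n w| <= C) ->
  exists Y : Omega -> R, [/\ measurable_fun setT Y, (forall w, `|Y w| <= C) &
    forall B, measurable B ->
      Ex (fun w => X n w * \1_B w) @[n --> U] --> Ex (fun w => Y w * \1_B w)].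
Proof.
move=> UU mX XC; have bX n : bdd (X n) by exact: bddP (XC n).
have bXB n B : measurable B -> bdd (fun w => X n w * \1_B w).
  by move=> mB; apply: bddM => //; exact: bdd_indic.
have bnd n B : measurable B -> `|Ex (fun w => X n w * \1_B w)| <= C * prob P B.
  move=> mB; rewrite (le_trans (Ex_abs P (bXB _ _ mB)))// -Ex_indic//.
  rewrite -ExZ; last exact: bdd_indic.
  apply: Ex_le => [||w].
  + exact/bdd_norm/bXB.
  + by apply: bddM; [exact: bdd_cst|exact: bdd_indic].
  + by rewrite normrM [X in _ * X]ger0_norm// ler_wpM2r// indicE.
pose nu B := lim (Ex (fun w => X n w * \1_B w) @[n --> U]).
have nuP B : measurable B ->
    `|nu B| <= C * prob P B /\ Ex (fun w => X n w * \1_B w) @[n --> U] --> nu B.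
  move=> mB; have [l lC cl] := @ultra_cvg U _ (C * prob P B) UU (fun n => bnd n B mB).
  by rewrite /nu (cvg_lim _ cl).
have mm : sigma_algebra setT (@measurable _ Omega) := sigma_algebra_measurable _.
have [||g [Sg gC gE]] := @radon_nikodym_sub (@measurable _ Omega) nu C mm (fun _ => id).
- move=> A B mA mB AB; have mAB : measurable (A `|` B) by exact: measurableU.
  apply/cvg_lim => //.
  have e n : Ex (fun w => X n w * \1_(A `|` B) w) =
      Ex (fun w => X n w * \1_A w) + Ex (fun w => X n w * \1_B w).
    rewrite -ExD; [|exact: bXB..].
    congr (Ex _); apply/funext => w; rewrite -mulrDr; congr (_ * _).
    rewrite !indicE in_setU; case: (boolP (w \in A)) => wA; case: (boolP (w \in B)) => wB /=;
      rewrite ?addr0 ?add0r//.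
    by move: AB; rewrite -subset0 => /(_ w); case; split; exact: set_mem.
  under eq_fun do rewrite e.
  by apply: cvgD; [have [] := nuP A mA|have [] := nuP B mB].
- by move=> A mA; have [] := nuP A mA.
exists g; split=> // [|B mB]; first exact: measurable_wrt_fun Sg.
by rewrite -gE//; have [] := nuP B mB.
Qed.

Lemma sigma_from_measurable (f : nat -> Omega -> R) m :
  (forall n, measurable_fun setT (f n)) -> sigma_from f m `<=` measurable.
Proof.
move=> mf; apply: smallest_sub; first exact: sigma_algebra_measurable.
by move=> _ [n _ [B mB <-]]; exact: mf.
Qed.

Lemma tail_measurable (f : nat -> Omega -> R) :
  (forall n, measurable_fun setT (f n)) -> tail_sigma f `<=` measurable.
Proof. by move=> mf A /(_ 0%N I); exact: sigma_from_measurable. Qed.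

Lemma sigma_from_sigma_algebra (f : nat -> Omega -> R) m : sigma_algebra setT (sigma_from f m).
Proof. exact: smallest_sigma_algebra. Qed.

Lemma tail_sigma_algebra (f : nat -> Omega -> R) : sigma_algebra setT (tail_sigma f).
Proof.
have s m := @sigma_from_sigma_algebra f m; split => [m _|A tA m _|A tA m _].
- by have [] := s m.
- by have [_ + _] := s m; apply; exact: tA.
- by have [_ _ +] := s m; apply => n; exact: tA.
Qed.

Lemma measurable_wrt_sigma_from (f : nat -> Omega -> R) m n (u : R -> R) :
  (m <= n)%N -> measurable_fun setT u -> measurable_wrt (sigma_from f m) (u \o f n).
Proof.
move=> mn mu Y mY; apply: sub_sigma_algebra; exists n => //=.
exists (u @^-1` Y); first by rewrite -[X in measurable X]setTI; exact: mu.
by rewrite setTI.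
Qed.

Lemma measurable_wrt_comp (S : set (set Omega)) (g : Omega -> R) (u : R -> R) :
  measurable_fun setT u -> measurable_wrt S g -> measurable_wrt S (u \o g).
Proof.
by move=> mu Sg Y mY; apply: (Sg (u @^-1` Y)); rewrite -[X in measurable X]setTI; exact: mu.
Qed.

Lemma measurable_wrt_limn_sup (S : set (set Omega)) (h : nat -> Omega -> R) C :
  sigma_algebra setT S -> (forall n, measurable_wrt S (h n)) ->
  (forall n w, `|h n w| <= C) -> measurable_wrt S (fun w => limn_sup (h ^~ w)).
Proof.
move=> aS Sh hC; pose T' : measurableType _ := g_sigma_algebraType S.
have mS (A : set T') : measurable A -> S A.
  by rewrite -[X in X A -> _]/(<<s S >>) sigma_algebra_id.
have : measurable_fun setT (fun w : T' => limn_sup (h ^~ w)).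
  apply: (@measurable_fun_limn_sup _ T' R setT h) => [w _|w _|n].
  - by exists C => _ [n _ <-]; rewrite (le_trans (ler_norm _)).
  - by exists (- C) => _ [n _ <-]; have := hC n w; rewrite ler_norml => /andP[].
  - by move=> _ Y mY; rewrite setTI; apply: sub_sigma_algebra; exact: Sh.
by move=> mh Y mY; apply: mS; rewrite -[X in measurable X]setTI; exact: mh.
Qed.

Lemma limn_sup_shift (a : nat -> R) m : limn_sup (fun n => a (n + m)%N) = limn_sup a.
Proof.
have E : sups (fun n => a (n + m)%N) = (fun n => sups a (n + m)%N).
  apply/funext => n; rewrite /sups/=; congr sup; apply/seteqP; split=> _ [k /= nk <-].
    by exists (k + m)%N => //=; rewrite leq_add2r.
  have mk : (m <= k)%N by apply: leq_trans nk; exact: leq_addl.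
  by exists (k - m)%N; rewrite /= ?subnK// leq_subRL// addnC.
rewrite /limn_sup /lim E; congr (get _); apply/funext => l.
exact: (cvg_shiftn m (sups a)).
Qed.

End sub_sigma_algebra.

(** * Tail measurability of weak limits *)

Section tail_limits.
Context {d : measure_display} {Omega : measurableType d} {R : realType}.
Variable P : probability Omega R.
Local Notation Ex := (expect P).

Lemma measurable_clamp (C : R) : measurable_fun setT (fun x : R => Num.max (- C) (Num.min C x)).
Proof. by apply: measurable_maxr => //; exact: measurable_minr. Qed.

Lemma norm_clamp (C x : R) : 0 <= C -> `|Num.max (- C) (Num.min C x)| <= C.
Proof. by move=> C0; rewrite ler_norml le_max lexx/= ge_max ge_min lexx/= andbT; lra. Qed.

Lemma clamp_id (C x : R) : `|x| <= C -> Num.max (- C) (Num.min C x) = x.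
Proof. by rewrite ler_norml => /andP[Cx xC]; rewrite (min_idPr xC) (max_idPr Cx). Qed.

Lemma Ex0 (h : Omega -> R) : Ex (fun w => 0 * h w) = 0.
Proof. by under eq_fun do rewrite mul0r; rewrite Ex_cst. Qed.

(** The constant sequence [Z] converges to 0 against indicators of sets of [S], hence against every
    bounded [S]-measurable function. *)
Lemma Ex_orthogonal (S : set (set Omega)) (Z h : Omega -> R) : bdd Z -> bdd h -> measurable_wrt S h ->
  (forall A, S A -> measurable A -> Ex (fun w => Z w * \1_A w) = 0) ->
  Ex (fun w => Z w * h w) = 0.
Proof.
move=> [mZ [C ZC]] bh Sh Z0.
have C0 : 0 <= C by rewrite (le_trans _ (ZC point)).
have : Ex (fun w => Z w * h w) @[n --> \oo] --> Ex (fun w => 0 * h w).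
  apply: (@wcv_test _ _ _ P S \oo (fun=> Z) (fun=> 0) h C) => //.
  - by move=> w; rewrite normr0.
  - by move=> B SB mB; under eq_fun do rewrite Z0//; rewrite Ex0; exact: cvg_cst.
rewrite Ex0 => cv.
by apply: (cvg_unique _ _ cv) => //; exact: cvg_cst.
Qed.

Lemma Ex_sqr0_ae (X Y : Omega -> R) : bdd X -> bdd Y -> Ex (fun w => (X w - Y w) ^+ 2) = 0 ->
  {ae P, forall w, X w = Y w}.
Proof.
move=> bX bY e; have := Ex0_ae (bddX 2 (bddB bX bY)) (fun w => sqr_ge0 _) e.
by apply: filterS => w /eqP; rewrite sqrf_eq0 subr_eq0 => /eqP.
Qed.

(* The weak limit agrees almost everywhere with its conditional expectation given
   [sigma_from f m], for every [m]; the limsup over [m] of these versions is tail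
   measurable. *)
Lemma wlim_ultra_tail (f : nat -> Omega -> R) (u : R -> R) (C : R) (U : set_system nat) :
  (forall n, measurable_fun setT (f n)) ->
  measurable_fun setT u -> (forall x, `|u x| <= C) ->
  UltraFilter U -> (forall m, U [set n | (m <= n)%N]) ->
  exists Y : Omega -> R, [/\ measurable_wrt (tail_sigma f) Y, (forall w, `|Y w| <= C) &
    forall B, measurable B ->
      Ex (fun w => u (f n w) * \1_B w) @[n --> U] --> Ex (fun w => Y w * \1_B w)].
Proof.
move=> mf mu uC UU Uoo; have FU : ProperFilter U by exact: ultra_proper.
have C0 : 0 <= C by rewrite (le_trans _ (uC 0)).
have muf n : measurable_fun setT (u \o f n) by exact: measurableT_comp.
have buf n : bdd (u \o f n) by apply: (@bddP _ _ _ _ C) => // w; exact: uC.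
have [Y0 [mY0 Y0C cY0]] := @wlim_ultra_exists _ _ _ P U (fun n => u \o f n) C UU muf
  (fun n w => uC (f n w)).
have bY0 : bdd Y0 by exact: bddP Y0C.
have /choice[Yn Ynp] m := @cond_exp_exists _ _ _ P (sigma_from f m) Y0 C
  (@sigma_from_sigma_algebra _ _ _ f m) (sigma_from_measurable (m := m) mf) mY0 Y0C.
have sYn m : measurable_wrt (sigma_from f m) (Yn m) by case: (Ynp m).
have YnC m w : `|Yn m w| <= C by case: (Ynp m).
have mYn m : measurable_fun setT (Yn m).
  by apply: measurable_wrt_fun (sYn m); exact: sigma_from_measurable.
have bYn m : bdd (Yn m) by exact: bddP (YnC m).
have Y0Yn m : {ae P, forall w, Y0 w = Yn m w}.
  apply: Ex_sqr0_ae => //.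
  have bD : bdd (fun w => Y0 w - Yn m w) by exact: bddB.
  have orth h : bdd h -> measurable_wrt (sigma_from f m) h ->
      Ex (fun w => (Y0 w - Yn m w) * h w) = 0.
    move=> bh Sh; apply: (@Ex_orthogonal (sigma_from f m)) => // A SA mA.
    have bA : bdd (\1_A : Omega -> R) by exact: bdd_indic.
    under eq_fun do rewrite mulrBl.
    rewrite ExB; [|exact: bddM..].
    by have [_ _ ->//] := Ynp m; rewrite subrr.
  (* For [n >= m] the function [u \o f n] is measurable with respect to [sigma_from f m], hence
     orthogonal to [Y0 - Yn m]; the weak limit [Y0] inherits this. *)
  have oY0 : Ex (fun w => (Y0 w - Yn m w) * Y0 w) = 0.
    have [mD _] := bD.
    have : Ex (fun w => (u \o f n) w * (Y0 w - Yn m w)) @[n --> U] -->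
        Ex (fun w => Y0 w * (Y0 w - Yn m w)).
      apply: (@wcv_test _ _ _ P measurable U _ _ _ C) => //.
      - by move=> Y mY; exact: bdd_cmp.
      - by move=> n w; exact: uC.
      - by move=> B mB _; exact: cY0.
    have c0 : Ex (fun w => (u \o f n) w * (Y0 w - Yn m w)) @[n --> U] --> (0 : R).
      apply: cvg_near_cst; apply: filterS (Uoo m) => n mn /=.
      rewrite -[RHS](orth (u \o f n))//; last exact: measurable_wrt_sigma_from.
      by congr (expect _ _); apply/funext => w; rewrite mulrC.
    move=> /(cvg_unique _ c0) => /(_ _)/esym <- //.
    by congr (expect _ _); apply/funext => w; rewrite mulrC.
  rewrite -[RHS](subrr (0 : R)) -{1}oY0 -(orth (Yn m))// -ExB; [|exact: bddM..].
  by congr (expect _ _); apply/funext => w; rewrite -mulrBr expr2.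
pose Y w := Num.max (- C) (Num.min C (limn_sup (Yn ^~ w))).
have YC w : `|Y w| <= C by exact: norm_clamp.
have sY : measurable_wrt (tail_sigma f) Y.
  apply: (measurable_wrt_comp (measurable_clamp C)) => B mB m _.
  have -> : (fun w => limn_sup (Yn ^~ w)) = fun w => limn_sup (fun n => Yn (n + m)%N w).
    by apply/funext => w; rewrite (limn_sup_shift (Yn ^~ w)).
  apply: (@measurable_wrt_limn_sup _ _ R (sigma_from f m) (fun n => Yn (n + m)%N) C) => //.
    exact: sigma_from_sigma_algebra.
  move=> n A mA; have := sYn (n + m)%N A mA.
  apply: sub_sigma_algebra2 => _ [k /= nk [B' mB' <-]].
  by exists k; [exact: leq_trans (leq_addl n m) nk|exists B'].
exists Y; split=> // B mB.
have mY : measurable_fun setT Y by apply: measurable_wrt_fun sY; exact: tail_measurable.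
suff -> : Ex (fun w => Y w * \1_B w) = Ex (fun w => Y0 w * \1_B w) by exact: cY0.
apply: Ex_ae => //.
- by apply: measurable_funM => //; exact: measurable_indic.
- by apply: measurable_funM => //; exact: measurable_indic.
- move/ae_foralln : Y0Yn; apply: filterS => w Yw _; congr (_ * _).
  rewrite /Y (_ : Yn ^~ w = fun=> Y0 w); last by apply/funext => n; rewrite (Yw n).
  have -> : limn_sup (fun=> Y0 w) = Y0 w.
    by apply/cvg_lim => //; apply: cvg_sups; exact: cvg_cst.
  exact: clamp_id.
Qed.

End tail_limits.

(** * Weakly convergent subsequences *)

(** Recursive selection in which the condition on the next index may refer to the whole list of
    indices chosen before it. *)
Lemma diag_choice (Q : seq nat -> nat -> Prop) :
  (forall s, exists n, (forall m, m \in s -> (m < n)%N) /\ Q s n) ->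
  exists phi, strict_incr phi /\ forall j, Q (map phi (iota 0 j)) (phi j).
Proof.
move=> /choice[next nextP].
pose pre j := iter j (fun s => rcons s (next s)) [::].
pose phi j := next (pre j).
have preE j : pre j = map phi (iota 0 j).
  by elim: j => // j ih; rewrite /pre iterS -/(pre j) -addn1 iotaD map_cat/= cats1 -ih.
exists phi; split=> [a b ab|j]; last by rewrite -preE; have [] := nextP (pre j).
have [h _] := nextP (pre b); apply: h; rewrite preE.
by apply/mapP; exists a => //; rewrite mem_iota.
Qed.

Lemma filter_seq_forall (T : Type) (I : eqType) (U : set_system T) (s : seq I) (A : I -> set T) :
  Filter U -> (forall i, i \in s -> U (A i)) -> U [set x | forall i, i \in s -> A i x].
Proof.
move=> FU; elim: s => [_|i s ih UA]; first by apply: filterS filterT => x _ i.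
have Us : U [set x | forall j, j \in s -> A j x] by apply: ih => j js; apply: UA; rewrite inE js orbT.
apply: (filterS _ (filterI (UA i (mem_head _ _)) Us)) => x [Ai As] j.
by rewrite inE => /orP[/eqP ->//|/As].
Qed.

Lemma strict_incr_ge (k : nat -> nat) n : strict_incr k -> (n <= k n)%N.
Proof. by move=> ik; elim: n => // n ih; rewrite (leq_ltn_trans ih)// ik. Qed.

Lemma strict_incr_comp (k l : nat -> nat) : strict_incr k -> strict_incr l -> strict_incr (k \o l).
Proof. by move=> ik il a b ab; apply/ik/il. Qed.

Lemma strict_incr_cvg (k : nat -> nat) : strict_incr k -> k @ \oo --> \oo.
Proof.
move=> ik A [N _ NA]; exists N => // n /= Nn; apply: NA => /=.
by rewrite (leq_trans Nn)// strict_incr_ge.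
Qed.

(** * Almost orthogonal sequences *)

Section almost_orthogonal.
Context {d : measure_display} {Omega : measurableType d} {R : realType}.
Variable P : probability Omega R.
Local Notation Ex := (expect P).

(** Adding term [n] costs at most [a + 2]: its square contributes [a], and its [n] products with
    earlier terms contribute twice a sum of [n] numbers below [1 / (n + 1)]. The weight [W] allows
    restriction to an event. *)
Lemma Ex_weighted_sum_sqr (W : Omega -> R) (Z : nat -> Omega -> R) (a : R) n : bdd W ->
  (forall i, bdd (Z i)) -> (forall i, (i < n)%N -> Ex (fun w => W w * Z i w ^+ 2) <= a) ->
  (forall i j, (i < j)%N -> (j < n)%N -> `|Ex (fun w => W w * (Z i w * Z j w))| <= j.+1%:R^-1) ->
  Ex (fun w => W w * (\sum_(i < n) Z i w) ^+ 2) <= n%:R * (a + 2).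
Proof.
move=> bW bZ; elim: n => [_ _|n ih Za Zo].
  by under eq_fun do rewrite big_ord0 expr0n/= mulr0; rewrite Ex_cst mul0r.
have bS : bdd (fun w => \sum_(i < n) Z i w) by apply: bdd_sum.
have -> : (fun w => W w * (\sum_(i < n.+1) Z i w) ^+ 2) = fun w =>
    W w * (\sum_(i < n) Z i w) ^+ 2 + (2 * (\sum_(i < n) W w * (Z i w * Z n w)) + W w * Z n w ^+ 2).
  apply/funext => w; rewrite big_ord_recr/= -mulr_sumr -mulr_suml; ring.
have bc i : bdd (fun w => W w * (Z i w * Z n w)) by do 2 apply: bddM => //.
have bs : bdd (fun w => \sum_(i < n) W w * (Z i w * Z n w)).
  by apply: (bdd_sum _ _ (X := fun i : 'I_n => fun w => W w * (Z i w * Z n w))) => i.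
have b2 : bdd (fun w => 2 * \sum_(i < n) W w * (Z i w * Z n w)).
  by apply: bddM => //; exact: bdd_cst.
have b3 : bdd (fun w => W w * Z n w ^+ 2) by apply: bddM => //; exact: bddX.
rewrite ExD//; [|by apply: bddM => //; exact: bddX|exact: bddD].
rewrite ExD// ExZ// Ex_sum; last by move=> i; exact: bc.
have h1 := ih (fun i ni => Za i (ltnW ni)) (fun i j ij nj => Zo i j ij (ltnW nj)).
have h2 := Za n (leqnn _).
have h3 : \sum_(i < n) Ex (fun w => W w * (Z i w * Z n w)) <= n%:R * n.+1%:R^-1.
  have -> : n%:R * n.+1%:R^-1 = \sum_(i < n) n.+1%:R^-1 :> R.
    by rewrite sumr_const card_ord mulr_natl.
  apply: ler_sum => i _.
  by rewrite (le_trans (ler_norm _))// Zo.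
have h4 : n%:R * n.+1%:R^-1 <= 1 :> R.
  by rewrite ler_pdivrMr// mul1r ler_nat.
have h5 := le_trans h3 h4.
lra.
Qed.

(* If the integrals of [Z n * h] exceed [eta] with constant sign on a finite set [J],
   Cauchy-Schwarz for [h] and the sum of [Z] over [J] gives eta |J| = O(sqrt |J|). *)
Lemma almost_orthogonal_wcv0 (Z : nat -> Omega -> R) (C : R) (h : Omega -> R) :
  (forall n, measurable_fun setT (Z n)) -> (forall n w, `|Z n w| <= C) -> bdd h ->
  (forall i j, (i < j)%N -> `|Ex (fun w => Z i w * Z j w)| <= j.+1%:R^-1) ->
  Ex (fun w => Z n w * h w) @[n --> \oo] --> (0 : R).
Proof.
move=> mZ ZC bh Zo; have bZ n : bdd (Z n) by exact: bddP (ZC n).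
apply: contrapT => /cvgrPdist_le/existsNP[/= eta /not_implyP[eta0]] nc.
have often n0 : exists n, (n0 < n)%N /\ eta < `|Ex (fun w => Z n w * h w)|.
  apply: contrapT => /forallNP H; apply: nc; exists n0.+1 => // n /= n0n.
  by rewrite sub0r normrN leNgt; apply/negP => lt; apply: (H n).
have [psi [ipsi psiP]] : exists psi, strict_incr psi /\
    forall j, eta < `|Ex (fun w => Z (psi j) w * h w)|.
  apply: (@diag_choice (fun _ n => eta < `|Ex (fun w => Z n w * h w)|)) => s.
  have [n [sn en]] := often (\max_(i <- s) i)%N; exists n; split=> // m ms.
  by rewrite (leq_ltn_trans _ sn)// (big_rem m ms)/= leq_maxl.
(* Multiplication by the signs makes all the integrals positive, and it preserves almost
   orthogonality because the signs have modulus at most 1. *)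
pose sg j : R := Num.sg (Ex (fun w => Z (psi j) w * h w)).
pose z j w := sg j * Z (psi j) w.
have bz j : bdd (z j) by apply: bddM => //; exact: bdd_cst.
have sg1 j : `|sg j| <= 1 by rewrite /sg normr_sg; case: eqP => /=; rewrite ?ler01.
have C0 : 0 <= C by rewrite (le_trans _ (ZC 0%N point)).
have zC j w : `|z j w| <= C.
  by rewrite /z normrM (le_trans _ (ZC (psi j) w))// ler_piMl.
have zh j : eta < Ex (fun w => z j w * h w).
  under eq_fun do rewrite /z -mulrA.
  by rewrite ExZ; [rewrite -normrEsg; exact: psiP|exact: bddM].
pose H := Ex (fun w => h w ^+ 2).
have H0 : 0 <= H by apply: Ex_ge0 => w; exact: sqr_ge0.
(* Weight for the inequality between arithmetic and geometric means: with [c * H <= eta], the part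
   containing [h] absorbs at most half of [n * eta]. *)
pose c := eta / (H + 1).
have c0 : 0 < c by rewrite divr_gt0// ltr_wpDl.
have cH : c * H <= eta.
  by rewrite /c mulrAC ler_pdivrMr ?ltr_wpDl// ler_pM2l//; lra.
have key n : (0 < n)%N -> n%:R * eta <= (C ^+ 2 + 2) / c.
  move=> n0; have nR : 0 < n%:R :> R by rewrite ltr0n.
  have cn : 0 < 2 * c * n%:R by apply: mulr_gt0 => //; apply: mulr_gt0.
  pose S w := \sum_(i < n) z i w.
  have bS : bdd S by exact: bdd_sum.
  have eS : n%:R * eta <= Ex (fun w => S w * h w).
    have -> : (fun w => S w * h w) = fun w => \sum_(i < n) z i w * h w.
      by apply/funext => w; rewrite /S mulr_suml.
    rewrite (Ex_sum P _ _ (X := fun i : 'I_n => fun w => z i w * h w)); last first.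
      by move=> i; exact: bddM.
    have -> : n%:R * eta = \sum_(i < n) eta by rewrite sumr_const card_ord mulr_natl.
    by apply: ler_sum => i _; exact: ltW.
  have eS2 : Ex (fun w => S w ^+ 2) <= n%:R * (C ^+ 2 + 2).
    have := @Ex_weighted_sum_sqr (fun=> 1) z (C ^+ 2) n (bdd_cst 1) bz.
    under eq_fun do rewrite mul1r; apply=> [i _|i j ij _].
      under eq_fun do rewrite mul1r; rewrite -[leRHS](Ex_cst P); apply: Ex_le => [||w].
      - exact: bddX.
      - exact: bdd_cst.
      - by rewrite -[leLHS]ger0_norm ?sqr_ge0// normrX lerXn2r ?nnegrE.
    under eq_fun do rewrite mul1r /z mulrACA.
    rewrite ExZ; last exact: bddM.
    rewrite normrM (@le_trans _ _ (1 * (psi j).+1%:R^-1))//.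
      apply: ler_pM => //; first by rewrite normrM -[leRHS]mulr1 ler_pM.
      exact/Zo/ipsi.
    by rewrite mul1r lef_pV2 ?posrE// ler_nat ltnS strict_incr_ge.
  have amgm : Ex (fun w => S w * h w) <=
      Ex (fun w => (c * n%:R / 2) * h w ^+ 2 + (2 * c * n%:R)^-1 * S w ^+ 2).
    apply: Ex_le => [||w]; first exact: bddM.
      apply: bddD; apply: bddM.
      - exact: bdd_cst.
      - exact: bddX.
      - exact: bdd_cst.
      - exact: bddX.
    rewrite -subr_ge0 (_ : _ - _ = (2 * c * n%:R)^-1 * (c * n%:R * h w - S w) ^+ 2).
      by apply: mulr_ge0; [rewrite invr_ge0 ltW|exact: sqr_ge0].
    by field; rewrite !gt_eqF.
  move: amgm; rewrite ExD; last 2 first.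
  - by apply: bddM; [exact: bdd_cst|exact: bddX].
  - by apply: bddM; [exact: bdd_cst|exact: bddX].
  rewrite !ExZ; [|exact: bddX..]; rewrite -/H => amgm.
  have h1 : c * n%:R / 2 * H <= n%:R * eta / 2.
    rewrite (_ : _ / 2 * H = n%:R / 2 * (c * H)); last by field.
    rewrite (_ : n%:R * eta / 2 = n%:R / 2 * eta); last by field.
    by rewrite ler_pM2l// divr_gt0.
  have h2 : (2 * c * n%:R)^-1 * Ex (fun w => S w ^+ 2) <= (C ^+ 2 + 2) / (2 * c).
    rewrite (_ : _ / (2 * c) = (2 * c * n%:R)^-1 * (n%:R * (C ^+ 2 + 2))); last first.
      by field; rewrite !gt_eqF.
    by rewrite ler_wpM2l// invr_ge0 ltW.
  rewrite (_ : _ / c = 2 * ((C ^+ 2 + 2) / (2 * c))); last by field; rewrite gt_eqF.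
  lra.
pose M := (C ^+ 2 + 2) / c / eta.
have := key (Num.truncn M).+1 isT; rewrite -ler_pdivlMr// -/M leNgt.
by rewrite truncnS_gt.
Qed.

End almost_orthogonal.

Section extraction.
Context {d : measure_display} {Omega : measurableType d} {R : realType}.
Variable P : probability Omega R.
Local Notation Ex := (expect P).

(** For uniformly bounded sequences, the only ones considered here, this amounts to weak convergence
    in L2. *)
Definition wcv (X : nat -> Omega -> R) (Y : Omega -> R) :=
  forall B, measurable B ->
    Ex (fun w => X n w * \1_B w) @[n --> \oo] --> Ex (fun w => Y w * \1_B w).

Lemma wcv_bdd (X : nat -> Omega -> R) (Y h : Omega -> R) (C : R) :
  (forall n, measurable_fun setT (X n)) -> (forall n w, `|X n w| <= C) ->
  measurable_fun setT Y -> (forall w, `|Y w| <= C) -> wcv X Y -> bdd h ->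
  Ex (fun w => X n w * h w) @[n --> \oo] --> Ex (fun w => Y w * h w).
Proof.
move=> mX XC mY YC XY bh; have [mh _] := bh.
by apply: (@wcv_test _ _ _ P measurable \oo X Y h C) => // [B mB|B mB _]; [exact: bdd_cmp|exact: XY].
Qed.

Lemma wcv_subseq (X : nat -> Omega -> R) Y k : strict_incr k -> wcv X Y ->
  wcv (fun n => X (k n)) Y.
Proof.
by move=> ik XY B mB; apply: (cvg_comp _ _ (strict_incr_cvg ik) (XY B mB)).
Qed.

(** One ultrafilter provides the limits [Y q] for all [q]. Along it the deviations [Z q n] tend
    weakly to 0, so the index chosen at step [j] can be made nearly orthogonal to all earlier ones
    for every [q <= j]. For fixed [q] almost orthogonality thus holds from step [q] on, which
    accounts for the shift by [q] in the proof. *)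
Lemma extraction (f : nat -> Omega -> R) (u : nat -> R -> R) (C : nat -> R) :
  (forall n, measurable_fun setT (f n)) ->
  (forall q, measurable_fun setT (u q)) -> (forall q x, `|u q x| <= C q) ->
  exists (k : nat -> nat) (Y : nat -> Omega -> R), strict_incr k /\
    forall q, [/\ measurable_wrt (tail_sigma f) (Y q), (forall w, `|Y q w| <= C q) &
      wcv (fun n w => u q (f (k n) w)) (Y q)].
Proof.
move=> mf mu uC.
have [U [UU Uoo]] := ultraFilterLemma (F := \oo) _.
have FU : ProperFilter U by exact: ultra_proper.
have Um m : U [set n | (m <= n)%N] by apply: Uoo; exact: nbhs_infty_ge.
have /choice[Y YP] q := @wlim_ultra_tail _ _ _ P f (u q) (C q) U mf (mu q) (uC q) UU Um.
have sY q : measurable_wrt (tail_sigma f) (Y q) by case: (YP q).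
have YC q w : `|Y q w| <= C q by case: (YP q).
have mY q : measurable_fun setT (Y q).
  by apply: measurable_wrt_fun (sY q); exact: tail_measurable.
have muf q n : measurable_fun setT (u q \o f n) by exact: measurableT_comp.
have buf q n : bdd (fun w => u q (f n w)).
  by apply: (@bddP _ _ _ _ (C q)) => [|w]; [exact: muf|exact: uC].
have bY q : bdd (Y q) by exact: bddP (YC q).
pose Z q n w := u q (f n w) - Y q w.
have bZ q n : bdd (Z q n) by exact: bddB.
have ZC q n w : `|Z q n w| <= 2 * C q.
  by rewrite mulr_natl mulr2n (le_trans (ler_normB _ _))// lerD.
have cZ q (h : Omega -> R) : bdd h -> Ex (fun w => h w * Z q n w) @[n --> U] --> (0 : R).
  move=> bh; have [mh _] := bh.
  have : Ex (fun w => (u q \o f n) w * h w) @[n --> U] --> Ex (fun w => Y q w * h w).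
    apply: (@wcv_test _ _ _ P measurable U _ _ _ (C q)) => //.
    - by move=> A mA; exact: bdd_cmp.
    - by move=> n w; exact: uC.
    - by move=> B mB _; case: (YP q) => _ _; exact.
  move/(cvgB)/(_ (cvg_cst (Ex (fun w => Y q w * h w)))); rewrite subrr.
  apply: cvg_trans; apply: near_eq_cvg; apply: nearW => n.
  rewrite !fctE -ExB; [|exact: bddM..].
  by congr (expect _ _); apply/funext => w; rewrite -mulrBl mulrC.
have [|k [ik kP]] := @diag_choice (fun s n => forall qm, qm \in
    [seq (q, m) | q <- iota 0 (size s).+1, m <- s] ->
    `|Ex (fun w => Z qm.1 qm.2 w * Z qm.1 n w)| <= (size s).+1%:R^-1).
  move=> s; set l := [seq _ | _ <- _, _ <- _].
  have Ul : U [set n | forall qm, qm \in l ->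
      `|Ex (fun w => Z qm.1 qm.2 w * Z qm.1 n w)| <= (size s).+1%:R^-1].
    have := @filter_seq_forall nat _ U l (fun qm => [set n |
      `|Ex (fun w => Z qm.1 qm.2 w * Z qm.1 n w)| <= (size s).+1%:R^-1]) _; apply => qm _.
    have /cvgrPdist_le := cZ qm.1 (Z qm.1 qm.2) (bZ _ _).
    move=> /(_ (size s).+1%:R^-1); rewrite invr_gt0 ltr0n => /(_ isT).
    by apply: filterS => n; rewrite sub0r normrN.
  have [n [nl /= sn]] := filter_ex (filterI Ul (Um (\max_(i <- s) i).+1)).
   exists n; split=> // m ms.
  by rewrite (leq_ltn_trans _ sn)// (big_rem m ms)/= leq_maxl.
exists k, Y; split=> // q; split=> // B mB.
have bB : bdd (\1_B : Omega -> R) by exact: bdd_indic.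
have : Ex (fun w => Z q (k (n + q)%N) w * \1_B w) @[n --> \oo] --> (0 : R).
  apply: (@almost_orthogonal_wcv0 _ _ _ P (fun n => Z q (k (n + q)%N)) (2 * C q)) => //.
  - by move=> n; case: (bZ q (k (n + q)%N)).
  - move=> i j ij; have := kP (j + q)%N (q, k (i + q)%N).
    rewrite size_map size_iota => /(_ _)/le_trans; apply; last first.
      by rewrite lef_pV2 ?posrE// ler_nat ltnS leq_addr.
    apply/allpairsP; exists (q, k (i + q)%N); split; rewrite ?mem_iota//= ?ltnS ?leq_addl//.
    by apply/mapP; exists (i + q)%N => //; rewrite mem_iota/= ltn_add2r.
rewrite (cvg_shiftn q (fun n => Ex (fun w => Z q (k n) w * \1_B w))).
move/(cvgD)/(_ (cvg_cst (Ex (fun w => Y q w * \1_B w)))); rewrite add0r.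
apply: cvg_trans; apply: near_eq_cvg; apply: nearW => n.
rewrite !fctE -ExD; [|exact: bddM..].
by congr (expect _ _); apply/funext => w; rewrite -mulrDl subrK.
Qed.

End extraction.

(** * Convergence in probability *)

Section convergence_in_probability.
Context {d : measure_display} {Omega : measurableType d} {R : realType}.
Variable P : probability Omega R.
Local Notation Ex := (expect P).
Local Notation Pr := (prob P).

Lemma measurable_gt (X : Omega -> R) (c : R) : measurable_fun setT X ->
  measurable [set w | c < X w].
Proof.
move=> mX; rewrite (_ : [set w | _] = X @^-1` `]c, +oo[); first exact: bdd_cmp.
by apply/seteqP; split=> w; rewrite /= in_itv/= andbT.
Qed.

Lemma measurable_le (X : Omega -> R) (c : R) : measurable_fun setT X ->
  measurable [set w | X w <= c].
Proof.
move=> mX; rewrite (_ : [set w | _] = X @^-1` `]-oo, c]); first exact: bdd_cmp.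
by apply/seteqP; split=> w; rewrite /= in_itv.
Qed.

Lemma measurable_lt (X : Omega -> R) (c : R) : measurable_fun setT X ->
  measurable [set w | X w < c].
Proof.
move=> mX; rewrite (_ : [set w | _] = X @^-1` `]-oo, c[); first exact: bdd_cmp.
by apply/seteqP; split=> w; rewrite /= in_itv.
Qed.

Lemma measurable_ge (X : Omega -> R) (c : R) : measurable_fun setT X ->
  measurable [set w | c <= X w].
Proof.
move=> mX; rewrite (_ : [set w | _] = X @^-1` `[c, +oo[); first exact: bdd_cmp.
by apply/seteqP; split=> w; rewrite /= in_itv/= andbT.
Qed.

Lemma measurable_norm_gt (X : Omega -> R) (c : R) : measurable_fun setT X ->
  measurable [set w | c < `|X w|].
Proof. by move=> mX; apply: (measurable_gt (X := fun w => `|X w|)); exact: measurableT_comp. Qed.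

Lemma PrE_cvg (A : nat -> set Omega) : (forall N, measurable (A N)) ->
  (P (A N) @[N --> \oo] --> 0%E) <->
  forall e, 0 < e -> \forall N \near \oo, Pr (A N) <= e.
Proof.
move=> mA; split=> [/fine_cvgP[_ /cvgrPdist_le h] e /h|h].
  by apply: filterS => N; rewrite sub0r normrN ger0_norm ?Pr_ge0.
apply/fine_cvgP; split; first by apply: nearW => N; rewrite PrE.
apply/cvgrPdist_le => e /h; apply: filterS => N.
by rewrite sub0r normrN ger0_norm ?Pr_ge0.
Qed.

Lemma conv_in_probP (X : nat -> Omega -> R) : (forall N, measurable_fun setT (X N)) ->
  conv_in_prob P X <-> forall e, 0 < e -> forall c, 0 < c ->
    \forall N \near \oo, Pr [set w | e < `|X N w|] <= c.
Proof.
move=> mX; have mA e N : measurable [set w | e < `|X N w|] by exact: measurable_norm_gt.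
by split=> h e e0; [apply/(PrE_cvg (mA e))/h|apply/(PrE_cvg (mA e))/(h e e0)].
Qed.

Lemma conv_in_prob_le (X Y : nat -> Omega -> R) :
  (forall N, measurable_fun setT (X N)) -> (forall N, measurable_fun setT (Y N)) ->
  (\forall N \near \oo, {ae P, forall w, `|X N w| <= `|Y N w|}) ->
  conv_in_prob P Y -> conv_in_prob P X.
Proof.
move=> mX mY XY /(conv_in_probP mY) h; apply/(conv_in_probP mX) => e e0 c c0.
apply: (filterS _ (filterI XY (h e e0 c c0))) => N [XYN] /(le_trans _); apply.
rewrite -!Ex_indic; [|exact: measurable_norm_gt..].
apply: Ex_le_ae; first by apply: bdd_indic; exact: measurable_norm_gt.
  by apply: bdd_indic; exact: measurable_norm_gt.
apply: filterS XYN => w XYw; rewrite !indicE ler_nat; case: (boolP (w \in _)) => //.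
by rewrite inE/= => eX; rewrite lt0b inE/= (lt_le_trans eX).
Qed.

(** Markov's inequality for [g N]: the set where it exceeds [e] lies in [S], and its integral there
    is at most the probability of [A N]. A version may be negative on a null set, which is treated
    apart. *)
Lemma cond_prob_conv (S : set (set Omega)) (A : nat -> set Omega) (g : nat -> Omega -> R) :
  S `<=` measurable -> (forall N, measurable (A N)) ->
  P (A N) @[N --> \oo] --> 0%E ->
  (forall N, cond_prob_version P S (A N) (g N)) -> conv_in_prob P g.
Proof.
move=> Sm mA /(PrE_cvg mA) h gP.
have mg N : measurable_fun setT (g N) by case: (gP N) => /(measurable_wrt_fun Sm).
apply/(conv_in_probP mg) => e e0 c c0.
have := h (c * e) (mulr_gt0 c0 e0); apply: filterS => N PA.
have [Sg ig gB] := gP N.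
pose B1 := [set w | e < g N w]; pose B2 := [set w | g N w < 0].
have mB1 : measurable B1 by exact: measurable_gt.
have mB2 : measurable B2 by exact: measurable_lt.
have SB1 : S B1.
  rewrite (_ : B1 = g N @^-1` `]e, +oo[); first by apply: Sg; exact: measurable_itv.
  by apply/seteqP; split=> w; rewrite /= in_itv/= andbT.
have SB2 : S B2.
  rewrite (_ : B2 = g N @^-1` `]-oo, 0[); first by apply: Sg; exact: measurable_itv.
  by apply/seteqP; split=> w; rewrite /= in_itv/=.
have RB B : S B -> Rintegral P B (g N) = Pr (A N `&` B) by move=> SB; rewrite /Rintegral gB.
have iB B : measurable B -> P.-integrable B (EFin \o g N) by move=> mB; exact: integrableS ig.
have ic r B : measurable B -> P.-integrable B (EFin \o (fun=> r : R)).
  by move=> mB; apply: (integrableS measurableT) => //; apply: bdd_int; exact: bdd_cst.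
have P1 : Pr B1 <= c.
  rewrite -(ler_pM2r e0) (le_trans _ PA)//.
  apply: (@le_trans _ _ (Pr (A N `&` B1))); last by apply: Pr_le => //; exact: measurableI.
  rewrite -RB// mulrC -(Rintegral_cst P mB1); apply: le_Rintegral => //; [exact: ic|exact: iB|].
  by move=> w /ltW.
have P2 : P B2 = 0%E.
  apply: (@integral_le0_null _ _ _ _ _ (fun w => 0 - g N w)) => // [|w|].
  - exact: (integrableB measurableT (ic 0 _ measurableT) ig).
  - by rewrite /B2/= sub0r oppr_gt0.
  - by rewrite RintegralB// ?RB// ?Rintegral_cst ?mul0r ?sub0r ?oppr_le0 ?Pr_ge0//; [exact: ic|exact: iB].
apply: le_trans P1; apply: (@le_trans _ _ (Pr (B1 `|` B2))).
  apply: Pr_le; [exact: measurable_norm_gt|exact: measurableU|].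
  move=> w /=; rewrite /B1/B2/=; case: (ltP (g N w) 0) => [|g0]; first by right.
  by rewrite ger0_norm//; left.
by rewrite (le_trans (Pr_U _ mB1 mB2))// {2}/prob P2 addr0.
Qed.

Lemma cond_prob_exists (S : set (set Omega)) (A : set Omega) :
  sigma_algebra setT S -> S `<=` measurable -> measurable A ->
  exists g, cond_prob_version P S A g /\ forall w, `|g w| <= 1.
Proof.
move=> aS Sm mA; have mI : measurable_fun setT (\1_A : Omega -> R) by exact: measurable_indic.
have [|g [Sg gC gE]] := @cond_exp_exists _ _ _ P S \1_A 1 aS Sm mI.
  by move=> w; rewrite indicE; case: (_ \in _); rewrite ?normr1 ?normr0.
have bg : bdd g by apply: (@bddP _ _ _ _ 1) => //; exact: measurable_wrt_fun Sg.
exists g; split=> //; split=> //; first exact: bdd_int.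
move=> B SB; have mB := Sm _ SB.
have := gE B SB; rewrite (_ : (fun w => \1_A w * \1_B w) = \1_(A `&` B)); last first.
  by apply/funext => w; rewrite indicI.
rewrite Ex_indic; last exact: measurableI.
rewrite Ex_indicM// PrE; last exact: measurableI.
move=> ->; rewrite fineK//.
by apply: integrable_fin_num => //; apply: integrableS (bdd_int P bg).
Qed.

(** The hypothesis speaks about all versions, so one has to be produced. Taken bounded by 1, it
    converges to 0 also in mean, and its mean is the probability of [A N]. *)
Lemma cond_prob_conv_inv (S : set (set Omega)) (A : nat -> set Omega) :
  sigma_algebra setT S -> S `<=` measurable -> (forall N, measurable (A N)) ->
  (forall g, (forall N, cond_prob_version P S (A N) (g N)) -> conv_in_prob P g) ->
  P (A N) @[N --> \oo] --> 0%E.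
Proof.
move=> aS Sm mA h.
have /choice[g gP] N := @cond_prob_exists S (A N) aS Sm (mA N).
have mg N : measurable_fun setT (g N) by case: (gP N) => -[/(measurable_wrt_fun Sm)].
have /(conv_in_probP mg) cg := h g (fun N => (gP N).1).
apply/(PrE_cvg mA) => e e0.
have e2 : 0 < e / 2 by rewrite divr_gt0.
have := cg _ e2 _ e2; apply: filterS => N PB.
have [[Sg ig gB] g1] := gP N.
pose B := [set w | e / 2 < `|g N w|].
have mB : measurable B by exact: measurable_norm_gt.
have bg : bdd (g N) by exact: bddP (g1).
have ST : S setT by case: aS => [S0 /(_ _ S0)]; rewrite setD0.
have -> : Pr (A N) = Ex (g N).
  by rewrite /expect /Rintegral gB// setIT.
have bB : bdd (\1_B : Omega -> R) by exact: bdd_indic.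
apply: (@le_trans _ _ (Ex (fun w => e / 2 + \1_B w))).
  apply: Ex_le => // [|w]; first by apply: bddD => //; exact: bdd_cst.
  rewrite (le_trans (ler_norm _))// indicE; case: (boolP (w \in B)) => wB.
    by rewrite (le_trans (g1 w))//= lerDr ltW.
  by rewrite addr0 leNgt; apply: contra wB => ?; rewrite inE.
rewrite ExD// ?Ex_cst ?Ex_indic//; last exact: bdd_cst.
rewrite -/B in PB; lra.
Qed.

End convergence_in_probability.

(** * Truncation and the sufficiency of the moment condition *)

Section truncations.
Context {R : realType}.

Definition trunc_sqr (N : nat) (x : R) : R := Num.min (x ^+ 2) (N%:R ^+ 2).

Definition trunc (N : nat) (x : R) : R := if `|x| <= N%:R then x else 0.

Lemma trunc_sqr_ge0 N x : 0 <= trunc_sqr N x.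
Proof. by rewrite le_min !sqr_ge0. Qed.

Lemma trunc_sqr_le N x : trunc_sqr N x <= N%:R ^+ 2.
Proof. by rewrite ge_min lexx orbT. Qed.

Lemma norm_trunc_sqr N x : `|trunc_sqr N x| <= N%:R ^+ 2.
Proof. by rewrite ger0_norm ?trunc_sqr_ge0// trunc_sqr_le. Qed.

Lemma norm_trunc N x : `|trunc N x| <= N%:R.
Proof. by rewrite /trunc; case: ifP => // _; rewrite normr0. Qed.

Lemma sqr_trunc_le N x : trunc N x ^+ 2 <= trunc_sqr N x.
Proof.
rewrite /trunc; case: ifP => xN; last by rewrite expr0n/= trunc_sqr_ge0.
by rewrite le_min lexx/= -[leLHS]ger0_norm ?sqr_ge0// normrX lerXn2r ?nnegrE.
Qed.

Lemma trunc_sqr_gt N x : N%:R < `|x| -> trunc_sqr N x = N%:R ^+ 2.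
Proof.
move=> Nx; apply/min_idPr.
by rewrite -[leRHS]ger0_norm ?sqr_ge0// normrX lerXn2r ?nnegrE// ltW.
Qed.

Lemma measurable_trunc_sqr N : measurable_fun setT (trunc_sqr N).
Proof. by apply: measurable_minr => //; exact: measurable_funX. Qed.

Lemma measurable_trunc N : measurable_fun setT (trunc N).
Proof.
apply: measurable_fun_ifT => //.
by apply: measurable_fun_ler => //; exact: measurableT_comp.
Qed.

End truncations.

Section tools.
Context {d : measure_display} {Omega : measurableType d} {R : realType}.
Variable P : probability Omega R.
Local Notation Ex := (expect P).
Local Notation Pr := (prob P).

Lemma ae_le_of_Ex (X Y : Omega -> R) : bdd X -> bdd Y ->
  (forall B, measurable B -> Ex (fun w => X w * \1_B w) <= Ex (fun w => Y w * \1_B w)) ->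
  {ae P, forall w, X w <= Y w}.
Proof.
move=> bX bY XY; pose B := [set w | 0 < X w - Y w].
have bXY : bdd (fun w => X w - Y w) by exact: bddB.
have mB : measurable B by apply: measurable_gt; case: bXY.
have bB : bdd (\1_B : Omega -> R) by exact: bdd_indic.
have PB : P B = 0%E.
  apply: (@integral_le0_null _ _ _ _ _ (fun w => X w - Y w)) => //; first exact: bdd_int.
  rewrite -Ex_indicM//; under eq_fun do rewrite mulrBl.
  by rewrite ExB; [rewrite subr_le0; exact: XY|exact: bddM..].
exists B; split=> // w /= XYw; rewrite /B/= subr_gt0 ltNge; exact/negP.
Qed.

Lemma tight1 (X : Omega -> R) : measurable_fun setT X -> forall e, 0 < e ->
  exists n : nat, Pr [set w | n%:R < `|X w|] <= e.
Proof.
move=> mX e e0; have mA n : measurable [set w | n%:R < `|X w|] by exact: measurable_norm_gt.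
have : P [set w | n%:R < `|X w|] @[n --> \oo] --> 0%E.
  rewrite -(measure0 P) (_ : set0 = \bigcap_n [set w | n%:R < `|X w|]); last first.
    apply/esym; rewrite -subset0 => w /(_ (Num.truncn `|X w|).+1 I)/=.
    by rewrite ltNge ltW// truncnS_gt.
  apply: nonincreasing_cvg_mu => //.
  - by rewrite ltey_eq fin_num_measure.
  - exact: bigcap_measurable.
  - by move=> n m nm; apply/subsetPset => w /=; apply: le_lt_trans; rewrite ler_nat.
by move/(PrE_cvg P mA) => /(_ e e0)[n _ /(_ n (leqnn n))]; exists n.
Qed.

Lemma conv_in_prob_Ex (X : nat -> Omega -> R) (C : R) : (forall N, measurable_fun setT (X N)) ->
  (forall N w, `|X N w| <= C) -> conv_in_prob P X ->
  Ex (fun w => `|X N w|) @[N --> \oo] --> (0 : R).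
Proof.
move=> mX XC /(conv_in_probP _ mX) h; apply/cvgrPdist_le => /= e e0.
have C0 : 0 <= C by rewrite (le_trans _ (XC 0%N point)).
have e1 : 0 < e / (2 * (C + 1)) by rewrite divr_gt0// mulr_gt0// ltr_wpDl.
have e2 : 0 < e / 2 by rewrite divr_gt0.
apply: (filterS _ (h _ e2 _ e1)) => N PN.
rewrite sub0r normrN ger0_norm; last by apply: Ex_ge0.
set A := [set w | _] in PN; have mA : measurable A by exact: measurable_norm_gt.
have bA : bdd (\1_A : Omega -> R) by exact: bdd_indic.
apply: (@le_trans _ _ (Ex (fun w => e / 2 + C * \1_A w))).
  apply: Ex_le => [||w].
  - by apply: bdd_norm; exact: bddP (XC N).
  - by apply: bddD; [exact: bdd_cst|apply: bddM => //; exact: bdd_cst].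
  - rewrite indicE; case: (boolP (w \in A)) => wA.
      by rewrite (le_trans (XC N w))//= mulr1 lerDr ltW.
    by rewrite mulr0 addr0 leNgt; apply: contra wA => ?; rewrite inE.
rewrite ExD; [|exact: bdd_cst|by apply: bddM => //; exact: bdd_cst].
rewrite Ex_cst ExZ// Ex_indic//.
have := ler_wpM2l C0 PN; move: (Pr A) => x.
have -> : C * (e / (2 * (C + 1))) = e / 2 * (C / (C + 1)) by field; lra.
have : C / (C + 1) <= 1 by rewrite ler_pdivrMr ?ltr_wpDl// mul1r; lra.
have : 0 <= C / (C + 1) by rewrite divr_ge0// ltW// ltr_wpDl.
nra.
Qed.

End tools.

(* [p j] is the largest truncation level that the [j]-th term of the subsequence has to
   respect, and [J N] the first term that respects level [N]. With [M] a tightness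
   bound, the earlier terms are negligible in an average of length [N]. *)
Lemma block_schedule (R : realType) (M : nat -> R) : exists p J : nat -> nat,
  [/\ (forall N n, (J N <= n)%N -> (N <= p n)%N),
      (forall N, (0 < J N)%N -> ((J N) ^ 2 <= N)%N /\ M (J N).-1 * (J N)%:R ^+ 2 <= N%:R) &
      forall j, \forall N \near \oo, (j < J N)%N].
Proof.
(* If [J N = j.+1], then [N] exceeds [p j >= q j], so the two summands are the two lower bounds on
   [N] demanded at that stage. Summing the [q i] makes [p] nondecreasing. *)
pose q j := (j.+1 ^ 2 + (Num.truncn (M j * j.+1%:R ^+ 2)).+1)%N.
pose p j := (\sum_(i < j.+1) q i)%N.
have pq j : (q j <= p j)%N by rewrite /p big_ord_recr/= leq_addl.
have pmono i j : (i <= j)%N -> (p i <= p j)%N.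
  move=> /subnK <-; elim: (j - i)%N => // n ih; rewrite addSn (leq_trans ih)//.
  by rewrite /p [leqRHS]big_ord_recr/= leq_addr.
have pj j : (j < p j)%N.
  by rewrite (leq_trans _ (pq j))// /q -addSnnS (leq_trans _ (leq_addr _ _))// ltnW// ltnS
    -[leqLHS]expn1 leq_pexp2l.
have ex N : exists j, (N <= p j)%N by exists N; exact: ltnW.
pose J N := ex_minn (ex N).
exists p, J; split.
- by move=> N n; rewrite /J; case: ex_minnP => j Nj _ /pmono; exact: leq_trans.
- move=> N; rewrite /J; case: ex_minnP => -[//|j] _ jmin _ /=.
  have pN : (p j < N)%N by rewrite ltnNge; apply/negP => /jmin; rewrite ltnn.
  have qN := leq_trans (pq j) (ltnW pN); split.
    by rewrite (leq_trans _ qN)// leq_addr.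
  apply: (@le_trans _ _ (Num.truncn (M j * j.+1%:R ^+ 2)).+1%:R).
    by rewrite ltW// truncnS_gt.
  by rewrite ler_nat (leq_trans _ qN)// leq_addl.
- move=> j; exists (p j).+1 => // N /= pN; rewrite /J; case: ex_minnP => i Ni _.
  by rewrite ltnNge; apply/negP => /pmono /(leq_trans Ni); rewrite leqNgt pN.
Qed.

Section core_suff.
Context {d : measure_display} {Omega : measurableType d} {R : realType}.
Variable P : probability Omega R.
Local Notation Ex := (expect P).
Local Notation Pr := (prob P).
Variables (F vb D : nat -> Omega -> R).
Hypothesis mF : forall n, measurable_fun setT (F n).
Hypothesis mvb : forall N, measurable_fun setT (vb N).
Hypothesis vb0 : forall N w, 0 <= vb N w.
Hypothesis vbN : forall N w, vb N w <= N%:R ^+ 2.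
Hypothesis mD : forall N, measurable_fun setT (D N).
Hypothesis DN : forall N w, `|D N w| <= N%:R.
Hypothesis cv : forall N, wcv P (fun n w => trunc_sqr N (F n w)) (vb N).
Hypothesis cD : forall N, wcv P (fun n w => trunc N (F n w)) (D N).

Let V N w := vb N w / N%:R.
Let W N : Omega -> R := \1_[set w | V N w <= 1].

Hypothesis cV : conv_in_prob P V.

Let V0 N w : 0 <= V N w. Proof. by rewrite divr_ge0. Qed.
Let mV N : measurable_fun setT (V N).
Proof. by apply: measurable_funM => //; exact: measurable_cst. Qed.
Let mW N : measurable [set w | V N w <= 1]. Proof. exact: measurable_le. Qed.
Let bW N : bdd (W N). Proof. exact: bdd_indic. Qed.
Let bvb N : bdd (vb N).
Proof. by apply: (@bddP _ _ _ _ (N%:R ^+ 2)) => // w; rewrite ger0_norm ?vb0. Qed.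
Let bD N : bdd (D N). Proof. exact: bddP (DN N). Qed.
Let bv N n : bdd (fun w => trunc_sqr N (F n w)).
Proof. apply: bdd_comp (mF n); [exact: measurable_trunc_sqr|exact: norm_trunc_sqr]. Qed.
Let bg N n : bdd (fun w => trunc N (F n w)).
Proof. apply: bdd_comp (mF n); [exact: measurable_trunc|exact: norm_trunc]. Qed.

Let cvE N h : bdd h -> Ex (fun w => trunc_sqr N (F n w) * h w) @[n --> \oo] --> Ex (fun w => vb N w * h w).
Proof.
apply: (@wcv_bdd _ _ _ P _ _ _ (N%:R ^+ 2)) => //.
- by move=> n; case: (bv N n).
- by move=> n w; exact: norm_trunc_sqr.
- by move=> w; rewrite ger0_norm ?vb0.
Qed.

Let cDE N h : bdd h -> Ex (fun w => trunc N (F n w) * h w) @[n --> \oo] --> Ex (fun w => D N w * h w).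
Proof.
apply: (@wcv_bdd _ _ _ P _ _ _ N%:R) => //.
- by move=> n; case: (bg N n).
- by move=> n w; exact: norm_trunc.
Qed.

(** A limiting form of Jensen's inequality: the expectation of [(trunc N (F n) - D N) ^+ 2] over [B]
    is nonnegative; bound the square of [trunc] by [trunc_sqr], expand, and let [n] tend to
    infinity. *)
Lemma sqr_center_le N : {ae P, forall w, D N w ^+ 2 <= vb N w}.
Proof.
apply: (ae_le_of_Ex (bddX 2 (bD N)) (bvb N)) => B mB.
have bB : bdd (\1_B : Omega -> R) by exact: bdd_indic.
have bDB : bdd (fun w => D N w * \1_B w) by exact: bddM.
have c1 := @cvE N _ bB; have c2 := @cDE N _ bDB.
pose L n := Ex (fun w => trunc_sqr N (F n w) * \1_B w) -
  2 * Ex (fun w => trunc N (F n w) * (D N w * \1_B w)) + Ex (fun w => D N w ^+ 2 * \1_B w).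
have cL : L n @[n --> \oo] --> Ex (fun w => vb N w * \1_B w) -
  2 * Ex (fun w => D N w * (D N w * \1_B w)) + Ex (fun w => D N w ^+ 2 * \1_B w).
  apply: cvgD; last exact: cvg_cst.
  apply: cvgB => //; apply: cvgM => //; exact: cvg_cst.
have L0 n : 0 <= L n.
  rewrite /L -ExZ; last exact: bddM.
  rewrite -ExB; [|exact: bddM|by apply: bddM; [exact: bdd_cst|exact: bddM]].
  rewrite -ExD; [|by apply: bddB; [exact: bddM|apply: bddM; [exact: bdd_cst|exact: bddM]]
    |by apply: bddM => //; exact: bddX].
  apply: Ex_ge0 => w; have := sqr_trunc_le N (F n w).
  rewrite indicE; case: (_ \in _); rewrite ?mulr1 ?mulr0 ?subr0 ?addr0//.
  have := sqr_ge0 (trunc N (F n w) - D N w); nra.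
have : 0 <= Ex (fun w => vb N w * \1_B w) -
  2 * Ex (fun w => D N w * (D N w * \1_B w)) + Ex (fun w => D N w ^+ 2 * \1_B w).
  by rewrite -(cvg_lim _ cL)//; apply: limr_ge; [apply/cvg_ex; eexists; exact: cL|exact: nearW].
have -> : (fun w => D N w * (D N w * \1_B w)) = (fun w => D N w ^+ 2 * \1_B w).
  by apply/funext => w; rewrite mulrA.
lra.
Qed.

Let VN1 N w : V N w / N%:R <= 1.
Proof.
rewrite /V; have [->|N0] := posnP N; first by rewrite invr0 mulr0 ler01.
by rewrite -mulrA -invfM -expr2 ler_pdivrMr ?mul1r// exprn_gt0// ltr0n.
Qed.

(** [V N / N] is bounded by 1 and tends to 0 in probability, hence in mean. Markov's inequality for
    [trunc_sqr N] at one large [N] then handles all late terms, and the finitely many others are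
    tight one by one. *)
Lemma tight_of_second_moment (e : R) : 0 < e -> exists M : R, forall n, Pr [set w | M < `|F n w|] <= e.
Proof.
move=> e0; have e2 : 0 < e / 2 by rewrite divr_gt0.
have mVN N : measurable_fun setT (fun w => V N w / N%:R).
  by apply: measurable_funM => //; exact: measurable_cst.
have VN0 N w : 0 <= V N w / N%:R by rewrite divr_ge0.
have cVN : conv_in_prob P (fun N w => V N w / N%:R).
  apply: conv_in_prob_le cV => //; exists 1%N => // N /= N0; apply: aeW => w.
  by rewrite !ger0_norm// ler_pdivrMr ?ltr0n// ler_peMr// ler1n.
have := @conv_in_prob_Ex _ _ _ P _ 1 mVN _ cVN.
move/(_ (fun N w => _))/cvgrPdist_le => /(_ _)/(_ _ e2) [|N1 _ N1P].
  by move=> N w; rewrite ger0_norm.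
pose N := N1.+1; have N0 : 0 < N%:R :> R by rewrite ltr0n.
have := N1P N (leqnSn _); rewrite sub0r normrN => hN.
have E1 : Ex (vb N) <= N%:R ^+ 2 * (e / 2).
  have := le_trans (ler_norm _) hN.
  rewrite (_ : (fun w => `|V N w / N%:R|) = (fun w => (N%:R ^+ 2)^-1 * vb N w)); last first.
    by apply/funext => w; rewrite ger0_norm// /V -mulrA -invfM mulrC -expr2.
  by rewrite ExZ// ler_pdivrMl// exprn_gt0.
have := @cvE N _ (bdd_cst 1).
have e1 (X : Omega -> R) : (fun w => X w * 1) = X by apply/funext => w; rewrite mulr1.
rewrite e1; under eq_fun do rewrite e1.
have N2e : 0 < N%:R ^+ 2 * (e / 2) by rewrite mulr_gt0// exprn_gt0.
move/cvgrPdist_le => /(_ _ N2e)[n0 _ n0P].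
have late n : (n0 <= n)%N -> Pr [set w | N%:R < `|F n w|] <= e.
  move=> /n0P h; have mA : measurable [set w | N%:R < `|F n w|] by exact: measurable_norm_gt.
  have N2 : 0 < N%:R ^+ 2 :> R by rewrite exprn_gt0.
  have mk := @Pr_markov _ _ _ P _ (fun w => trunc_sqr N (F n w))
    (N%:R ^+ 2) N2 mA (bv N n) (fun w => trunc_sqr_ge0 N (F n w)).
  apply: le_trans (mk _) _; first by move=> w /= /trunc_sqr_gt ->.
  rewrite ler_pdivrMr//; move: h; rewrite ler_norml => /andP[+ _]; nra.
have /choice[m mP] n := tight1 P (mF n) e0.
exists (N + \sum_(i < n0) m i)%N%:R => n.
have [n0n|nn0] := leqP n0 n.
  apply: le_trans (late n n0n); apply: Pr_le; [exact: measurable_norm_gt..|].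
  by move=> w /=; apply: le_lt_trans; rewrite ler_nat leq_addr.
apply: le_trans (mP n); apply: Pr_le; [exact: measurable_norm_gt..|].
move=> w /=; apply: le_lt_trans; rewrite ler_nat.
by rewrite (bigD1 (Ordinal nn0))//= addnCA leq_addr.
Qed.


Let WV N := Ex (fun w => W N w * V N w).

(** [W N * V N] is bounded by 1, so convergence in probability implies convergence in mean; this is
    what the weight [W N] is for. *)
Let WV0 : WV N @[N --> \oo] --> (0 : R).
Proof.
have WV01 N w : 0 <= W N w * V N w by rewrite mulr_ge0// indicE.
have mWV N : measurable_fun setT (fun w => W N w * V N w).
  by apply: measurable_funM => //; case: (bW N).
have WVE N : WV N = Ex (fun w => `|W N w * V N w|).
  by congr (expect _ _); apply/funext => w; rewrite ger0_norm.
under eq_fun do rewrite WVE.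
apply: (@conv_in_prob_Ex _ _ _ _ _ 1) => // [N w|].
  rewrite ger0_norm// /W indicE; case: (boolP (_ \in _)); rewrite ?mul1r ?mul0r//.
  by rewrite inE.
apply: conv_in_prob_le cV => //; apply: nearW => N; apply: aeW => w.
by rewrite !ger0_norm// /W indicE ler_piMl//; case: (_ \in _).
Qed.

Let bV N : bdd (V N).
Proof. by apply: bddM => //; exact: bdd_cst. Qed.

Let WvbE N : Ex (fun w => W N w * vb N w) = N%:R * WV N.
Proof.
rewrite /WV -ExZ; last exact: bddM.
congr (expect _ _); apply/funext => w; rewrite mulrCA; congr (_ * _).
rewrite /V; have [->|N0] := posnP N; last by rewrite mulrCA divff ?mulr1// pnatr_eq0 -lt0n.
by rewrite mul0r; apply/eqP; rewrite eq_le vb0 andbT (le_trans (vbN 0 w))// expr0n.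
Qed.

Let Z N n w := trunc N (F n w) - D N w.
Let bZ N n : bdd (Z N n). Proof. exact: bddB. Qed.

(** The slack 1 is harmless: summed over [N] terms and divided by the square of [N], it becomes
    [1 / N]. *)
Let good N n := Ex (fun w => W N w * trunc_sqr N (F n w)) <= N%:R * WV N + 1.

Let good_near N : \forall n \near \oo, good N n.
Proof.
have := @cvE N _ (bW N) => /cvgrPdist_le /(_ _ ltr01); apply: filterS => n.
rewrite ler_norml => /andP[h _]; rewrite /good -WvbE.
under eq_fun do rewrite mulrC; under [in leRHS]eq_fun do rewrite mulrC; lra.
Qed.

Let cross_near N m e : 0 < e ->
  \forall n \near \oo, `|Ex (fun w => W N w * (Z N m w * Z N n w))| <= e.
Proof.
move=> e0; have bWZ : bdd (fun w => W N w * Z N m w) by exact: bddM.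
have := @cDE N _ bWZ => /cvgrPdist_le /(_ _ e0); apply: filterS => n.
rewrite -ExB; [|exact: bddM..]; rewrite -normrN -mulN1r -ExZ; last first.
  by apply: bddB; exact: bddM.
by congr (`|expect _ _| <= _); apply/funext => w; rewrite /Z; ring.
Qed.

(** From (a - b)^2 <= 2 a^2 + 2 b^2 together with [sqr_center_le]. *)
Let good_sqr N n : good N n -> Ex (fun w => W N w * Z N n w ^+ 2) <= 4 * (N%:R * WV N) + 2.
Proof.
move=> gn; have b1 : bdd (fun w => W N w * trunc_sqr N (F n w)) by exact: bddM.
have b2 : bdd (fun w => W N w * vb N w) by exact: bddM.
apply: (@le_trans _ _ (Ex (fun w => 2 * (W N w * trunc_sqr N (F n w)) + 2 * (W N w * vb N w)))).
  apply: Ex_le_ae; first by apply: bddM => //; exact: bddX.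
    by apply: bddD; apply: bddM => //; exact: bdd_cst.
  apply: filterS (sqr_center_le N) => w Dw.
  rewrite /W indicE; case: (_ \in _); rewrite ?mul1r ?mul0r ?mulr0 ?addr0//.
  have := sqr_trunc_le N (F n w); have := sqr_ge0 (trunc N (F n w) + D N w).
  rewrite /Z; nra.
rewrite ExD ?ExZ//; [|by apply: bddM => //; exact: bdd_cst..].
by rewrite WvbE; move: gn; rewrite /good; lra.
Qed.

(** By [sqr_center_le], the square of the quotient is at most [V N] almost everywhere. *)
Lemma center_over_sqrt : conv_in_prob P (fun N w => D N w / Num.sqrt N%:R).
Proof.
apply/conv_in_probP => [N|e e0 c c0].
  by apply: measurable_funM => //; exact: measurable_cst.
have e2 : 0 < e ^+ 2 by rewrite exprn_gt0.
have := (conv_in_probP P mV).1 cV _ e2 _ c0; apply: filterS => N.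
apply: le_trans; rewrite -!Ex_indic; [|apply: measurable_norm_gt..] => //; last first.
  by apply: measurable_funM => //; exact: measurable_cst.
apply: Ex_le_ae; [apply: bdd_indic; apply: measurable_norm_gt..|] => //.
  by apply: measurable_funM => //; exact: measurable_cst.
apply: filterS (sqr_center_le N) => w Dw; rewrite !indicE ler_nat.
case: (boolP (w \in _)) => //; rewrite inE/= => h.
rewrite lt0b inE/= ger0_norm// (@lt_le_trans _ _ (`|D N w / Num.sqrt N%:R| ^+ 2))//.
  by rewrite ltrXn2r// ?nnegrE// ltW.
by rewrite -normrX ger0_norm ?sqr_ge0// exprMn exprVn sqr_sqrtr// ler_wpM2r ?invr_ge0.
Qed.

(** The index chosen at step [j] is [good] and nearly orthogonal to the earlier ones at every level
    [N <= p j]. An average of length [N] is cut at position [J N]: the later terms obey the weighted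
    second moment bound at level [N], the [J N] earlier ones are small by tightness. *)
Lemma hereditary_lln : exists phi, strict_incr phi /\ forall psi, strict_incr psi ->
  conv_in_prob P (fun N w => avg F (phi \o psi) N w - D N w).
Proof.
have tight j := @tight_of_second_moment (j.+1%:R ^+ 2)^-1.
have /choice[M MP] j : exists M : R, forall n, Pr [set w | M < `|F n w|] <= (j.+1%:R ^+ 2)^-1.
  by apply: tight; rewrite invr_gt0 exprn_gt0.
have [p [J [Jp JM Joo]]] := block_schedule M.
have [|phi [iphi phiP]] := @diag_choice (fun s n =>
    (forall N, N \in iota 0 (p (size s)).+1 -> good N n) /\
    (forall Nm, Nm \in [seq (N, m) | N <- iota 0 (p (size s)).+1, m <- s] ->
      `|Ex (fun w => W Nm.1 w * (Z Nm.1 Nm.2 w * Z Nm.1 n w))| <= (size s).+1%:R^-1)).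
  move=> s.
  have U1 : \forall n \near \oo, forall N, N \in iota 0 (p (size s)).+1 -> good N n.
    by apply: (@filter_seq_forall _ _ _ _ (fun N n => good N n)) => N _; exact: good_near.
  have U2 : \forall n \near \oo, forall Nm, Nm \in [seq (N, m) | N <- iota 0 (p (size s)).+1, m <- s] ->
      `|Ex (fun w => W Nm.1 w * (Z Nm.1 Nm.2 w * Z Nm.1 n w))| <= (size s).+1%:R^-1.
    apply: (@filter_seq_forall _ _ _ _ (fun Nm n =>
      `|Ex (fun w => W Nm.1 w * (Z Nm.1 Nm.2 w * Z Nm.1 n w))| <= (size s).+1%:R^-1)) => Nm _.
    exact: cross_near.
  have [n [[n1 n2] /= sn]] := filter_ex (filterI (filterI U1 U2) (nbhs_infty_ge (\max_(i <- s) i).+1)).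
  exists n; split=> // m ms.
  by rewrite (leq_ltn_trans _ sn)// (big_rem m ms)/= leq_maxl.
have gphi N j : (N <= p j)%N -> good N (phi j).
  by move=> Nj; have [+ _] := phiP j; rewrite size_map size_iota; apply; rewrite mem_iota ltnS.
have xphi N i j : (i < j)%N -> (N <= p j)%N ->
    `|Ex (fun w => W N w * (Z N (phi i) w * Z N (phi j) w))| <= j.+1%:R^-1.
  move=> ij Nj; have [_] := phiP j; rewrite size_map size_iota => /(_ (N, phi i)); apply.
  apply/allpairsP; exists (N, phi i); split; rewrite ?mem_iota ?ltnS//=.
  by apply: map_f; rewrite mem_iota.
exists phi; split=> // psi ipsi.
pose m n := phi (psi n).
have psige n : (n <= psi n)%N by exact: strict_incr_ge.
(* Since [psi n >= n], position [n >= J N] of any further subsequence respects level [N]. Earlier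
   positions are set to 0 and treated separately. *)
pose z N n w := if (J N <= n)%N then Z N (m n) w else 0.
have bz N n : bdd (z N n) by rewrite /z; case: (J N <= n)%N => //; exact: bdd_cst.
have Jle N n : (J N <= n)%N -> (N <= p (psi n))%N.
  by move=> Jn; apply: Jp; exact: leq_trans (psige n).
have zsum N : Ex (fun w => W N w * (\sum_(i < N) z N i w) ^+ 2) <= N%:R * (4 * (N%:R * WV N) + 4).
  have WVN0 : 0 <= N%:R * WV N.
    by rewrite mulr_ge0//; apply: Ex_ge0 => w; rewrite mulr_ge0// indicE.
  rewrite (_ : N%:R * (4 * (N%:R * WV N) + 4) = N%:R * (4 * (N%:R * WV N) + 2 + 2)); last by ring.
  apply: Ex_weighted_sum_sqr => // [i iN|i j ij jN].
    rewrite /z; case: (leqP (J N) i) => Ji; first by apply: le_trans (good_sqr (gphi _ _ (Jle _ _ Ji))) _; lra.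
    by under eq_fun do rewrite expr0n/= mulr0; rewrite Ex_cst; lra.
  rewrite /z; case: (leqP (J N) i) => Ji; last first.
    by under eq_fun do rewrite mul0r mulr0; rewrite Ex_cst normr0 invr_ge0.
  have Jj := leq_trans Ji (ltnW ij); rewrite Jj.
  apply: le_trans (xphi _ _ _ (ipsi _ _ ij) (Jle _ _ Jj)) _.
  by rewrite lef_pV2 ?posrE// ler_nat ltnS.
pose y N n w := if (J N <= n)%N then W N w * trunc_sqr N (F (m n) w) else 0.
have by_ N n : bdd (y N n).
  by rewrite /y; case: (J N <= n)%N; [exact: bddM|exact: bdd_cst].
have y0 N n w : 0 <= y N n w.
  by rewrite /y; case: ifP => // _; rewrite mulr_ge0 ?trunc_sqr_ge0// indicE.
have ysum N : Ex (fun w => \sum_(i < N) y N i w) <= N%:R * (N%:R * WV N + 1).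
  rewrite Ex_sum//.
  have -> : N%:R * (N%:R * WV N + 1) = \sum_(i < N) (N%:R * WV N + 1).
    by rewrite sumr_const card_ord mulr_natl.
  apply: ler_sum => i _; rewrite /y; case: (leqP (J N) i) => Ji; first exact: gphi (Jle _ _ Ji).
  have WVN0 : 0 <= N%:R * WV N.
    by rewrite mulr_ge0//; apply: Ex_ge0 => w; rewrite mulr_ge0// indicE.
  by rewrite Ex_cst; lra.
have mavg N : measurable_fun setT (fun w => avg F (phi \o psi) N w - D N w).
  apply: measurable_funB => //; apply: measurable_funM; first exact: measurable_cst.
  by apply: measurable_sum => i; exact: mF.
apply/(conv_in_probP P mavg) => e e0 c c0.
(* One third each for the centered sum from [J N] on, the first [J N] values of [F], and the [J N]
   copies of [D N] subtracted from them. Likewise [c] is shared among five exceptional events. *)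
pose e3 := e / 3; have e30 : 0 < e3 by rewrite divr_gt0.
have e32 : 0 < e3 ^+ 2 by rewrite exprn_gt0.
have c5 : 0 < c / 5 by rewrite divr_gt0.
have near1 := (conv_in_probP P mV).1 cV 1 ltr01 _ c5.
have near2 := (conv_in_probP P mV).1 cV _ e32 _ c5.
have [j0 j0P] : exists j0 : nat, (j0.+1%:R^-1 <= e3) /\ (j0.+1%:R^-1 <= c / 5).
  pose t := e3^-1 + (c / 5)^-1.
  have t1 : t <= (Num.truncn t).+1%:R by rewrite ltW// truncnS_gt.
  have i1 : 0 < e3^-1 by rewrite invr_gt0.
  have i2 : 0 < (c / 5)^-1 by rewrite invr_gt0.
  exists (Num.truncn t); split; rewrite -[leRHS]invrK lef_pV2 ?posrE// (le_trans _ t1)//.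
    by rewrite /t lerDl ltW.
  by rewrite /t lerDr ltW.
have near3 := Joo j0.
(* Markov's inequality at level [(N * e3) ^+ 2] turns [zsum] into [(36 / e ^+ 2) * (WV N + 1 / N)];
   [K] is twice that factor. *)
pose K := 18 / e ^+ 2 * 4.
have K0 : 0 < K by rewrite mulr_gt0// divr_gt0// exprn_gt0.
have cinv : (N%:R : R)^-1 @[N --> \oo] --> (0 : R).
  by apply/gtr0_cvgV0; [exists 1%N => // n /= n0; rewrite ltr0n|exact: cvgr_idn].
have near4 : \forall N \near \oo, WV N + N%:R^-1 <= c / 5 /\ K * (WV N + N%:R^-1) <= c / 5.
  have cs : WV N + N%:R^-1 @[N --> \oo] --> (0 : R).
    by rewrite -[X in _ --> X](addr0 (0 : R)); exact: cvgD.
  have c6 : 0 < Num.min (c / 5) (c / 5 / K) by rewrite lt_min c5 divr_gt0.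
  move/cvgrPdist_le : cs => /(_ _ c6); apply: filterS => N.
  rewrite sub0r normrN => /(le_trans (ler_norm _)); rewrite le_min => /andP[-> h].
  by split=> //; rewrite mulrC -ler_pdivlMr.
have near5 : \forall N \near \oo, (0 < N)%N by exact: nbhs_infty_gt.
apply: (filterS _ (filterI near1 (filterI near2 (filterI near3 (filterI near4 near5))))).
move=> N [PV1 [PV2 [JN [[WVc KWVc] N0]]]].
have NR : 0 < N%:R :> R by rewrite ltr0n.
have J0 : (0 < J N)%N by exact: leq_trans JN.
have [JJ MJ] := JM N J0.
have JR : 0 < (J N)%:R :> R by rewrite ltr0n.
have JN_ : (J N <= N)%N by rewrite (leq_trans _ JJ)// -[leqLHS]expn1 leq_pexp2l.
have Jinv : (J N)%:R^-1 <= j0.+1%:R^-1 :> R by rewrite lef_pV2 ?posrE// ler_nat.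
(* Off [A1] the weight [W N] is 1. Off [A2] the head terms are small. A single late term larger than
   [N] would already put a point outside [A1] into [A3], so off both truncation changes nothing. Off
   [A4] the centered sum is small, and off [A5] so is the contribution of [D N] to the head. *)
pose A1 := [set w | 1 < `|V N w|].
pose A2 := \big[setU/set0]_(i < J N) [set w | N%:R / (J N)%:R ^+ 2 < `|F (m i) w|].
pose A3 := [set w | N%:R ^+ 2 <= \sum_(i < N) y N i w].
pose A4 := [set w | (N%:R * e3) ^+ 2 <= W N w * (\sum_(i < N) z N i w) ^+ 2].
pose A5 := [set w | e3 ^+ 2 < `|V N w|].
have mA1 : measurable A1 by exact: measurable_norm_gt.
have mA2i n : measurable [set w | N%:R / (J N)%:R ^+ 2 < `|F (m n) w|] by exact: measurable_norm_gt.
have mA2 : measurable A2 by exact: bigsetU_measurable.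
have bys : bdd (fun w => \sum_(i < N) y N i w) by exact: bdd_sum.
have mA3 : measurable A3 by apply: measurable_ge; case: bys.
have bzs : bdd (fun w => W N w * (\sum_(i < N) z N i w) ^+ 2).
  by apply: bddM => //; apply: bddX; exact: bdd_sum.
have mA4 : measurable A4 by apply: measurable_ge; case: bzs.
have mA5 : measurable A5 by exact: measurable_norm_gt.
(* Tightness is used at stage [(J N).-1], whose bound is the inverse square of [J N]; the [J N]
   events together have probability at most [1 / J N]. *)
have P2 : Pr A2 <= c / 5.
  apply: le_trans (Pr_bigU _ _ _) _ => //.
  apply: (@le_trans _ _ (\sum_(i < J N) ((J N)%:R ^+ 2)^-1)).
    apply: ler_sum => i _; have := MP (J N).-1 (m i); rewrite prednK//.
    apply: le_trans; apply: Pr_le => //; first exact: measurable_norm_gt.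
    by move=> w /=; apply: le_lt_trans; rewrite ler_pdivlMr// exprn_gt0.
  rewrite sumr_const card_ord -[_ *+ _]mulr_natl expr2 invfM mulrA divff ?gt_eqF// mul1r.
  by apply: le_trans Jinv _; case: j0P.
have P3 : Pr A3 <= c / 5.
  have N2 : 0 < N%:R ^+ 2 :> R by rewrite exprn_gt0.
  have y0s w : 0 <= \sum_(i < N) y N i w by apply: sumr_ge0.
  have h := @Pr_markov _ _ _ P A3 _ _ N2 mA3 bys y0s (fun w => id).
  apply: le_trans h _; rewrite ler_pdivrMr// (le_trans (ysum N))//.
  have -> : N%:R * (N%:R * WV N + 1) = (WV N + N%:R^-1) * N%:R ^+ 2.
    by field; rewrite gt_eqF.
  by rewrite ler_pM2r.
have P4 : Pr A4 <= c / 5.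
  have N2 : 0 < (N%:R * e3) ^+ 2 :> R by rewrite exprn_gt0// mulr_gt0.
  have zz w : 0 <= W N w * (\sum_(i < N) z N i w) ^+ 2 by rewrite mulr_ge0 ?sqr_ge0// indicE.
  have h := @Pr_markov _ _ _ P A4 _ _ N2 mA4 bzs zz (fun w => id).
  apply: le_trans h _; rewrite ler_pdivrMr// (le_trans (zsum N))//.
  have -> : N%:R * (4 * (N%:R * WV N) + 4) = (K / 2 * (WV N + N%:R^-1)) * (N%:R * e3) ^+ 2.
    by rewrite /K /e3; field; rewrite !gt_eqF.
  have WV1 : 0 <= WV N by apply: Ex_ge0 => w; rewrite mulr_ge0// indicE.
  have Ni : 0 <= N%:R^-1 :> R by rewrite invr_ge0.
  rewrite ler_pM2r// (le_trans _ KWVc)// mulrAC ler_pdivrMr//.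
  have : 0 <= K * (WV N + N%:R^-1) by apply: mulr_ge0; [exact: ltW|exact: addr_ge0].
  lra.
apply: (@le_trans _ _ (Pr (A1 `|` (A2 `|` (A3 `|` (A4 `|` A5)))))); last first.
  have h4 := Pr_U P mA4 mA5.
  have h3 := Pr_U P mA3 (measurableU _ _ mA4 mA5).
  have h2 := Pr_U P mA2 (measurableU _ _ mA3 (measurableU _ _ mA4 mA5)).
  have h1 := Pr_U P mA1 (measurableU _ _ mA2 (measurableU _ _ mA3 (measurableU _ _ mA4 mA5))).
  rewrite -/A1 in PV1; rewrite -/A5 in PV2; lra.
have mA : measurable (A1 `|` (A2 `|` (A3 `|` (A4 `|` A5)))) by do 4 apply: measurableU => //.
rewrite -!Ex_indic//; last exact: measurable_norm_gt.
apply: Ex_le_ae; [by apply: bdd_indic; exact: measurable_norm_gt|exact: bdd_indic|].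
apply: filterS (sqr_center_le N) => w Dw; rewrite !indicE ler_nat.
case: (boolP (w \in _)) => //; rewrite inE/= => ew; rewrite lt0b inE/=.
apply: contrapT => /not_orP[/negP nA1 /not_orP[nA2 /not_orP[/negP nA3 /not_orP[/negP nA4 /negP nA5]]]].
move: nA1 nA3 nA4 nA5; rewrite /A1 /A3 /A4 /A5 /= -!leNgt -!ltNge => nA1 nA3 nA4 nA5.
have Ww : W N w = 1.
  by rewrite /W indicE mem_set//= (le_trans (ler_norm _)).
have zE n : (J N <= n)%N -> (n < N)%N -> z N n w = F (m n) w - D N w.
  move=> Jn nN; rewrite /z Jn /Z /trunc; case: leP => // Fn.
  exfalso; move: nA3; rewrite ltNge => /negP; apply.
  rewrite (bigD1 (Ordinal nN))//= {1}/y Jn Ww mul1r trunc_sqr_gt// lerDl.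
  by apply: sumr_ge0 => i _; exact: y0.
have Fhead n : (n < J N)%N -> `|F (m n) w| <= N%:R / (J N)%:R ^+ 2.
  move=> nJ; rewrite leNgt; apply/negP => lt; apply: nA2.
  rewrite /A2 -(bigcup_mkord (J N)
    (fun n => [set w | N%:R / (J N)%:R ^+ 2 < `|F (m n) w|])).
  by exists n.
(* With [(J N)^2 <= N] and [sqr_center_le], the square of the left side is at most [N * vb N w],
   that is, [V N w] times the square of [N]. *)
have Dhead : (J N)%:R * `|D N w| <= N%:R * e3.
  have NE : 0 <= N%:R * e3 by apply: mulr_ge0 => //; exact: ltW.
  have JD : 0 <= (J N)%:R * `|D N w| by exact: mulr_ge0.
  rewrite -ler_sqr ?nnegrE// !exprMn -normrX ger0_norm ?sqr_ge0//.
  apply: (@le_trans _ _ (N%:R * vb N w)).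
    by rewrite ler_pM ?sqr_ge0// -natrX ler_nat.
  have -> : N%:R * vb N w = N%:R ^+ 2 * V N w by rewrite /V; field; rewrite gt_eqF.
  by rewrite ler_pM2l ?exprn_gt0// -exprMn; exact: le_trans (ler_norm _) nA5.
have Zsum : `|\sum_(i < N) z N i w| < N%:R * e3.
  have NE : 0 <= N%:R * e3 by apply: mulr_ge0 => //; exact: ltW.
  rewrite -ltr_sqr ?nnegrE//.
  by rewrite -normrX ger0_norm ?sqr_ge0//; move: nA4; rewrite Ww mul1r.
have split_sum : avg F (phi \o psi) N w - D N w = N%:R^-1 *
    (\sum_(i < N) z N i w + \sum_(i < J N) (F (m i) w - D N w)).
  have DE : D N w = N%:R^-1 * \sum_(i < N) D N w.
    by rewrite sumr_const card_ord -(mulr_natl (D N w)) mulKf// gt_eqF.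
  rewrite {1}DE /avg -mulrBr -sumrB; congr (_ * _).
  rewrite -(big_mkord xpredT (fun i => F (m i) w - D N w)).
  rewrite -(big_mkord xpredT (fun i => z N i w)) -(big_mkord xpredT (fun i => F (m i) w - D N w)).
  rewrite (big_cat_nat (n := J N))//= [in RHS](big_cat_nat (n := J N) (p := N))//=.
  have -> : \sum_(0 <= i < J N) z N i w = 0.
    by rewrite big_nat_cond big1// => i /andP[/andP[_ iJ] _]; rewrite /z leqNgt iJ.
  rewrite add0r.
  rewrite addrC; congr (_ + _); rewrite !big_nat; apply: eq_bigr => i /andP[Ji iN].
  by rewrite zE.
have head : `|\sum_(i < J N) (F (m i) w - D N w)| <= N%:R * e3 + N%:R * e3.
  apply: le_trans (ler_norm_sum _ _ _) _.
  apply: (@le_trans _ _ (\sum_(i < J N) (N%:R / (J N)%:R ^+ 2 + `|D N w|))).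
    by apply: ler_sum => i _; rewrite (le_trans (ler_normB _ _))// lerD2r Fhead.
  rewrite sumr_const card_ord -[_ *+ _]mulr_natl mulrDr lerD//.
  have -> : (J N)%:R * (N%:R / (J N)%:R ^+ 2) = N%:R * (J N)%:R^-1 :> R.
    by field; rewrite gt_eqF.
  by rewrite ler_pM2l// (le_trans Jinv)//; case: j0P.
suff h : `|avg F (phi \o psi) N w - D N w| <= e by move: ew; rewrite ltNge h.
rewrite split_sum normrM ger0_norm ?invr_ge0//.
rewrite ler_pdivrMl// (le_trans (ler_normD _ _))//.
have := ltW Zsum; move: head; rewrite /e3.
have -> : N%:R * e = N%:R * (e / 3) + (N%:R * (e / 3) + N%:R * (e / 3)) by lra.
by move=> h1 h2; apply: lerD.
Qed.

End core_suff.

(** * Necessity of the moment condition *)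

Section core_nec.
Context {d : measure_display} {Omega : measurableType d} {R : realType}.
Variable P : probability Omega R.
Local Notation Ex := (expect P).
Local Notation Pr := (prob P).
Variables (F D : nat -> Omega -> R).
Hypothesis mF : forall n, measurable_fun setT (F n).
Hypothesis mD : forall N, measurable_fun setT (D N).

Lemma measurable_avg psi N : measurable_fun setT (avg F psi N).
Proof.
apply: measurable_funM; first exact: measurable_cst.
by apply: measurable_sum => i; exact: mF.
Qed.

Let mdev psi N : measurable_fun setT (fun w => avg F psi N w - D N w).
Proof. by apply: measurable_funB => //; exact: measurable_avg. Qed.

Lemma Pr_gt_le (X Y : Omega -> R) (a b : R) : measurable_fun setT X -> measurable_fun setT Y ->
  (forall w, a < `|X w| -> b < `|Y w|) -> Pr [set w | a < `|X w|] <= Pr [set w | b < `|Y w|].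
Proof. by move=> mX mY XY; apply: Pr_le => //; exact: measurable_norm_gt. Qed.

Lemma Pr_gt_B (X Y : Omega -> R) (a b : R) : measurable_fun setT X -> measurable_fun setT Y ->
  Pr [set w | a + b < `|X w - Y w|] <= Pr [set w | a < `|X w|] + Pr [set w | b < `|Y w|].
Proof.
move=> mX mY; have mA := measurable_norm_gt a mX; have mB := measurable_norm_gt b mY.
apply: le_trans (Pr_U P mA mB); apply: Pr_le => //.
- by apply: measurable_norm_gt; exact: measurable_funB.
- exact: measurableU.
move=> w /= h; apply: contrapT => /not_orP[/negP + /negP]; rewrite -!leNgt => h1 h2.
by move: h; rewrite ltNge (le_trans (ler_normB _ _))// lerD.
Qed.

Lemma avgS psi N w : avg F (psi \o S) N w - avg F psi N w =
  N%:R^-1 * (F (psi N) w - F (psi 0%N) w).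
Proof.
rewrite /avg -mulrBr -sumrB; congr (_ * _).
by rewrite -(big_mkord xpredT (fun i => F (psi i.+1) w - F (psi i) w)) telescope_sumr.
Qed.

Hypothesis lln : forall psi, strict_incr psi ->
  conv_in_prob P (fun N w => avg F psi N w - D N w).

(** Without tightness there is a subsequence [psi] along which |F (psi N)| > N has probability above
    [e] for every [N]. The averages along [psi] and along its shift are both close to [D N], and
    they differ by (F (psi N) - F (psi 0)) / N, which must therefore tend to 0 in probability. *)
Lemma tight_of_lln (e : R) : 0 < e -> exists M : R, forall n, Pr [set w | M < `|F n w|] <= e.
Proof.
move=> e0; apply: contrapT => /forallNP nt.
have {}nt M : exists n, e < Pr [set w | M < `|F n w|].
  by have /existsNP[n /negP] := nt M; rewrite -ltNge; exists n.
have e4 : 0 < e / 4 by rewrite divr_gt0.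
have /choice[m mP] n := tight1 P (mF n) e0.
have [|psi [ipsi psiP]] := @diag_choice (fun s n => e < Pr [set w | (size s)%:R < `|F n w|]).
  (* Beyond [size s], the level exceeds the tightness levels of all terms up to the largest index in
     [s]; an index violating it must lie past them. *)
  move=> s; pose K := (size s + \sum_(i < (\max_(j <- s) j).+1) m i)%N.
  have [n nP] := nt K%:R; exists n; split; last first.
    apply: lt_le_trans nP _; apply: Pr_gt_le => // w.
    by apply: le_lt_trans; rewrite ler_nat leq_addr.
  move=> j js; rewrite ltnNge; apply/negP => nj.
  have ns : (n < (\max_(j <- s) j).+1)%N.
    by rewrite ltnS (leq_trans nj)// (big_rem j js)/= leq_maxl.
  move: nP; rewrite ltNge => /negP; apply; apply: le_trans (mP n).
  apply: Pr_gt_le => // w; apply: le_lt_trans; rewrite ler_nat.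
  by rewrite /K (bigD1 (Ordinal ns))//= addnCA leq_addr.
have psiN N : e < Pr [set w | N%:R < `|F (psi N) w|].
  by have := psiP N; rewrite size_map size_iota.
have ipsiS : strict_incr (psi \o S) by move=> a b ab; apply: ipsi.
have q4 : 0 < 4^-1 :> R by [].
have n1 := (conv_in_probP P (mdev psi)).1 (lln ipsi) _ q4 _ e4.
have n2 := (conv_in_probP P (mdev (psi \o S))).1 (lln ipsiS) _ q4 _ e4.
have [m0 m0P] := tight1 P (mF (psi 0%N)) e4.
have n4 : \forall N \near \oo, (2 * m0 < N)%N by exact: nbhs_infty_gt.
have [N [n1N [n2N n4N]]] := filter_ex (filterI n1 (filterI n2 n4)).
have N0 : 0 < N%:R :> R by rewrite ltr0n (leq_ltn_trans _ n4N).
have h1 : Pr [set w | 4^-1 + 4^-1 < `|N%:R^-1 * (F (psi N) w - F (psi 0%N) w)|] <= e / 4 + e / 4.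
  apply: le_trans (lerD n2N n1N); apply: le_trans (Pr_gt_B _ _ _ _) => //.
  apply: Pr_gt_le => //; first by apply: measurable_funM; [exact: measurable_cst|exact: measurable_funB].
    by apply: measurable_funB.
  by move=> w; rewrite opprB addrA subrK avgS.
have h2 : Pr [set w | N%:R < `|F (psi N) w|] <= (e / 4 + e / 4) + e / 4.
  apply: le_trans (lerD h1 m0P).
  have m1 : measurable_fun setT (fun w => N%:R^-1 * (F (psi N) w - F (psi 0%N) w)).
    by apply: measurable_funM; [exact: measurable_cst|exact: measurable_funB].
  have m2 := measurable_norm_gt (4^-1 + 4^-1) m1.
  have m3 := measurable_norm_gt m0%:R (mF (psi 0%N)).
  apply: le_trans (Pr_U P m2 m3); apply: Pr_le; [exact: measurable_norm_gt|exact: measurableU|].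
  move=> w /= Nw; case: (ltP m0%:R `|F (psi 0%N) w|) => [|h]; [by right|left].
  rewrite normrM ger0_norm ?invr_ge0// ltr_pdivlMl//.
  have m0N : 2 * m0%:R < N%:R :> R by rewrite -natrM ltr_nat.
  have := lerB_dist (F (psi N) w) (F (psi 0%N) w); lra.
have := psiN N; lra.
Qed.

(* Otherwise longer and longer initial segments of bad subsequences can be spliced into a
   single subsequence that violates the law of large numbers. *)
Lemma uniform_lln (e : R) : 0 < e -> exists N0, forall N, (N0 <= N)%N -> exists L,
  forall psi, strict_incr psi -> (L <= psi 0%N)%N ->
    Pr [set w | e < `|avg F psi N w - D N w|] <= e.
Proof.
move=> e0; apply: contrapT => /forallNP nu.
have {}nu N0 : exists N, (N0 <= N)%N /\ forall L, exists psi,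
    [/\ strict_incr psi, (L <= psi 0%N)%N & e < Pr [set w | e < `|avg F psi N w - D N w|]].
  have /existsNP[N /not_implyP[N0N /forallNP h]] := nu N0; exists N; split=> // L.
  have /existsNP[psi /not_implyP[ipsi /not_implyP[Lpsi /negP]]] := h L.
  by rewrite -ltNge; exists psi.
have e2 : 0 < e / 2 by rewrite divr_gt0.
have step (st : (nat -> nat) * nat) : exists st' : (nat -> nat) * nat, strict_incr st.1 ->
    [/\ strict_incr st'.1, (st.2 < st'.2)%N, (forall n, (n < st.2)%N -> st'.1 n = st.1 n) &
      e / 2 < Pr [set w | e / 2 < `|avg F st'.1 st'.2 w - D st'.2 w|]].
  case: st => phi M /=; have [iphi|] := pselect (strict_incr phi); last by exists (phi, M).
  (* Exchanging the first [M] terms costs two families of [M] events of this probability, at most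
     [e / 2] in all; [N] is taken so large that off these events the average moves by at most
     [2 * M * K / N <= e / 2]. [M.+1] covers the initial stage, where [M = 0]. *)
  have eM : 0 < e / (4 * M.+1%:R) by rewrite divr_gt0// mulr_gt0.
  have [K KP] := tight_of_lln eM.
  have [N [NN Nbad]] := nu (maxn M.+1 (Num.truncn (4 * M%:R * K / e)).+1).
  move: NN; rewrite geq_max => /andP[MN KN].
  have [psi [ipsi Lpsi badpsi]] := Nbad (phi M).
  (* Positions are not shifted: [psi] is followed from position [M] on, and [psi 0 >= phi M] keeps
     the splice increasing. *)
  pose phi' n := if (n < M)%N then phi n else psi n.
  exists (phi', N) => _ /=; split=> //.
  - move=> a b ab; rewrite /phi'; case: ifPn => aM; case: ifPn => bM; [exact: iphi| |exfalso|exact: ipsi].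
      rewrite (leq_trans (iphi _ _ aM))// (leq_trans Lpsi)//.
      by case: b ab {bM} => // b _; exact/ltnW/ipsi.
    by move: aM; rewrite (ltn_trans ab bM).
  - by move=> n nM; rewrite /phi' nM.
  have N0 : 0 < N%:R :> R by rewrite ltr0n (leq_trans _ MN).
  have K4 : 4 * M%:R * K <= N%:R * e.
    rewrite -ler_pdivrMr// (le_trans (ltW (truncnS_gt _)))// ler_nat//.
  pose bad (G : nat -> nat) := \big[setU/set0]_(i < M) [set w | K < `|F (G i) w|].
  have mb G (i : nat) : measurable [set w | K < `|F (G i) w|] by exact: measurable_norm_gt.
  have mbad G : measurable (bad G) by exact: bigsetU_measurable.
  have Pbad G : Pr (bad G) <= e / 4.
    apply: le_trans (Pr_bigU _ _ _) _ => //.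
    apply: (@le_trans _ _ (\sum_(i < M) (e / (4 * M.+1%:R)))).
      by apply: ler_sum => i _; exact: KP.
    rewrite sumr_const card_ord -(mulr_natl (e / _)).
    rewrite (_ : _ * _ = e / 4 * (M%:R / M.+1%:R)); last by field; rewrite gt_eqF ?ltr0n// -natr1 ltr_wpDl.
    by rewrite ler_piMr ?divr_ge0// ?ler_pdivrMr ?mul1r ?ler_nat// ltW.
  have : Pr [set w | e < `|avg F psi N w - D N w|] <=
      Pr [set w | e / 2 < `|avg F phi' N w - D N w|] + (Pr (bad phi) + Pr (bad psi)).
    have mA := measurable_norm_gt (e / 2) (mdev phi' N).
    apply: le_trans (le_trans (Pr_U P mA (measurableU _ _ (mbad phi) (mbad psi))) _); last first.
      by rewrite lerD2l Pr_U.
    apply: Pr_le; [exact: measurable_norm_gt|by apply: measurableU => //; apply: measurableU|].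
    move=> w /= h; apply: contrapT => /not_orP[/negP + /not_orP[n1 n2]].
    rewrite -leNgt => n3.
    have nb G : ~ bad G w -> forall i, (i < M)%N -> `|F (G i) w| <= K.
      move=> nbG i iM; rewrite leNgt; apply/negP => lt; apply: nbG; rewrite /bad.
      by rewrite -(bigcup_mkord M (fun i => [set w | K < `|F (G i) w|])); exists i.
    have dE : avg F psi N w - avg F phi' N w = N%:R^-1 * \sum_(i < M) (F (psi i) w - F (phi i) w).
      rewrite /avg -mulrBr -sumrB; congr (_ * _).
      rewrite -(big_mkord xpredT (fun i => F (psi i) w - F (phi' i) w)).
      rewrite -(big_mkord xpredT (fun i => F (psi i) w - F (phi i) w)).
      rewrite (big_cat_nat (n := M))//=; last exact: ltnW.
      rewrite [X in _ + X]big_nat_cond [X in _ + X]big1 ?addr0.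
        by rewrite !big_nat; apply: eq_bigr => i /andP[_ iM]; rewrite /phi' iM.
      by move=> i /andP[/andP[Mi _] _]; rewrite /phi' ltnNge Mi subrr.
    have dle : `|avg F psi N w - avg F phi' N w| <= e / 2.
      rewrite dE normrM ger0_norm ?invr_ge0// ler_pdivrMl//.
      apply: le_trans (ler_norm_sum _ _ _) _.
      apply: (@le_trans _ _ (\sum_(i < M) (K + K))).
        apply: ler_sum => i _; rewrite (le_trans (ler_normB _ _))// lerD//; exact: nb.
      rewrite sumr_const card_ord -(mulr_natl (K + K)); lra.
    move: h; rewrite ltNge => /negP; apply.
    rewrite (_ : avg F psi N w - D N w = (avg F psi N w - avg F phi' N w) + (avg F phi' N w - D N w)); last by ring.
    by rewrite (le_trans (ler_normD _ _))//; lra.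
  have := Pbad phi; have := Pbad psi; lra.
have /choice[next nextP] := step.
pose st k := iter k next (id, 0%N).
have ist k : strict_incr (st k).1.
  by elim: k => [a b //|k ih]; have [] := nextP _ ih.
have Mst k : ((st k).2 < (st k.+1).2)%N by have [] := nextP _ (ist k).
have kM k : (k <= (st k).2)%N by elim: k => // k ih; exact: leq_ltn_trans (Mst k).
have stE k n : (n < (st k).2)%N -> (st k.+1).1 n = (st k).1 n.
  by have [_ _ + _] := nextP _ (ist k); exact.
have stE' k j n : (n < (st k).2)%N -> (st (j + k)%N).1 n = (st k).1 n.
  move=> nk; elim: j => // j ih; rewrite addSn stE//.
  elim: j {ih} => // j ih; rewrite addSn; exact: ltn_trans (Mst _).
(* Stage [n.+1] has already fixed all positions below [(st n.+1).2], hence position [n]. *)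
pose m n := (st n.+1).1 n.
have mE k n : (n < (st k).2)%N -> m n = (st k).1 n.
  move=> nk; rewrite /m; case: (leqP k n.+1) => [kn|nk'].
    by rewrite -(subnK kn) stE'.
  by rewrite -(subnK (ltnW nk')) stE'.
have im : strict_incr m.
  move=> a b ab; rewrite (mE b.+1 a) ?(mE b.+1 b)//; first exact: ist.
  by apply: leq_trans (kM b.+1); exact: ltnW.
have [N1 _ N1P] := (conv_in_probP P (mdev m)).1 (lln im) _ e2 _ e2.
have := N1P (st N1.+1).2 (leq_trans (leqnSn _) (kM _)).
have [_ _ _] := nextP _ (ist N1).
rewrite -/(st N1.+1) ltNge => /negP h1 h2; apply: h1; apply: le_trans h2.
apply: Pr_gt_le => // w; rewrite /avg.
by under [in X in _ -> X]eq_bigr => i _ do rewrite (mE N1.+1)//.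
Qed.

End core_nec.

(** * Rademacher sums and the Paley-Zygmund inequality *)

Section rademacher.
Context {R : realType}.
Implicit Types (G H : seq bool -> R) (x : nat -> R).

(** Expectation over [n] independent fair signs, a list of booleans being one sign pattern. *)
Fixpoint sign_avg (n : nat) (G : seq bool -> R) : R :=
  if n is n'.+1 then
    (sign_avg n' (fun l => G (true :: l)) + sign_avg n' (fun l => G (false :: l))) / 2
  else G [::].

Definition sgn_of (b : bool) : R := if b then 1 else - 1.

Fixpoint sign_sum (l : seq bool) (x : nat -> R) : R :=
  if l is b :: l' then sgn_of b * x 0%N + sign_sum l' (x \o S) else 0.

Lemma sign_avgS n G : sign_avg n.+1 G =
  (sign_avg n (fun l => G (true :: l)) + sign_avg n (fun l => G (false :: l))) / 2.
Proof. by []. Qed.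

Lemma sign_avg_le n G H : (forall l, size l = n -> G l <= H l) -> sign_avg n G <= sign_avg n H.
Proof.
elim: n G H => [|n ih] G H GH /=; first exact: GH.
by rewrite ler_pM2r// lerD//; apply: ih => l ln; apply: GH; rewrite /= ln.
Qed.

Lemma sign_avgD n G H : sign_avg n (fun l => G l + H l) = sign_avg n G + sign_avg n H.
Proof. by elim: n G H => [|n ih] G H //=; rewrite !ih; field. Qed.

Lemma sign_avgZ n c G : sign_avg n (fun l => c * G l) = c * sign_avg n G.
Proof. by elim: n G => [|n ih] G //=; rewrite !ih; field. Qed.

Lemma sign_avg_cst n c : sign_avg n (fun=> c) = c.
Proof. by elim: n => [|n ih] //=; rewrite !ih; field. Qed.

Lemma sum_sqrS n x : \sum_(i < n.+1) x i ^+ 2 = x 0%N ^+ 2 + \sum_(i < n) (x \o S) i ^+ 2.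
Proof. by rewrite big_ord_recl; congr (_ + _); apply: eq_bigr => i _; rewrite lift0. Qed.

Lemma sign_avg2 n c x : sign_avg n (fun l => (c + sign_sum l x) ^+ 2) =
  c ^+ 2 + \sum_(i < n) x i ^+ 2.
Proof.
elim: n c x => [|n ih] c x; first by rewrite /= big_ord0 !addr0.
have E b : (fun l => (c + sign_sum (b :: l) x) ^+ 2) =
    (fun l => ((c + sgn_of b * x 0%N) + sign_sum l (x \o S)) ^+ 2).
  by apply/funext => l; rewrite /= addrA.
by rewrite sign_avgS !E !ih sum_sqrS /sgn_of; field.
Qed.

(** Khintchine's inequality for the fourth moment is the case [c = 0]; the offset [c] carries the
    signs already fixed and closes the induction. *)
Lemma sign_avg4 n c x : sign_avg n (fun l => (c + sign_sum l x) ^+ 4) <=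
  c ^+ 4 + 6 * c ^+ 2 * (\sum_(i < n) x i ^+ 2) + 3 * (\sum_(i < n) x i ^+ 2) ^+ 2.
Proof.
elim: n c x => [|n ih] c x; first by rewrite /= big_ord0 expr0n/= !mulr0 !addr0.
have E b : (fun l => (c + sign_sum (b :: l) x) ^+ 4) =
    (fun l => ((c + sgn_of b * x 0%N) + sign_sum l (x \o S)) ^+ 4).
  by apply/funext => l; rewrite /= addrA.
rewrite sign_avgS !E.
have h1 := ih (c + sgn_of true * x 0%N) (x \o S).
have h2 := ih (c + sgn_of false * x 0%N) (x \o S).
rewrite ler_pdivrMr//; apply: le_trans (lerD h1 h2) _.
rewrite sum_sqrS /sgn_of.
set q := \sum_(i < n) _; set a := x 0%N.
have := sqr_ge0 (a ^+ 2); nra.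
Qed.

(** With S the signed sum and Q the sum of squares, S^2 <= S^4 / (12 Q) + 3 Q 1_{|S| > t} + t^2
    pointwise, because (S^2 - 6 Q)^2 >= 0. Averaging, with at most 3 Q^2 for the fourth moment and
    1/12 for the probability, gives Q <= Q / 4 + Q / 4 + t^2. *)
Lemma rademacher_paley_zygmund n x (t : R) : 0 <= t ->
  sign_avg n (fun l => (t < `|sign_sum l x|)%R%:R) <= 12^-1 ->
  \sum_(i < n) x i ^+ 2 <= 2 * t ^+ 2.
Proof.
move=> t0; set q := sign_avg _ _; set Q := \sum_(i < n) _ => q12.
have Q0 : 0 <= Q by apply: sumr_ge0 => i _; exact: sqr_ge0.
have [->|Qn0] := eqVneq Q 0; first by rewrite mulr_ge0 ?sqr_ge0.
have Qp : 0 < Q by rewrite lt_neqAle eq_sym Qn0.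
have e2 := sign_avg2 n 0 x; have e4 := sign_avg4 n 0 x.
have : sign_avg n (fun l => (0 + sign_sum l x) ^+ 2) <= sign_avg n (fun l =>
    (12 * Q)^-1 * (0 + sign_sum l x) ^+ 4 + (3 * Q * (t < `|sign_sum l x|)%R%:R + t ^+ 2)).
  apply: sign_avg_le => l _; rewrite add0r; case: ltP => tS /=; last first.
    rewrite mulr0 add0r ler_wpDl//.
      by apply: mulr_ge0; [rewrite invr_ge0 mulr_ge0|rewrite -[4%N]/(2 * 2)%N exprM; exact: sqr_ge0].
    by rewrite -[leLHS]ger0_norm ?sqr_ge0// normrX lerXn2r ?nnegrE.
  rewrite mulr1; set S := sign_sum l x.
  have -> : (12 * Q)^-1 * S ^+ 4 + (3 * Q + t ^+ 2) =
      S ^+ 2 + (12 * Q)^-1 * (S ^+ 2 - 6 * Q) ^+ 2 + t ^+ 2.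
    by field; rewrite gt_eqF.
  rewrite -addrA lerDl addr_ge0 ?sqr_ge0// mulr_ge0 ?sqr_ge0// invr_ge0 mulr_ge0//.
rewrite !sign_avgD !sign_avgZ sign_avg_cst e2 -/q -/Q.
rewrite !expr0n/= mulr0 mul0r !add0r in e4 *.
have : (12 * Q)^-1 * sign_avg n (fun l => (0 + sign_sum l x) ^+ 4) <= Q / 4.
  rewrite ler_pdivrMl ?mulr_gt0// (le_trans e4)// -/Q; lra.
have : 3 * Q * q <= Q / 4.
  have := ler_wpM2l Q0 q12; lra.
lra.
Qed.

End rademacher.

(** * Elementary inequalities for products and powers *)

Section real_inequalities.
Context {R : realType}.

Lemma prod_1sub_ge n (a : nat -> R) : (forall i, 0 <= a i <= 1) ->
  1 - \sum_(i < n) a i <= \prod_(i < n) (1 - a i) /\ 0 <= \prod_(i < n) (1 - a i) <= 1.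
Proof.
move=> a01; elim: n => [|n [ih /andP[ih0 ih1]]]; first by rewrite !big_ord0 subr0 ler01 !lexx.
rewrite !big_ord_recr/=; have /andP[a0 a1] := a01 n.
by split; [nra|apply/andP; split; nra].
Qed.

Lemma bernoulli_le n (x : R) : -1 <= x -> 1 + n%:R * x <= (1 + x) ^+ n.
Proof.
move=> x1; elim: n => [|n ih]; first by rewrite mul0r addr0 expr0.
rewrite exprSr -natr1; have x0 : 0 <= 1 + x by lra.
apply: le_trans (ler_wpM2r x0 ih).
have : 0 <= n%:R * x ^+ 2 by rewrite mulr_ge0 ?sqr_ge0.
nra.
Qed.

(** Bernoulli's inequality for 1 + x, combined with (1 - x)^n (1 + x)^n <= 1. *)
Lemma exprn_1sub_le n (x : R) : 0 <= x <= 1 -> (1 - x) ^+ n <= (1 + n%:R * x)^-1.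
Proof.
move=> /andP[x0 x1]; have h : 1 + n%:R * x <= (1 + x) ^+ n by apply: bernoulli_le; lra.
have p : 0 < 1 + n%:R * x by rewrite ltr_wpDr// mulr_ge0.
rewrite -[leRHS]mul1r ler_pdivlMr// (@le_trans _ _ ((1 - x) ^+ n * (1 + x) ^+ n))//.
  by rewrite ler_wpM2l// exprn_ge0// subr_ge0.
by rewrite -exprMn exprn_ile1//; nra.
Qed.

Lemma exprn_1add_le n (x : R) : 0 <= x -> n%:R * x < 1 -> (1 + x) ^+ n <= (1 - n%:R * x)^-1.
Proof.
move=> x0 nx; have [->|n0] := posnP n; first by rewrite expr0 mul0r subr0 invr1.
have x1 : x <= 1 by rewrite (le_trans _ (ltW nx))// ler_peMl// ler1n.
have p : 0 < 1 - n%:R * x by rewrite subr_gt0.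
rewrite -[leRHS]mul1r ler_pdivlMr// (@le_trans _ _ ((1 + x) ^+ n * (1 - x) ^+ n))//.
  rewrite ler_wpM2l ?exprn_ge0 ?addr_ge0//.
  by have := @bernoulli_le n (- x); rewrite mulrN; apply; lra.
by rewrite -exprMn exprn_ile1//; nra.
Qed.

End real_inequalities.

(** * Sums of squared differences *)

Section sign_averages.
Context {d : measure_display} {Omega : measurableType d} {R : realType}.
Variable P : probability Omega R.
Local Notation Ex := (expect P).
Local Notation Pr := (prob P).

Lemma bdd_sign_avg n (G : seq bool -> Omega -> R) : (forall l, bdd (G l)) ->
  bdd (fun w => sign_avg n (fun l => G l w)).
Proof.
elim: n G => [|n ih] G bG /=; first exact: bG.
apply: bddM; last exact: bdd_cst.
by apply: bddD; apply: (ih (fun l => G (_ :: l))).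
Qed.

Lemma Ex_sign_avg n (G : seq bool -> Omega -> R) : (forall l, bdd (G l)) ->
  Ex (fun w => sign_avg n (fun l => G l w)) = sign_avg n (fun l => Ex (G l)).
Proof.
elim: n G => [|n ih] G bG //=.
have b b : bdd (fun w => sign_avg n (fun l => G (b :: l) w)).
  by apply: (bdd_sign_avg n (G := fun l => G (b :: l))).
under eq_fun do rewrite mulrC; rewrite ExZ ?ExD//; last exact: bddD.
by rewrite mulrC (ih (fun l => G (true :: l)))// (ih (fun l => G (false :: l))).
Qed.

Lemma sign_sumE l (x : nat -> R) :
  sign_sum l x = \sum_(i < size l) sgn_of (nth true l i) * x i.
Proof.
elim: l x => [|b l ih] x; first by rewrite big_ord0.
by rewrite /= big_ord_recl ih/=; congr (_ + _); apply: eq_bigr => i _; rewrite lift0.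
Qed.

Variables (F D : nat -> Omega -> R).
Hypothesis mF : forall n, measurable_fun setT (F n).
Hypothesis mD : forall N, measurable_fun setT (D N).
Hypothesis lln : forall psi, strict_incr psi ->
  conv_in_prob P (fun N w => avg F psi N w - D N w).

Let X psi n w := F (psi n.*2) w - F (psi n.*2.+1) w.

Let mX psi n : measurable_fun setT (X psi n).
Proof. exact: measurable_funB. Qed.

Let msum psi l : measurable_fun setT (fun w => sign_sum l (X psi ^~ w)).
Proof.
under eq_fun do rewrite sign_sumE.
by apply: measurable_sum => i; apply: measurable_funM => //; exact: measurable_cst.
Qed.

(** For a sign pattern [l], the selections [phi true] and [phi false] take opposite members of each
    pair. Both averages have the same center [D N], which cancels in their difference, the signed
    sum divided by [N]; the factors 2 come from using two averages. *)
Lemma sign_sum_small (e : R) : 0 < e -> exists N0, forall N, (N0 <= N)%N -> exists L,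
  forall psi, strict_incr psi -> (L <= psi 0%N)%N -> forall l, size l = N ->
    Pr [set w | 2 * e * N%:R < `|sign_sum l (X psi ^~ w)|] <= 2 * e.
Proof.
move=> e0; have [N0 N0P] := uniform_lln mF mD lln e0.
exists (maxn 1 N0) => N; rewrite geq_max => /andP[Npos /N0P[L LP]].
exists L => psi ipsi Lpsi l lN.
have NR : 0 < N%:R :> R by rewrite ltr0n.
pose phi (b : bool) n := psi (n.*2 + (nth true l n (+) b))%N.
have iphi b : strict_incr (phi b).
  move=> i j ij; apply: ipsi; rewrite (@leq_trans i.+1.*2)//.
    by rewrite doubleS ltnS; case: (_ (+) _); rewrite ?addn1 ?addn0.
  by rewrite (@leq_trans j.*2) ?leq_double ?leq_addr.
have Lphi b : (L <= phi b 0%N)%N.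
  rewrite (leq_trans Lpsi)// /phi double0 add0n; case: (_ (+) _) => //=; exact/ltnW/ipsi.
have mdev b : measurable_fun setT (fun w => avg F (phi b) N w - D N w).
  by apply: measurable_funB => //; exact: measurable_avg.
have h b := LP (phi b) (iphi b) (Lphi b).
have -> : 2 * e = e + e by lra.
apply: le_trans (lerD (h true) (h false)); apply: le_trans (Pr_gt_B _ _ _ _ _) => //.
apply: Pr_gt_le => //; first exact: measurable_funB.
move=> w; rewrite opprB addrA subrK.
have -> : avg F (phi true) N w - avg F (phi false) N w = N%:R^-1 * sign_sum l (X psi ^~ w).
  rewrite /avg -mulrBr -sumrB sign_sumE lN; congr (_ * _); apply: eq_bigr => i _.
  rewrite /phi /X; case: (nth true l i) => /=; rewrite ?addn0 ?addn1 /sgn_of; ring.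
by rewrite normrM ger0_norm ?invr_ge0// ltr_pdivlMl// mulrC.
Qed.

(** [q w] is the proportion of sign patterns whose signed sum exceeds [t] at [w]. Its mean is at
    most [2 * e], so [q] is below 1/12 off an event of probability [24 * e], and there the sum of
    squares is at most [2 * t ^+ 2]. *)
Lemma sum_squares_small (e : R) : 0 < e -> exists N0, forall N, (N0 <= N)%N -> exists L,
  forall psi, strict_incr psi -> (L <= psi 0%N)%N ->
    Pr [set w | 8 * e ^+ 2 * N%:R ^+ 2 < \sum_(i < N) X psi i w ^+ 2] <= 24 * e.
Proof.
move=> e0; have [N0 N0P] := sign_sum_small e0.
exists N0 => N /N0P[L LP]; exists L => psi ipsi Lpsi.
have h := LP psi ipsi Lpsi.
pose t := 2 * e * N%:R.
have t0 : 0 <= t by rewrite !mulr_ge0// ltW.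
pose A l := [set w | t < `|sign_sum l (X psi ^~ w)|].
have mA l : measurable (A l) by exact: measurable_norm_gt.
pose q w := sign_avg N (fun l => \1_(A l) w : R).
have bq : bdd q by apply: (bdd_sign_avg N (G := fun l => \1_(A l))) => l; exact: bdd_indic.
have q0 w : 0 <= q w.
  by rewrite -(sign_avg_cst N (0 : R)); apply: sign_avg_le => l _; rewrite indicE.
have Eq : Ex q <= 2 * e.
  rewrite Ex_sign_avg => [|l]; last exact: bdd_indic.
  rewrite -(sign_avg_cst N (2 * e)); apply: sign_avg_le => l lN.
  by rewrite Ex_indic//; exact: h.
have mS : measurable_fun setT (fun w => \sum_(i < N) X psi i w ^+ 2).
  by apply: measurable_sum => i; exact: measurable_funX.
have c0 : 0 < 12^-1 :> R by [].
apply: le_trans (@Pr_markov _ _ _ P _ q _ c0 _ bq q0 _) _.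
- exact: measurable_gt.
- move=> w /=; apply: contraTT; rewrite -ltNge -leNgt => /ltW qw.
  have -> : 8 * e ^+ 2 * N%:R ^+ 2 = 2 * t ^+ 2 by rewrite /t; ring.
  apply: (@rademacher_paley_zygmund _ N (X psi ^~ w) t t0); apply: le_trans qw.
  by apply: sign_avg_le => l _; rewrite indicE mem_setE.
- by rewrite invrK; lra.
Qed.

(** A product of factors 1 - a_i with a_i in [0, 1] is at least 1 minus the sum of the a_i; where
    that sum is not known to be small the product is still nonnegative. *)
Lemma prod_trunc_ge (e : R) : 0 < e -> exists N0, forall N, (N0 <= N)%N -> exists L,
  forall psi, strict_incr psi -> (L <= psi 0%N)%N ->
    1 - 8 * e ^+ 2 - 24 * e <=
    Ex (fun w => \prod_(i < N) (1 - trunc_sqr N (X psi i w) / N%:R ^+ 2)).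
Proof.
move=> e0; have [N0 N0P] := sum_squares_small e0.
exists (maxn 1 N0) => N; rewrite geq_max => /andP[Npos /N0P[L LP]].
exists L => psi ipsi Lpsi; have h := LP psi ipsi Lpsi.
have N2 : 0 < N%:R ^+ 2 :> R by rewrite exprn_gt0// ltr0n.
set A := [set w | _] in h.
have mS : measurable_fun setT (fun w => \sum_(i < N) X psi i w ^+ 2).
  by apply: measurable_sum => i; exact: measurable_funX.
have mA : measurable A by exact: measurable_gt.
have bA : bdd (\1_A : Omega -> R) by exact: bdd_indic.
have bt i : bdd (fun w => 1 - trunc_sqr N (X psi i w) / N%:R ^+ 2).
  apply: bddB; first exact: bdd_cst.
  apply: bddM; last exact: bdd_cst.
  apply: bdd_comp (mX psi i); [exact: measurable_trunc_sqr|exact: norm_trunc_sqr].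
apply: (@le_trans _ _ (Ex (fun w => (1 - 8 * e ^+ 2) - \1_A w))).
  rewrite ExB//; last exact: bdd_cst.
  by rewrite Ex_cst Ex_indic//; lra.
apply: Ex_le.
- by apply: bddB => //; exact: bdd_cst.
- exact: bdd_prod.
move=> w; pose a i := trunc_sqr N (X psi i w) / N%:R ^+ 2.
have a01 i : 0 <= a i <= 1.
  by rewrite divr_ge0 ?trunc_sqr_ge0 ?sqr_ge0//= ler_pdivrMr// mul1r trunc_sqr_le.
have [p1 /andP[p0 _]] := prod_1sub_ge N a01.
have e20 : 0 <= e ^+ 2 by exact: sqr_ge0.
rewrite indicE; case: (boolP (w \in A)) => wA /=.
  by apply: le_trans p0; lra.
rewrite subr0; apply: le_trans p1; rewrite lerD2l lerN2 -mulr_suml ler_pdivrMr//.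
move: wA; rewrite notin_setE /A/= => /negP; rewrite -leNgt; apply: le_trans.
by apply: ler_sum => i _; rewrite ge_min lexx.
Qed.

End sign_averages.

Lemma near_dist_le (R : realType) (a : nat -> R) (l e : R) : a n @[n --> \oo] --> l -> 0 < e ->
  \forall n \near \oo, `|l - a n| <= e.
Proof. by move=> /cvgrPdist_le al /al. Qed.

Section inball.
Context {R : realType}.

Definition inball (M : nat) (x : R) : R := (`|x| <= M%:R)%R%:R.

Lemma measurable_inball M : measurable_fun setT (inball M).
Proof.
have -> : inball M = \1_[set x | `|x| <= M%:R].
  by apply/funext => x; rewrite indicE /inball; congr (nat_of_bool _)%:R; apply/idP/idP; rewrite inE.
by apply: measurable_indic; apply: measurable_le; exact: normr_measurable.
Qed.

Lemma norm_inball M x : `|inball M x| <= 1.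
Proof. by rewrite /inball normr_nat lern1 leq_b1. Qed.

End inball.

(** * Iterated weak limits and convergence of the second moments *)

Section second_moment.
Context {d : measure_display} {Omega : measurableType d} {R : realType}.
Variable P : probability Omega R.
Local Notation Ex := (expect P).
Local Notation Pr := (prob P).
Variables (F D : nat -> Omega -> R).
Hypothesis mF : forall n, measurable_fun setT (F n).
Hypothesis mD : forall N, measurable_fun setT (D N).

(* The indices are sent to infinity one after the other: factors already chosen are
   absorbed in [h], those still to come enter through the limit [1 - Bb * Tb]. *)
Lemma product_limit (b t : R -> R) (Bb Tb : Omega -> R) :
  (forall n, bdd (fun w => b (F n w))) -> (forall n, bdd (fun w => t (F n w))) -> bdd Bb -> bdd Tb ->
  (forall h, bdd h -> Ex (fun w => b (F n w) * h w) @[n --> \oo] --> Ex (fun w => Bb w * h w)) ->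
  (forall h, bdd h -> Ex (fun w => t (F n w) * h w) @[n --> \oo] --> Ex (fun w => Tb w * h w)) ->
  forall n h (e : R) L, bdd h -> 0 < e -> exists psi, [/\ strict_incr psi, (L <= psi 0%N)%N &
    `|Ex (fun w => h w * \prod_(i < n) (1 - b (F (psi i.*2.+1) w) * t (F (psi i.*2) w))) -
      Ex (fun w => h w * (1 - Bb w * Tb w) ^+ n)| <= e].
Proof.
move=> bb bt bB bT cb ct; elim=> [|n ih] h e L bh e0.
  exists (fun n => n + L)%N; split=> // [a c|]; first by rewrite ltn_add2r.
  under eq_fun do rewrite big_ord0; under [X in _ - Ex X]eq_fun do rewrite expr0.
  by rewrite subrr normr0 ltW.
(* A third of the error for each of the two indices of the new pair, a third for the induction
   hypothesis, which is applied with the new factor absorbed in [h]. *)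
have e3 : 0 < e / 3 by rewrite divr_gt0.
pose K w := 1 - Bb w * Tb w.
have bK : bdd K by apply: bddB; [exact: bdd_cst|exact: bddM].
have bhK : bdd (fun w => h w * K w ^+ n) by apply: bddM => //; exact: bddX.
have bhKB : bdd (fun w => Bb w * (h w * K w ^+ n)) by exact: bddM.
have n1 := near_dist_le (ct _ bhKB) e3.
have [i1 [n1i Li1]] := filter_ex (filterI n1 (nbhs_infty_ge L)).
have bhKt : bdd (fun w => t (F i1 w) * (h w * K w ^+ n)) by exact: bddM.
have n2 := near_dist_le (cb _ bhKt) e3.
have [i2 [n2i i12]] := filter_ex (filterI n2 (nbhs_infty_gt i1)).
pose k w := 1 - b (F i2 w) * t (F i1 w).
have bk : bdd k by apply: bddB; [exact: bdd_cst|exact: bddM].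
have bhk : bdd (fun w => h w * k w) by exact: bddM.
have [psi [ipsi Lpsi psiP]] := ih _ _ i2.+1 bhk e3.
pose psi' m := if m is m'.+1 then (if m' is m''.+1 then psi m'' else i2) else i1.
exists psi'; split=> //.
  move=> [|[|a]] [|[|c]] //= ac; last exact: ipsi.
  - apply: (leq_trans i12); apply: (leq_trans (leqnSn i2)); apply: (leq_trans Lpsi).
    by case: c ac => // c _; exact/ltnW/ipsi.
  - by apply: (leq_trans Lpsi); case: c ac => // c _; exact/ltnW/ipsi.
have -> : (fun w => h w * \prod_(i < n.+1) (1 - b (F (psi' i.*2.+1) w) * t (F (psi' i.*2) w))) =
    (fun w => h w * k w * \prod_(i < n) (1 - b (F (psi i.*2.+1) w) * t (F (psi i.*2) w))).
  by apply/funext => w; rewrite big_ord_recl mulrA.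
have E1 : Ex (fun w => h w * k w * K w ^+ n) =
    Ex (fun w => h w * K w ^+ n) - Ex (fun w => b (F i2 w) * (t (F i1 w) * (h w * K w ^+ n))).
  rewrite -ExB//; last exact: bddM.
  by congr (expect _ _); apply/funext => w; rewrite /k; ring.
have E2 : Ex (fun w => h w * K w ^+ n.+1) =
    Ex (fun w => h w * K w ^+ n) - Ex (fun w => Tb w * (Bb w * (h w * K w ^+ n))).
  rewrite -ExB//; last exact: bddM.
  by congr (expect _ _); apply/funext => w; rewrite exprS {1}/K; ring.
have E3 : Ex (fun w => Bb w * (t (F i1 w) * (h w * K w ^+ n))) =
    Ex (fun w => t (F i1 w) * (Bb w * (h w * K w ^+ n))).
  by congr (expect _ _); apply/funext => w; ring.
move: psiP n1i n2i; rewrite E1 E2 E3 -/K !ler_norml; lra.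
Qed.

Hypothesis lln : forall psi, strict_incr psi ->
  conv_in_prob P (fun N w => avg F psi N w - D N w).
Variables (vb bb : nat -> Omega -> R).
Hypothesis mvb : forall N, measurable_fun setT (vb N).
Hypothesis vb0 : forall N w, 0 <= vb N w.
Hypothesis vbN : forall N w, vb N w <= N%:R ^+ 2.
Hypothesis cv : forall N, wcv P (fun n w => trunc_sqr N (F n w)) (vb N).
Hypothesis mbb : forall M, measurable_fun setT (bb M).
Hypothesis bb0 : forall M w, 0 <= bb M w.
Hypothesis bb1 : forall M w, bb M w <= 1.
Hypothesis cb : forall M, wcv P (fun n w => inball M (F n w)) (bb M).

Let binball M n : bdd (fun w => inball M (F n w)).
Proof. exact: bdd_comp (measurable_inball M) (norm_inball M) (mF n). Qed.

Let bv N n : bdd (fun w => trunc_sqr N (F n w)).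
Proof. apply: bdd_comp (mF n); [exact: measurable_trunc_sqr|exact: norm_trunc_sqr]. Qed.

Let bvb N : bdd (vb N).
Proof. by apply: (@bddP _ _ _ _ (N%:R ^+ 2)) => // w; rewrite ger0_norm ?vb0. Qed.

Let bbb M : bdd (bb M).
Proof. by apply: (@bddP _ _ _ _ 1) => // w; rewrite ger0_norm. Qed.

Let cvE N h : bdd h -> Ex (fun w => trunc_sqr N (F n w) * h w) @[n --> \oo] --> Ex (fun w => vb N w * h w).
Proof.
apply: (@wcv_bdd _ _ _ P _ _ _ (N%:R ^+ 2)) => //.
- by move=> n; case: (bv N n).
- by move=> n w; exact: norm_trunc_sqr.
- by move=> w; rewrite ger0_norm ?vb0.
Qed.

Let cbE M h : bdd h -> Ex (fun w => inball M (F n w) * h w) @[n --> \oo] --> Ex (fun w => bb M w * h w).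
Proof.
apply: (@wcv_bdd _ _ _ P _ _ _ 1) => //.
- by move=> n; case: (binball M n).
- by move=> n w; exact: norm_inball.
- by move=> w; rewrite ger0_norm.
Qed.

Let tt M N x : R := trunc_sqr N x / (2 * N%:R ^+ 2) - M%:R ^+ 2 / N%:R ^+ 2.

(** From x^2 / 2 <= (x - y)^2 + y^2 with |y| <= M. The bound separates [x] from [y], as
    [product_limit] requires. *)
Let trunc_sqr_sub M N x y : (0 < N)%N ->
  0 <= 1 - trunc_sqr N (x - y) / N%:R ^+ 2 <= 1 - inball M y * tt M N x.
Proof.
move=> N0; have N2 : 0 < N%:R ^+ 2 :> R by rewrite exprn_gt0// ltr0n.
apply/andP; split.
  by rewrite subr_ge0 ler_pdivrMr// mul1r trunc_sqr_le.
rewrite lerD2l lerN2 /inball; case: (leP `|y| M%:R) => yM; last first.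
  by rewrite mul0r divr_ge0 ?trunc_sqr_ge0// ltW.
rewrite mul1r /tt ler_pdivlMr//.
have -> : (trunc_sqr N x / (2 * N%:R ^+ 2) - M%:R ^+ 2 / N%:R ^+ 2) * N%:R ^+ 2 =
    trunc_sqr N x / 2 - M%:R ^+ 2 :> R by field; rewrite gt_eqF// ltr0n.
have y2 : y ^+ 2 <= M%:R ^+ 2.
  by rewrite -[leLHS]ger0_norm ?sqr_ge0// normrX lerXn2r ?nnegrE.
have h1 : trunc_sqr N x <= x ^+ 2 by rewrite ge_min lexx.
have h2 := trunc_sqr_le N x.
rewrite [leRHS]/trunc_sqr le_min; apply/andP; split.
  have := sqr_ge0 (x - 2 * y); nra.
have := sqr_ge0 (M%:R : R); have := sqr_ge0 (N%:R : R); lra.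
Qed.

(** By tightness the expectation of [bb M] is at least [1 - c / 2] for large [M]; apply Markov's
    inequality to [1 - bb M] at level 1/2. *)
Let bbar_small (c : R) : 0 < c -> exists M, Pr [set w | bb M w < 2^-1] <= c.
Proof.
move=> c0; have c2 : 0 < c / 4 by rewrite divr_gt0.
have [K KP] := tight_of_lln mF mD lln c2.
pose M := (Num.truncn K).+1; exists M.
have MP n : 1 - c / 4 <= Ex (fun w => inball M (F n w)).
  have mA : measurable [set w | K < `|F n w|] by exact: measurable_norm_gt.
  have bA : bdd (\1_[set w | K < `|F n w|] : Omega -> R) by exact: bdd_indic.
  apply: (@le_trans _ _ (Ex (fun w => 1 - \1_[set w | K < `|F n w|] w))).
    by rewrite ExB ?Ex_cst ?Ex_indic// ?lerD2l ?lerN2//; exact: bdd_cst.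
  apply: Ex_le => // [|w]; first by apply: bddB => //; exact: bdd_cst.
  rewrite indicE /inball; case: (leP `|F n w| M%:R) => /= h.
    by rewrite lerBlDr lerDl.
  by rewrite mem_set/= ?subrr// (lt_trans _ h)// truncnS_gt.
have EM : 1 - c / 2 <= Ex (bb M).
  have e1 (X : Omega -> R) : (fun w => X w * 1) = X by apply/funext => w; rewrite mulr1.
  have := @cbE M _ (bdd_cst 1); rewrite e1; under eq_fun do rewrite e1.
  move/cvgrPdist_le => /(_ _ c2)/filter_ex[n]; rewrite ler_norml => /andP[+ _].
  have := MP n; lra.
have mA : measurable [set w | bb M w < 2^-1] by exact: measurable_lt.
have h0 : 0 < 2^-1 :> R by [].
have b1 : bdd (fun w => 1 - bb M w) by apply: bddB => //; exact: bdd_cst.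
apply: le_trans (@Pr_markov _ _ _ P _ (fun w => 1 - bb M w) _ h0 mA b1 _ _) _.
- by move=> w; rewrite subr_ge0.
- by move=> w /=; lra.
- by rewrite invrK ExB//; [rewrite Ex_cst; lra|exact: bdd_cst].
Qed.

(** 33 = 8 + 24 + 1: the losses in [prod_trunc_ge], with [e ^+ 2 <= e], and one [e] from
    [product_limit]. *)
Let power_near_one M (e : R) : 0 < e -> e <= 1 -> exists N0, forall N, (N0 <= N)%N ->
  1 - 33 * e <= Ex (fun w => (1 - bb M w * (vb N w / (2 * N%:R ^+ 2) - M%:R ^+ 2 / N%:R ^+ 2)) ^+ N).
Proof.
move=> e0 e1; have [N0 N0P] := prod_trunc_ge mF mD lln e0.
exists (maxn 1 N0) => N; rewrite geq_max => /andP[Npos /N0P[L LP]].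
have N2 : 0 < N%:R ^+ 2 :> R by rewrite exprn_gt0// ltr0n.
pose Tb w := vb N w / (2 * N%:R ^+ 2) - M%:R ^+ 2 / N%:R ^+ 2.
have bT : bdd Tb by apply: bddB; [apply: bddM => //; exact: bdd_cst|exact: bdd_cst].
have bt n : bdd (fun w => tt M N (F n w)).
  by apply: bddB; [apply: bddM => //; exact: bdd_cst|exact: bdd_cst].
have ct h : bdd h -> Ex (fun w => tt M N (F n w) * h w) @[n --> \oo] --> Ex (fun w => Tb w * h w).
  move=> bh; have E (X : Omega -> R) : bdd X ->
      Ex (fun w => (X w / (2 * N%:R ^+ 2) - M%:R ^+ 2 / N%:R ^+ 2) * h w) =
      (2 * N%:R ^+ 2)^-1 * Ex (fun w => X w * h w) - M%:R ^+ 2 / N%:R ^+ 2 * Ex h.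
    move=> bX; have bXh : bdd (fun w => X w * h w) by exact: bddM.
    rewrite -!ExZ// -ExB; [|by apply: bddM => //; exact: bdd_cst..].
    by congr (expect _ _); apply/funext => w; ring.
  rewrite /Tb E//; under eq_fun do rewrite /tt E//.
  apply: cvgB; last exact: cvg_cst.
  by apply: cvgM; [exact: cvg_cst|exact: cvE].
have [psi [ipsi Lpsi psiP]] := @product_limit (inball M) (tt M N) (bb M) Tb (binball M) bt (bbb M) bT
  (@cbE M) ct N (fun=> 1) e L (bdd_cst 1) e0.
have h1 := LP psi ipsi Lpsi.
have h2 : Ex (fun w => \prod_(i < N) (1 - trunc_sqr N (F (psi i.*2) w - F (psi i.*2.+1) w) / N%:R ^+ 2)) <=
    Ex (fun w => 1 * \prod_(i < N) (1 - inball M (F (psi i.*2.+1) w) * tt M N (F (psi i.*2) w))).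
  apply: Ex_le => [||w].
  - apply: bdd_prod => i; apply: bddB; first exact: bdd_cst.
    apply: bddM; last exact: bdd_cst.
    apply: (bdd_comp (measurable_trunc_sqr N) (norm_trunc_sqr N)); exact: measurable_funB.
  - apply: bddM; first exact: bdd_cst.
    by apply: bdd_prod => i; apply: bddB; [exact: bdd_cst|exact: bddM].
  - rewrite mul1r; apply: ler_prod => i _; exact: trunc_sqr_sub.
move: psiP; rewrite [X in _ - expect _ X](_ : _ = (fun w => (1 - bb M w * Tb w) ^+ N)); last first.
  by apply/funext => w; rewrite mul1r.
rewrite ler_norml => /andP[h3 h4].
have e2 : e ^+ 2 <= e by rewrite expr2 ler_piMl// ltW.
rewrite -/Tb; lra.
Qed.

(** Let [kap] be the base of the power in [power_near_one]. Everywhere [kap <= 1 + M^2 / N^2], so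
    its [N]-th power is at most [1 + del] for large [N]. Where [vb N / N > eta] and [bb M >= 1/2],
    moreover [kap <= 1 - eta / (8 N)], so the power is at most [lam]. As its expectation is at least
    [1 - del], that event has probability at most [2 * del / (1 - lam) = c / 2]. *)
Lemma second_moment_conv : conv_in_prob P (fun N w => vb N w / N%:R).
Proof.
have mV N : measurable_fun setT (fun w => vb N w / N%:R).
  by apply: measurable_funM => //; exact: measurable_cst.
apply/(conv_in_probP P mV) => eta eta0 c c0.
have c2 : 0 < c / 2 by rewrite divr_gt0.
have [M MP] := bbar_small c2.
pose lam := (1 + eta / 8)^-1.
have lam1 : lam < 1 by rewrite /lam invf_lt1 ?ltrDl ?divr_gt0// addr_gt0// divr_gt0.
have lam0 : 0 < lam by rewrite invr_gt0 addr_gt0// divr_gt0.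
pose del := (1 - lam) * c / 4.
have del0 : 0 < del by rewrite divr_gt0// mulr_gt0// subr_gt0.
pose e := Num.min 1 (del / 33).
have e0 : 0 < e by rewrite lt_min ltr01 divr_gt0.
have e1 : e <= 1 by rewrite ge_min lexx.
have e33 : 33 * e <= del by rewrite mulrC -ler_pdivlMr// ge_min lexx orbT.
have [N0 N0P] := power_near_one M e0 e1.
(* The inverse of [1 - M^2 / N] bounds the [N]-th power of [1 + M^2 / N^2], by [exprn_1add_le]. *)
have cU : ((1 - (M%:R ^+ 2) / N%:R)^-1 : R) @[N --> \oo] --> ((1 - M%:R ^+ 2 * 0)^-1 : R).
  apply: cvgV; first by rewrite mulr0 subr0 oner_neq0.
  apply: cvgB; first exact: cvg_cst.
  apply: cvgM; first exact: cvg_cst.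
  by apply/gtr0_cvgV0; [exists 1%N => // n /= n0; rewrite ltr0n|exact: cvgr_idn].
have n1 := near_dist_le cU del0.
have n2 : \forall N \near \oo, (N0 <= N)%N by exact: nbhs_infty_ge.
have n3 : \forall N \near \oo, (maxn (M ^ 2).+1 (Num.truncn (8 * M%:R ^+ 2 / eta)).+1 <= N)%N.
  exact: nbhs_infty_ge.
apply: (filterS _ (filterI n1 (filterI n2 n3))) => N [UN [/N0P h]].
rewrite geq_max => /andP[MN KN].
have NR : 0 < N%:R :> R by rewrite ltr0n (leq_trans _ MN).
have M2N : M%:R ^+ 2 < N%:R :> R by rewrite -natrX ltr_nat.
have K8 : 8 * M%:R ^+ 2 <= N%:R * eta.
  by rewrite -ler_pdivrMr// (le_trans (ltW (truncnS_gt _)))// ler_nat.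
have {}UN : (1 - (M%:R ^+ 2) / N%:R)^-1 <= 1 + del :> R.
  by move: UN; rewrite mulr0 subr0 invr1 ler_norml => /andP[]; lra.
pose A := [set w | eta < `|vb N w / N%:R|]; pose B := [set w | bb M w < 2^-1].
have mA : measurable A by exact: measurable_norm_gt.
have mB : measurable B by exact: measurable_lt.
have mAB : measurable (A `\` B) by exact: measurableD.
have bAB : bdd (\1_(A `\` B) : Omega -> R) by exact: bdd_indic.
suff hAB : Pr (A `\` B) <= c / 2.
  have hB : Pr B <= c / 2 by [].
  apply: (@le_trans _ _ (Pr ((A `\` B) `|` B))).
    by apply: Pr_le => //; [exact: measurableU|move=> w Aw; have [|nB] := pselect (B w); [right|left]].
  have := Pr_U P mAB mB; lra.
pose kap w := 1 - bb M w * (vb N w / (2 * N%:R ^+ 2) - M%:R ^+ 2 / N%:R ^+ 2).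
have N2 : 0 < N%:R ^+ 2 :> R by rewrite exprn_gt0.
have M0 : 0 <= M%:R ^+ 2 / N%:R ^+ 2 :> R by rewrite divr_ge0 ?sqr_ge0.
have vN0 w : 0 <= vb N w / (2 * N%:R ^+ 2) <= 2^-1.
  rewrite divr_ge0 ?mulr_ge0 ?sqr_ge0//= ler_pdivrMr ?mulr_gt0// mulrA mulVf// mul1r.
  exact: vbN.
have kap0 w : 0 <= kap w.
  by rewrite /kap; have /andP[] := vN0 w; have := bb0 M w; have := bb1 M w; nra.
have bkap : bdd kap.
  apply: bddB; first exact: bdd_cst.
  apply: bddM => //; apply: bddB; last exact: bdd_cst.
  by apply: bddM => //; exact: bdd_cst.
have U1 : 1 <= (1 - (M%:R ^+ 2) / N%:R)^-1 :> R.
  rewrite invf_ge1 ?gerBl ?divr_ge0 ?sqr_ge0// subr_gt0 ltr_pdivrMr// mul1r//.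
have NMN : N%:R * (M%:R ^+ 2 / N%:R ^+ 2) = M%:R ^+ 2 / N%:R :> R.
  by field; rewrite gt_eqF.
have kapN w : kap w ^+ N <= (1 + del) - (1 - lam) * \1_(A `\` B) w.
  rewrite indicE; case: (boolP (w \in _)) => [|_]; rewrite ?mulr1 ?mulr0 ?subr0.
    rewrite inE => -[]; rewrite /A /B/= ger0_norm ?divr_ge0// => Aw /negP; rewrite -leNgt => Bw.
    apply: (@le_trans _ _ lam); last lra.
    have x01 : 0 <= eta / (8 * N%:R) <= 1.
      rewrite divr_ge0 ?mulr_ge0 ?(ltW eta0)//= ler_pdivrMr ?mulr_gt0// mul1r.
      have := vN0 w; have := vbN N w; move: Aw; rewrite ltr_pdivlMr//; nra.
    apply: (@le_trans _ _ ((1 - eta / (8 * N%:R)) ^+ N)).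
      rewrite lerXn2r ?nnegrE//; first by case/andP: x01 => _; rewrite subr_ge0.
      rewrite /kap.
      have q1 : eta / (2 * N%:R) <= vb N w / (2 * N%:R ^+ 2).
        rewrite (_ : vb N w / (2 * N%:R ^+ 2) = vb N w / N%:R / (2 * N%:R)); last by field; rewrite gt_eqF.
        by rewrite ler_pM2r ?invr_gt0 ?mulr_gt0// ltW.
      have q2 : M%:R ^+ 2 / N%:R ^+ 2 <= eta / (8 * N%:R).
        rewrite ler_pdivrMr// (_ : eta / (8 * N%:R) * N%:R ^+ 2 = N%:R * eta / 8); last by field; rewrite gt_eqF.
        by rewrite ler_pdivlMr// mulrC.
      have q3 : eta / (2 * N%:R) = 4 * (eta / (8 * N%:R)) by field; rewrite gt_eqF.
      have q4 : 4 * (eta / (8 * N%:R)) <= vb N w / (2 * N%:R ^+ 2) by rewrite -q3.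
      have /andP[x0 _] := x01; have b0 := bb0 M w.
      move: q2 q4 x0 Bw b0; set x := eta / _; set v := vb N w / _; set m := _ / N%:R ^+ 2.
      move: (bb M w) => y q2 q4 x0 Bw b0.
      have r1 : 0 <= y * (v - m - 3 * x) by apply: mulr_ge0 => //; lra.
      have r2 : 0 <= (y - 2^-1) * x by apply: mulr_ge0 => //; lra.
      lra.
    apply: le_trans (exprn_1sub_le N x01) _.
    by rewrite (_ : N%:R * (eta / (8 * N%:R)) = eta / 8)//; field; rewrite gt_eqF.
  apply: le_trans UN; apply: (@le_trans _ _ ((1 + M%:R ^+ 2 / N%:R ^+ 2) ^+ N)).
    have m1 : 0 <= 1 + M%:R ^+ 2 / N%:R ^+ 2 :> R by exact: addr_ge0.
    rewrite lerXn2r ?nnegrE// /kap.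
    have /andP[v0 _] := vN0 w; have y0 := bb0 M w; have y1 := bb1 M w.
    have r1 := mulr_ge0 y0 v0.
    have r2 : 0 <= (1 - bb M w) * (M%:R ^+ 2 / N%:R ^+ 2) by rewrite mulr_ge0// subr_ge0.
    move: r1 r2; lra.
  have := @exprn_1add_le _ N _ M0; rewrite NMN; apply.
  by rewrite ltr_pdivrMr// mul1r.
have : Ex (fun w => kap w ^+ N) <= Ex (fun w => (1 + del) - (1 - lam) * \1_(A `\` B) w).
  apply: Ex_le => //; first exact: bddX.
  by apply: bddB; [exact: bdd_cst|apply: bddM => //; exact: bdd_cst].
rewrite ExB; [|exact: bdd_cst|by apply: bddM => //; exact: bdd_cst].
rewrite Ex_cst ExZ// Ex_indic// => h2.
have l1 : 0 < 1 - lam by rewrite subr_gt0.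
have : (1 - lam) * Pr (A `\` B) <= 2 * del by rewrite -/kap in h; lra.
rewrite /del (_ : 2 * _ = (1 - lam) * (c / 2)); last by field.
by rewrite ler_pM2l.
Qed.

End second_moment.

(** * Determining subsequences and random measures *)

Section step_functions.
Context {R : realType}.

(* By telescoping, [x] selects the value [g j] of the first grid point [X j >= x]. *)
Lemma telescoped_step (X g : nat -> R) (x : R) r :
  (forall i, X i < X i.+1) -> exists j, [/\ (j <= r)%N,
    g r + \sum_(i < r) (g i - g i.+1) * (x <= X i)%R%:R = g j,
    ((j < r)%N -> x <= X j) & (forall i, (i < j)%N -> X i < x)].
Proof.
move=> Xi; elim: r => [|r [j [jr sE xj jx]]].
  by exists 0%N; split=> //; rewrite big_ord0 addr0.
case: (leP x (X r)) => [xr|rx].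
  exists j; split=> //; first exact: leqW.
    by rewrite big_ord_recr/= xr mulr1 -sE; ring.
  by move=> _; have [jr'|jr'|->//] := ltngtP j r; [exact: xj|rewrite ltnNge jr in jr'].
have Xr i : (i <= r)%N -> X i <= X r.
  move=> /subnK <-; elim: (r - i)%N => // n ih; rewrite addSn.
  exact: le_trans ih (ltW (Xi _)).
exists r.+1; split; rewrite ?ltnn//; last by move=> i; rewrite ltnS => /Xr/le_lt_trans; apply.
rewrite big1 ?addr0// => i _; have -> : (x <= X i) = false.
  by apply/negbTE; rewrite -ltNge; apply: le_lt_trans rx; apply: Xr; rewrite -ltnS.
by rewrite mulr0.
Qed.

Lemma trunc_sqr_lipschitz N (x y : R) : trunc_sqr N y - trunc_sqr N x <= 2 * N%:R * `|x - y|.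
Proof.
have [xN|Nx] := leP `|x| N%:R; last first.
  rewrite (trunc_sqr_gt Nx); apply: (@le_trans _ _ 0); last by rewrite !mulr_ge0.
  by rewrite subr_le0 trunc_sqr_le.
have x2 : x ^+ 2 = `|x| ^+ 2 by rewrite -normrX ger0_norm ?sqr_ge0.
have y2 : y ^+ 2 = `|y| ^+ 2 by rewrite -normrX ger0_norm ?sqr_ge0.
have -> : trunc_sqr N x = `|x| ^+ 2.
  by rewrite -x2; apply/min_idPl; rewrite x2 lerXn2r ?nnegrE.
have yxy : `|y| <= `|x| + `|x - y|.
  by rewrite addrC -lerBlDr distrC (le_trans _ (lerB_dist _ _)).
have xy0 : 0 <= `|x - y| by [].
have x0 : 0 <= `|x| by []. have y0 : 0 <= `|y| by [].
rewrite /trunc_sqr y2; move: (`|y|) (`|x|) (`|x - y|) yxy xy0 x0 y0 xN => b a c.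
move=> h c0 a0 b0 aN; have [bN|Nb] := leP b N%:R.
  apply: (@le_trans _ _ (b ^+ 2 - a ^+ 2)); first by rewrite lerD2r ge_min lexx.
  nra.
apply: (@le_trans _ _ (N%:R ^+ 2 - a ^+ 2)); first by rewrite lerD2r ge_min lexx orbT.
nra.
Qed.

(** Convergence of the distribution functions is available only at points of the dense set, so the
    grid is chosen inside it. Finitely many points suffice because [trunc_sqr N] is constant outside
    [[- N, N]]. *)
Lemma trunc_sqr_step (N : nat) (S : set R) (e : R) : dense S -> 0 < e -> exists r (X g : nat -> R),
  (forall i, S (X i)) /\
  forall x, `|trunc_sqr N x - (g r + \sum_(i < r) (g i - g i.+1) * (x <= X i)%R%:R)| <= e.
Proof.
(* Consecutive grid points are less than [2 * h] apart and [trunc_sqr N] has Lipschitz constant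
   [2 * N], so the error is at most [4 * N * h <= e]. *)
move=> dS e0; pose h := e / (4 * N.+1%:R).
have h0 : 0 < h by rewrite divr_gt0// mulr_gt0.
pose K : R := N%:R + 1 + h.
pose c (i : nat) : R := - K + i%:R * h.
have cS i : c i < c i.+1 by rewrite /c -natr1; lra.
have /choice[X XP] (i : nat) : exists x, S x /\ c i < x < c i.+1.
  have [||x [xi Sx]] := dS `]c i, c i.+1[%classic; last by exists x; rewrite /= in_itv/= in xi.
  - exists ((c i + c i.+1) / 2); rewrite /= in_itv/=; have := cS i; lra.
  - exact: itv_open.
have Xi i : X i < X i.+1.
  by have [_ /andP[_ h1]] := XP i; have [_ /andP[h2 _]] := XP i.+1; exact: lt_trans h2.
pose r := (Num.truncn (2 * K / h)).+1.
have rK : K <= c r.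
  have := truncnS_gt (2 * K / h); rewrite -/r ltr_pdivrMr// /c => ?; lra.
(* [g r] is the value to the right of the first [r] grid points, a region lying beyond [N]. *)
pose g i := if i == r then N%:R ^+ 2 else trunc_sqr N (X i).
exists r, X, g; split=> [i|x]; first by have [] := XP i.
have [j [jr -> xj jx]] := telescoped_step g x r Xi.
have far (y : R) : N%:R < `|y| -> trunc_sqr N y = N%:R ^+ 2 by exact: trunc_sqr_gt.
have near0 : X 0%N < - N%:R.
  have [_ /andP[_]] := XP 0%N; rewrite /c /K; lra.
have [jr'|jr'|jr'] := ltngtP j r; last 2 first.
- by rewrite ltnNge jr in jr'.
- rewrite /g jr' eqxx far ?subrr ?normr0 ?ltW// ltr_normr; apply/orP; left.
  apply: lt_trans (jx r.-1 _); last by rewrite jr' prednK.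
  have [_ /andP[+ _]] := XP r.-1; apply: lt_trans.
  have : c r = c r.-1 + h by rewrite /c /r/= -natr1; ring.
  move=> cr; rewrite cr /K in rK; lra.
rewrite /g ltn_eqF//; have xle := xj jr'.
case: j jr jr' xj jx xle => [|j] jr jr' xj jx xle.
  have f1 : N%:R < `|X 0%N| by rewrite ltr_normr; apply/orP; right; lra.
  have f2 : N%:R < `|x| by rewrite ltr_normr; apply/orP; right; lra.
  by rewrite (trunc_sqr_gt f1) (trunc_sqr_gt f2) subrr normr0 ltW.
have lt1 := jx j (ltnSn _).
have dist : X j.+1 - X j <= 2 * h.
  have [_ /andP[]] := XP j.+1; have [_ /andP[]] := XP j; rewrite /c -!natr1; lra.
have hN : 2 * N%:R * (2 * h) <= e.
  rewrite (_ : 2 * N%:R * (2 * h) = e * (N%:R / N.+1%:R)); last first.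
    by rewrite /h; field; rewrite gt_eqF// -natr1 ltr_wpDl.
  by rewrite ler_piMr ?(ltW e0)// ler_pdivrMr// mul1r ler_nat.
have xX : `|x - X j.+1| <= 2 * h by rewrite ler0_norm; lra.
have N0 : 0 <= 2 * N%:R :> R by rewrite mulr_ge0.
have l1 := trunc_sqr_lipschitz N x (X j.+1).
have l2 := trunc_sqr_lipschitz N (X j.+1) x; rewrite distrC in l2.
have := ler_wpM2l N0 xX.
rewrite ler_norml; lra.
Qed.

End step_functions.

(** * Truncated second moments of the limiting random measure *)

Section bridge.
Context {d : measure_display} {Omega : measurableType d} {R : realType}.
Variable P : probability Omega R.
Local Notation Ex := (expect P).
Local Notation Pr := (prob P).
Variable mu : R.-pker Omega ~> R.

(** Packaging each [mu w] as a probability makes [expect] and its lemmas available for integrals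
    over the real line. *)
Definition kernel_at (w : Omega) : set R -> \bar R := mu w.

HB.instance Definition _ (w : Omega) := isMeasure.Build _ _ _ (kernel_at w)
  (measure0 (mu w)) (measure_ge0 (mu w)) (@measure_semi_sigma_additive _ _ _ (mu w)).

HB.instance Definition _ (w : Omega) := Measure_isProbability.Build _ _ _ (kernel_at w)
  (prob_kernel w).

Definition kernel_prob (w : Omega) : probability R R := kernel_at w.

(** This is N times V_N. *)
Definition second_moment (N : nat) (w : Omega) : R := expect (kernel_prob w) (trunc_sqr N).

Lemma bdd_trunc_sqr N : bdd (@trunc_sqr R N).
Proof. by apply: (@bddP _ _ _ _ (N%:R ^+ 2)); [exact: measurable_trunc_sqr|exact: norm_trunc_sqr]. Qed.

Lemma measurable_second_moment N : measurable_fun setT (second_moment N).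
Proof.
apply: (@measurableT_comp _ _ _ _ _ _ (@fine R)) => //.
apply: (@measurable_fun_integral_kernel _ _ _ _ _ (fun w => mu w)).
- by move=> U mU; exact: measurable_kernel.
- by move=> z; rewrite lee_fin trunc_sqr_ge0.
- by apply/measurable_EFinP; exact: measurable_trunc_sqr.
Qed.

Lemma second_moment_ge0 N w : 0 <= second_moment N w.
Proof. by apply: Ex_ge0 => x; exact: trunc_sqr_ge0. Qed.

Lemma second_moment_le N w : second_moment N w <= N%:R ^+ 2.
Proof.
rewrite (le_trans (ler_norm _))//; apply: Ex_bnd; first exact: measurable_trunc_sqr.
exact: norm_trunc_sqr.
Qed.

Variables (f : nat -> Omega -> R) (k : nat -> nat) (Dset : set R) (H : R -> Omega -> R).
Hypothesis mf : forall n, measurable_fun setT (f n).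
Hypothesis dk : determining P f k Dset H.
Hypothesis lmu : limiting_measure P H mu.

(** For step functions with jumps in [Dset], the convergence is that of the determining subsequence;
    [trunc_sqr N] is a uniform limit of such functions, with the same error under the law of the
    terms and under [mu w]. *)
Lemma wcv_second_moment N : wcv P (fun n w => trunc_sqr N (f (k n) w)) (second_moment N).
Proof.
have [_ [_ dS] [H01 mH] _ cH] := dk.
move=> B mB; have bB : bdd (\1_B : Omega -> R) by exact: bdd_indic.
apply/cvgrPdist_le => /= e e0.
have e3 : 0 < e / 3 by rewrite divr_gt0.
have [r [X [g [SX Xg]]]] := trunc_sqr_step N dS e3.
pose s (x : R) := g r + \sum_(i < r) (g i - g i.+1) * (x <= X i)%R%:R.
pose sH w := g r + \sum_(i < r) (g i - g i.+1) * H (X i) w.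
have mle (i : nat) : measurable [set x : R | x <= X i].
  by apply: measurable_le; exact: measurable_id.
have le_indic (i : nat) (x : R) : (x <= X i)%R%:R = \1_[set x | x <= X i] x :> R.
  by rewrite indicE; congr (nat_of_bool _)%:R; apply/idP/idP; rewrite inE.
have bH i : bdd (H i).
  apply: (@bddP _ _ _ _ 1) => // w; have /andP[h0 h1] := H01 i w; by rewrite ger0_norm.
have bs : bdd s.
  apply: bddD; first exact: bdd_cst.
  apply: (bdd_sum _ _ (X := fun i : 'I_r => fun x : R => (g i - g i.+1) * (x <= X i)%R%:R)) => i.
  apply: bddM; first exact: bdd_cst.
  by under eq_fun do rewrite le_indic; exact: bdd_indic.
have bsf n : bdd (fun w => s (f (k n) w)).
  by case: bs => ms [C sC]; exact: (bdd_comp ms sC (mf (k n))).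
have bsH : bdd sH.
  apply: bddD; first exact: bdd_cst.
  apply: (bdd_sum _ _ (X := fun i : 'I_r => fun w => (g i - g i.+1) * H (X i) w)) => i.
  by apply: bddM => //; exact: bdd_cst.
have bv n : bdd (fun w => trunc_sqr N (f (k n) w)).
  exact: (bdd_comp (measurable_trunc_sqr N) (norm_trunc_sqr N) (mf (k n))).
have bm : bdd (second_moment N).
  apply: (@bddP _ _ _ _ (N%:R ^+ 2)); first exact: measurable_second_moment.
  by move=> w; rewrite ger0_norm ?second_moment_ge0 ?second_moment_le.
have cs : Ex (fun w => s (f (k n) w) * \1_B w) @[n --> \oo] --> Ex (fun w => sH w * \1_B w).
  pose T n (i : 'I_r) w := (g i - g i.+1) * (\1_([set w | f (k n) w <= X i] `&` B) w : R).
  pose TH (i : 'I_r) w := (g i - g i.+1) * (H (X i) w * \1_B w).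
  have mI n i : measurable ([set w | f (k n) w <= X i] `&` B).
    by apply: measurableI => //; exact: measurable_le.
  have E1 n : Ex (fun w => s (f (k n) w) * \1_B w) =
      g r * Pr B + \sum_(i < r) (g i - g i.+1) * Pr ([set w | f (k n) w <= X i] `&` B).
    have bT i : bdd (T n i) by apply: bddM; [exact: bdd_cst|exact: bdd_indic].
    transitivity (Ex (fun w => g r * \1_B w + \sum_(i < r) T n i w)); last first.
      rewrite ExD; [|by apply: bddM => //; exact: bdd_cst|exact: bdd_sum].
      rewrite ExZ// Ex_indic// (Ex_sum P _ _ (X := T n))//; congr (_ + _).
      by apply: eq_bigr => i _; rewrite ExZ ?Ex_indic//; exact: bdd_indic.
    congr (expect _ _); apply/funext => w; rewrite /s mulrDl mulr_suml; congr (_ + _).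
    apply: eq_bigr => i _; rewrite /T -mulrA; congr (_ * _).
    rewrite indicI; congr (_ * _).
    by rewrite indicE; congr (nat_of_bool _)%:R; apply/idP/idP; rewrite inE.
  have E2 : Ex (fun w => sH w * \1_B w) =
      g r * Pr B + \sum_(i < r) (g i - g i.+1) * Ex (fun w => H (X i) w * \1_B w).
    have bHB i : bdd (fun w => H i w * \1_B w) by exact: bddM.
    have bT i : bdd (TH i) by apply: bddM; [exact: bdd_cst|exact: bHB].
    transitivity (Ex (fun w => g r * \1_B w + \sum_(i < r) TH i w)); last first.
      rewrite ExD; [|by apply: bddM => //; exact: bdd_cst|exact: bdd_sum].
      rewrite ExZ// Ex_indic// (Ex_sum P _ _ (X := TH))//; congr (_ + _).
      by apply: eq_bigr => i _; rewrite ExZ.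
    congr (expect _ _); apply/funext => w; rewrite /sH mulrDl mulr_suml; congr (_ + _).
    by apply: eq_bigr => i _; rewrite /TH -mulrA.
  under eq_fun do rewrite E1; rewrite E2.
  apply: cvgD; first exact: cvg_cst.
  apply: cvg_rsum => i; apply: cvgM; first exact: cvg_cst.
  have iH : P.-integrable B (EFin \o H (X i)) by exact: integrableS (bdd_int P (bH (X i))).
  rewrite Ex_indicM//; apply: fine_cvg; rewrite /Rintegral fineK; first exact: cH.
  exact: (integrable_fin_num _ iH).
have near1 n : `|Ex (fun w => trunc_sqr N (f (k n) w) * \1_B w) - Ex (fun w => s (f (k n) w) * \1_B w)| <= e / 3.
  rewrite -ExB; [|exact: bddM..].
  have bb : bdd (fun w => (trunc_sqr N (f (k n) w) - s (f (k n) w)) * \1_B w).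
    by apply: bddM => //; exact: bddB.
  under eq_fun do rewrite -mulrBl; case: bb => mb _; apply: Ex_bnd => // w.
  by rewrite normrM (le_trans _ (Xg (f (k n) w)))// ler_piMr// indicE normr_nat lern1 leq_b1.
have sHs : {ae P, forall w, `|second_moment N w - sH w| <= e / 3}.
  apply: filterS lmu => w muH.
  have -> : sH w = expect (kernel_prob w) s.
    rewrite /s ExD; [|exact: bdd_cst|]; last first.
      apply: (bdd_sum _ _ (X := fun i : 'I_r => fun x : R => (g i - g i.+1) * (x <= X i)%R%:R)) => i.
      by apply: bddM; [exact: bdd_cst|under eq_fun do rewrite le_indic; exact: bdd_indic].
    rewrite Ex_cst (Ex_sum _ _ _ (X := fun i : 'I_r => fun x : R => (g i - g i.+1) * (x <= X i)%R%:R)).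
      congr (_ + _); apply: eq_bigr => i _.
      under eq_fun do rewrite le_indic.
      rewrite ExZ; last exact: bdd_indic.
      rewrite Ex_indic//; congr (_ * _); rewrite /prob/= (_ : [set x | x <= X i] = `]-oo, X i]%classic).
        by rewrite muH.
      by apply/seteqP; split=> x; rewrite /= in_itv.
    by move=> i; apply: bddM; [exact: bdd_cst|under eq_fun do rewrite le_indic; exact: bdd_indic].
  rewrite /second_moment -ExB//; last exact: bdd_trunc_sqr.
  have [mb _] := bddB (bdd_trunc_sqr N) bs; exact: Ex_bnd.
have near2 : `|Ex (fun w => second_moment N w * \1_B w) - Ex (fun w => sH w * \1_B w)| <= e / 3.
  rewrite -ExB; [|exact: bddM..].
  have bb : bdd (fun w => second_moment N w * \1_B w - sH w * \1_B w).
    by apply: bddB; exact: bddM.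
  apply: le_trans (Ex_abs P bb) _; rewrite -[leRHS](Ex_cst P).
  apply: Ex_le_ae; [exact: bdd_norm|exact: bdd_cst|].
  apply: filterS sHs => w; apply: le_trans; rewrite -mulrBl normrM.
  by rewrite ler_piMr// indicE normr_nat lern1 leq_b1.
move/cvgrPdist_le : cs => /(_ _ e3); apply: filterS => n.
have := near1 n; move: near2; rewrite !ler_norml; lra.
Qed.

End bridge.

(** * The two conditions on the random measure *)

Section moment_split.
Context {d : measure_display} {Omega : measurableType d} {R : realType}.
Variable P : probability Omega R.
Variable mu : R.-pker Omega ~> R.

Definition tail_term (N : nat) (w : Omega) : R :=
  N%:R * fine (mu w (~` `[- N%:R, N%:R]%classic)).

Definition center_term (N : nat) (w : Omega) : R :=
  (N%:R)^-1 * fine (\int[mu w]_(x in `[- N%:R, N%:R]%classic) (x ^+ 2)%:E).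

Lemma tail_term_ge0 N w : 0 <= tail_term N w.
Proof. by rewrite mulr_ge0// fine_ge0. Qed.

Lemma center_term_ge0 N w : 0 <= center_term N w.
Proof.
rewrite mulr_ge0 ?invr_ge0// fine_ge0//; apply: integral_ge0 => x _.
by rewrite lee_fin sqr_ge0.
Qed.

Lemma second_moment_split N w : second_moment mu N w / N%:R = tail_term N w + center_term N w.
Proof.
rewrite /tail_term /center_term; have [->|N0] := posnP N; first by rewrite invr0 mulr0 !mul0r addr0.
have NR : N%:R != 0 :> R by rewrite pnatr_eq0 -lt0n.
pose I : set R := `[- N%:R, N%:R]%classic.
have mI : measurable I by exact: measurable_itv.
have IP x : I x <-> `|x| <= N%:R by rewrite /I/= in_itv/= ler_norml.
have xI (x : R) : I x -> `|x ^+ 2| <= N%:R ^+ 2.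
  by move=> /IP xN; rewrite normrX lerXn2r ?nnegrE.
have b1 : bdd (fun x : R => x ^+ 2 * \1_I x).
  apply: (@bddP _ _ _ _ (N%:R ^+ 2)).
    by apply: measurable_funM; [exact: measurable_funX|exact: measurable_indic].
  move=> x; rewrite indicE; case: (boolP (x \in I)) => xin.
    by rewrite mulr1; apply: xI; exact: set_mem.
  by rewrite mulr0 normr0 sqr_ge0.
have b2 : bdd (fun x : R => N%:R ^+ 2 * \1_(~` I) x : R).
  by apply: bddM; [exact: bdd_cst|apply: bdd_indic; exact: measurableC].
have -> : second_moment mu N w = expect (kernel_prob mu w) (fun x => x ^+ 2 * \1_I x + N%:R ^+ 2 * \1_(~` I) x).
  congr (expect _ _); apply/funext => x; rewrite !indicE in_setC.
  case: (boolP (x \in I)) => [/set_mem/IP xN|xN] /=.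
    rewrite mulr1 mulr0 addr0; apply/min_idPl.
    by rewrite -[leLHS]ger0_norm ?sqr_ge0// normrX lerXn2r ?nnegrE.
  rewrite mulr0 mulr1 add0r trunc_sqr_gt// ltNge; apply/negP => /IP.
  by move=> Ix; rewrite mem_set in xN.
rewrite ExD// ExZ; last by apply: bdd_indic; exact: measurableC.
rewrite Ex_indic; last exact: measurableC.
rewrite Ex_indicM// /Rintegral /prob /I /=.
set a := fine _; set b := fine _; field; exact: NR.
Qed.

Lemma measurable_tail_term N : measurable_fun setT (tail_term N).
Proof.
apply: measurable_funM; first exact: measurable_cst.
apply: (@measurableT_comp _ _ _ _ _ _ (@fine R)) => //.
by apply: measurable_kernel; apply: measurableC; exact: measurable_itv.
Qed.

Lemma measurable_center_term N : measurable_fun setT (center_term N).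
Proof.
have -> : center_term N = fun w => second_moment mu N w / N%:R - tail_term N w.
  by apply/funext => w; rewrite second_moment_split addrAC subrr add0r.
apply: measurable_funB; last exact: measurable_tail_term.
by apply: measurable_funM; [exact: measurable_second_moment|exact: measurable_cst].
Qed.

Lemma conv_in_probD (X Y : nat -> Omega -> R) :
  (forall N, measurable_fun setT (X N)) -> (forall N, measurable_fun setT (Y N)) ->
  conv_in_prob P X -> conv_in_prob P Y -> conv_in_prob P (fun N w => X N w + Y N w).
Proof.
move=> mX mY /(conv_in_probP P mX) cX /(conv_in_probP P mY) cY.
apply/conv_in_probP => [N|e e0 c c0]; first exact: measurable_funD.
have e2 : 0 < e / 2 by rewrite divr_gt0. have c2 : 0 < c / 2 by rewrite divr_gt0.
apply: (filterS _ (filterI (cX _ e2 _ c2) (cY _ e2 _ c2))) => N [h1 h2].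
have mNY : measurable_fun setT (fun w => - Y N w) by exact: measurableT_comp.
have := @Pr_gt_B _ _ _ P (X N) (fun w => - Y N w) (e / 2) (e / 2) (mX N) mNY.
rewrite -splitr => /le_trans h.
have -> : [set w | e < `|X N w + Y N w|] = [set w | e < `|X N w - - Y N w|].
  by apply/seteqP; split=> w /=; rewrite opprK.
apply: h; rewrite [X in _ + prob P X](_ : _ = [set w | e / 2 < `|Y N w|]); last first.
  by apply/seteqP; split=> w /=; rewrite normrN.
rewrite [leRHS]splitr; exact: lerD.
Qed.

(** Both terms are nonnegative, so each is dominated by their sum. *)
Lemma second_moment_convP :
  conv_in_prob P (fun N w => second_moment mu N w / N%:R) <->
  conv_in_prob P tail_term /\ conv_in_prob P center_term.
Proof.
have mV N : measurable_fun setT (fun w => second_moment mu N w / N%:R).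
  by apply: measurable_funM; [exact: measurable_second_moment|exact: measurable_cst].
have mt := measurable_tail_term; have mc := measurable_center_term.
split=> [cV|[ct cc]].
  split; apply: conv_in_prob_le cV => //; apply: nearW => N; apply: aeW => w.
  - rewrite second_moment_split !ger0_norm ?tail_term_ge0 ?lerDl ?center_term_ge0//.
    by rewrite addr_ge0 ?tail_term_ge0 ?center_term_ge0.
  - rewrite second_moment_split !ger0_norm ?center_term_ge0 ?lerDr ?tail_term_ge0//.
    by rewrite addr_ge0 ?tail_term_ge0 ?center_term_ge0.
under eq_fun do under eq_fun do rewrite second_moment_split.
exact: conv_in_probD.
Qed.

End moment_split.

(** * Continuity points of monotone functions *)

Section continuity_points.
Context {R : realType}.

(** The discontinuities of a monotone function are countable, while an interval has positive
    Lebesgue measure. Continuity is phrased through nearby points on either side because these serve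
    later to bracket [x]. *)
Lemma monotone_continuity_point (Phi : R -> R) (a b : R) : {homo Phi : x y / x <= y} -> a < b ->
  exists x, a < x < b /\ forall e, 0 < e ->
    (exists y, y < x /\ Phi x - Phi y <= e) /\ (exists z, x < z /\ Phi z - Phi x <= e).
Proof.
move=> ndP ab; have ndF : {in `[a, b] &, nondecreasing_fun Phi} by move=> x y _ _; exact: ndP.
pose C := [set x | (x \in `]a, b[) /\ discontinuity Phi x].
have cC : countable C by exact: discontinuity_countable.
have [x [xab nd]] : exists x, (x \in `]a, b[) /\ ~ discontinuity Phi x.
  apply: contrapT => /forallNP H.
  have sub : `]a, b[%classic `<=` C.
    by move=> x xab; split=> //; apply: contrapT => nd; apply: (H x).
  have := countable_lebesgue_measure0 (sub_countable (subset_card_le sub) cC).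
  rewrite lebesgue_measure_itv/= lte_fin ab -EFinB => -[] /eqP.
  by rewrite subr_eq0 gt_eqF.
exists x; split; first by rewrite in_itv/= in xab.
have cl : cvg (Phi y @[y --> x^'-]).
  apply: nondecreasing_at_left_is_cvgr; apply: nearW => t.
    by move=> u v _ _; exact: ndP.
  by exists (Phi x) => _ [u /= + <-]; rewrite in_itv/= => /andP[_ /ltW/ndP].
have cr : cvg (Phi y @[y --> x^'+]).
  apply: nondecreasing_at_right_is_cvgr; apply: nearW => t.
    by move=> u v _ _; exact: ndP.
  by exists (Phi x) => _ [u /= + <-]; rewrite in_itv/= => /andP[/ltW/ndP].
have lr : lim (Phi y @[y --> x^'-]) = lim (Phi y @[y --> x^'+]).
  by apply/eqP; apply: contrapT => /negP lr; apply: nd.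
move=> e e0; have e2 : 0 < e / 2 by rewrite divr_gt0.
move/cvgrPdist_le : (cl) => /(_ _ e2) nl; move/cvgrPdist_le : (cr) => /(_ _ e2) nr.
have [y [yl /= yx]] := @filter_ex _ _ (at_left_proper_filter x) _ (filterI nl (nbhs_left_lt x)).
have [z [zl /= xz]] := @filter_ex _ _ (at_right_proper_filter x) _ (filterI nr (nbhs_right_gt x)).
rewrite lr in yl; move: yl zl; rewrite !ler_norml => yl zl.
have h1 := ndP _ _ (ltW yx); have h2 := ndP _ _ (ltW xz).
by split; [exists y|exists z]; split=> //; lra.
Qed.

(** One continuity point is picked in each of the countably many intervals with rational left end
    and length [1 / (n + 1)]. *)
Lemma dense_continuity_points (Phi : R -> R) : {homo Phi : x y / x <= y} ->
  exists S : set R, [/\ countable S, dense S & forall x, S x -> forall e, 0 < e ->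
    (exists y, y < x /\ Phi x - Phi y <= e) /\ (exists z, x < z /\ Phi z - Phi x <= e)].
Proof.
move=> ndP.
have /choice[c cP] (pn : rat * nat) : exists x, ratr pn.1 < x < ratr pn.1 + pn.2.+1%:R^-1 /\
    forall e, 0 < e -> (exists y, y < x /\ Phi x - Phi y <= e) /\ (exists z, x < z /\ Phi z - Phi x <= e).
  by apply: monotone_continuity_point => //; rewrite ltrDl invr_gt0.
exists (range c); split.
- exact: (sub_countable (card_image_le c setT) (countableP _)).
- move=> O [x Ox] oO; have /nbhs_ballP[e /= e0 xe] := open_nbhs_nbhs (conj oO Ox).
  have [|p] := @rat_in_itvoo R x (x + e / 2); first by rewrite ltrDl divr_gt0.
  rewrite in_itv/= => /andP[xp px].
  pose n := Num.truncn (2 / e).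
  have ne : n.+1%:R^-1 <= e / 2.
    by rewrite -[leRHS]invrK lef_pV2 ?posrE ?invr_gt0 ?divr_gt0// invf_div ltW// truncnS_gt.
  have [/andP[c1 c2] _] := cP (p, n); exists (c (p, n)); split; last by exists (p, n).
  have px' : c (p, n) < x + e.
    apply: (lt_le_trans c2); rewrite /= [leRHS](_ : x + e = (x + e / 2) + e / 2); last by lra.
    by apply: lerD => //; exact: ltW.
  have xp' : x < c (p, n) by exact: lt_trans c1.
  by apply: xe; rewrite /ball/= ltr_norml; apply/andP; split; lra.
- by move=> _ [pn _ <-]; have [] := cP pn.
Qed.

End continuity_points.

(** * Random measures from distribution functions on the rationals *)

Section kernel_of_cdf.
Context {d : measure_display} {Omega : measurableType d} {R : realType}.
Variable G : rat -> Omega -> R.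
Hypothesis mG : forall r, measurable_fun setT (G r).
Hypothesis G0 : forall r w, 0 <= G r w.
Hypothesis G1 : forall r w, G r w <= 1.
Hypothesis G_mono : forall r s w, r <= s -> G r w <= G s w.
Hypothesis G_low : forall w (e : R), 0 < e -> exists r, G r w <= e.
Hypothesis G_high : forall w (e : R), 0 < e -> exists r, 1 - e <= G r w.

(** The right-continuous extension to the reals of a monotone function on the rationals. *)
Definition right_inf (w : Omega) (x : R) : R := inf [set G r w | r in [set r | x < ratr r]].

Lemma right_inf_le w x r : x < ratr r -> right_inf w x <= G r w.
Proof.
move=> xr; apply: ge_inf; last by exists r.
by exists 0 => _ [s _ <-].
Qed.

Lemma right_inf_ge w x (c : R) : (forall r, x < ratr r -> c <= G r w) -> c <= right_inf w x.
Proof.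
move=> cG; apply: lb_le_inf => [|_ [r xr <-]]; last exact: cG.
have [|r] := @rat_in_itvoo R x (x + 1); first by rewrite ltrDl.
by rewrite in_itv/= => /andP[xr _]; exists (G r w), r.
Qed.

Lemma right_inf_lt w x (c : R) : right_inf w x < c -> exists2 r, x < ratr r & G r w < c.
Proof.
move=> h; apply: contrapT => H; move: h; rewrite ltNge => /negP; apply.
apply: right_inf_ge => r xr; rewrite leNgt; apply/negP => Gc; apply: H.
by exists r.
Qed.

Lemma right_inf_nd w : {homo right_inf w : x y / x <= y}.
Proof.
by move=> x y xy; apply: right_inf_ge => r yr; apply: right_inf_le; exact: le_lt_trans yr.
Qed.

Lemma right_inf_ge0 w x : 0 <= right_inf w x.
Proof. exact: right_inf_ge. Qed.

Lemma right_inf_le1 w x : right_inf w x <= 1.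
Proof.
have [|r] := @rat_in_itvoo R x (x + 1); first by rewrite ltrDl.
by rewrite in_itv/= => /andP[xr _]; apply: le_trans (right_inf_le w xr) _.
Qed.

Lemma le_right_inf w x r : ratr r <= x -> G r w <= right_inf w x.
Proof.
move=> rx; apply: right_inf_ge => s xs; apply: G_mono.
by apply: ltW; rewrite -(ltr_rat R); exact: le_lt_trans xs.
Qed.

Lemma right_inf_rc w x : right_inf w y @[y --> x^'+] --> right_inf w x.
Proof.
apply/cvgrPdist_le => /= e e0.
have [|r xr Gr] := @right_inf_lt w x (right_inf w x + e); first by rewrite ltrDl.
near=> y.
have xy : x < y by near: y; exact: nbhs_right_gt.
have yr : y < ratr r by near: y; exact: nbhs_right_lt.
have h1 := right_inf_nd w (ltW xy); have h2 := right_inf_le w yr.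
by rewrite ler_norml; lra.
Unshelve. all: by end_near. Qed.

Lemma right_infNy w : right_inf w x @[x --> -oo] --> (0 : R).
Proof.
apply/cvgrPdist_le => /= e e0; have [r Gr] := G_low w e0.
near=> x; rewrite sub0r normrN ger0_norm ?right_inf_ge0//.
apply: le_trans (right_inf_le w _) Gr; near: x.
by apply: nbhs_ninfty_lt; rewrite num_real.
Unshelve. all: by end_near. Qed.

Lemma right_infy w : right_inf w x @[x --> +oo] --> (1 : R).
Proof.
apply/cvgrPdist_le => /= e e0; have [r Gr] := G_high w e0.
near=> x; rewrite ger0_norm ?subr_ge0 ?right_inf_le1//.
have : G r w <= right_inf w x.
  by apply: le_right_inf; near: x; apply: nbhs_pinfty_ge; rewrite num_real.
lra.
Unshelve. all: by end_near. Qed.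

Lemma measurable_right_inf x : measurable_fun setT (right_inf ^~ x).
Proof.
apply: (measurability _ (RGenInftyO.measurableE R)) => //.
move=> _ [_ [c ->] <-]; rewrite setTI.
rewrite (_ : _ @^-1` _ = \bigcup_r [set w | x < ratr r /\ G r w < c]); last first.
  apply/seteqP; split=> [w /=|w [r _ /= [xr Gr]]]; rewrite in_itv/=.
    by move=> /right_inf_lt[r xr Gr]; exists r.
  exact: le_lt_trans (right_inf_le w xr) Gr.
apply: bigcupT_measurable_rat => r; case: (ltP x (ratr r)) => xr.
  by rewrite (_ : [set w | _ /\ _] = [set w | G r w < c]); [exact: measurable_lt|
    apply/seteqP; split=> w /=; [case|]].
by rewrite (_ : [set w | _ /\ _] = set0)//; apply/seteqP; split=> // w /= [].
Qed.

(** Each [w] gets its Lebesgue-Stieltjes measure. Measurability in [w] is clear for half-lines,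
    which generate the Borel sets and are stable under intersection, and extends by Dynkin's
    theorem. *)
Lemma kernel_of_cdf : exists mu : R.-pker Omega ~> R,
  forall w x, mu w `]-oo, x]%classic = (right_inf w x)%:E.
Proof.
pose cb (w : Omega) : cumulativeBounded (0 : R) (1 : R) := HB.pack (right_inf w)
  (isCumulative.Build R _ R (right_inf w) (@right_inf_nd w) (fun x => @right_inf_rc w x))
  (isCumulativeBounded.Build R 0 1 (right_inf w) (@right_infNy w) (@right_infy w)).
pose lsm w : {measure set (measurableTypeR R) -> \bar R} := lebesgue_stieltjes_measure (cb w).
pose k0 w : set R -> \bar R := lsm w.
have k00 w : k0 w set0 = 0%E by exact: (measure0 (lsm w)).
have k0_ge0 w A : (0 <= k0 w A)%E by exact: (measure_ge0 (lsm w)).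
have k0_sigma w : semi_sigma_additive (k0 w) by exact: (@measure_semi_sigma_additive _ _ _ (lsm w)).
pose k w : {measure set R -> \bar R} := HB.pack (k0 w)
  (isMeasure.Build _ _ _ (k0 w) (k00 w) (k0_ge0 w) (k0_sigma w)).
have kE w x : k w `]-oo, x]%classic = (right_inf w x)%:E.
  exact: (cdf_lebesgue_stieltjes_id (cb w) x).
have kT w : k w setT = 1%E.
  exact: (@probability_setT _ _ _ (lebesgue_stieltjes_measure (cb w))).
have mk U : measurable U -> measurable_fun setT (k ^~ U).
  pose GG : set (set R) := @RGenOInfty.G R.
  have mE : @measurable _ R = <<s GG >> by exact: (RGenOInfty.measurableE R).
  move=> mU; have {mU} : <<s GG >> U by rewrite -mE.
  apply: (dynkin_induction mE (P := fun U => measurable_fun setT (k ^~ U))).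
  - move=> _ _ [x ->] [y ->]; exists (Num.max x y).
    by apply/seteqP; split=> z; rewrite /= !in_itv/= !andbT gt_max => /andP.
  - by under eq_fun do rewrite kT; exact: measurable_cst.
  - move=> _ [x ->].
    have E w : k w `]x, +oo[%classic = (1 - right_inf w x)%:E.
      rewrite -setCitvl EFinB -kE -(kT w).
      rewrite -(setTD `]-oo, x]%classic) measureD//; last first.
        by rewrite -[ltLHS]/(k w setT) kT ltry.
      by rewrite setTI.
    under eq_fun do rewrite E.
    apply/measurable_EFinP; apply: measurable_funB; first exact: measurable_cst.
    exact: measurable_right_inf.
  - move=> S mS mkS.
    have E w : k w (~` S) = (1 - k w S)%E.
      rewrite -(kT w) -setTD measureD//; last first.
        by rewrite -[ltLHS]/(k w setT) kT ltry.
      by rewrite setTI.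
    by under eq_fun do rewrite E; apply: emeasurable_funB => //; exact: measurable_cst.
  - move=> A mA tA mkA.
    have E w : k w (\bigcup_n A n) = (\sum_(0 <= n <oo) k w (A n))%E.
      by apply: measure_semi_bigcup => //; exact: bigcup_measurable.
    by under eq_fun do rewrite E; apply: ge0_emeasurable_sum.
pose ker : R.-ker Omega ~> R := HB.pack k (isKernel.Build _ _ _ _ R k mk).
pose mu : R.-pker Omega ~> R := HB.pack (Kernel.sort ker)
  (Kernel_isProbability.Build _ _ _ _ R ker kT).
by exists mu.
Qed.

End kernel_of_cdf.

(** * Existence of determining subsequences *)

Section determining_exists.
Context {d : measure_display} {Omega : measurableType d} {R : realType}.
Variable P : probability Omega R.
Local Notation Ex := (expect P).
Local Notation Pr := (prob P).

Lemma ae_forall_countable (T : countType) (Q : T -> Omega -> Prop) :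
  (forall t, {ae P, forall w, Q t w}) -> {ae P, forall w, forall t, Q t w}.
Proof.
move=> Qt; have : {ae P, forall w, forall n, forall t : T, unpickle n = Some t -> Q t w}.
  apply/ae_foralln => n; case E : (unpickle n) => [t|]; last exact: aeW.
  by apply: filterS (Qt t) => w Qtw t' [<-].
by apply: filterS => w h t; exact: (h (pickle t) t (pickleK t)).
Qed.

Definition below (x y : R) : R := (y <= x)%R%:R.

Lemma below_indic x : below x = \1_[set y | y <= x].
Proof.
by apply/funext => y; rewrite indicE; congr (nat_of_bool _)%:R; apply/idP/idP; rewrite inE.
Qed.

Lemma measurable_below x : measurable_fun setT (below x).
Proof. by rewrite below_indic; apply: measurable_indic; apply: measurable_le; exact: measurable_id. Qed.

Lemma norm_below x y : `|below x y| <= 1.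
Proof. by rewrite normr_nat lern1 leq_b1. Qed.

Variables (f : nat -> Omega -> R) (k : nat -> nat) (G0 : rat -> Omega -> R).
Hypothesis mf : forall n, measurable_fun setT (f n).
Hypothesis ik : strict_incr k.
Hypothesis tight : forall e : R, 0 < e -> exists M : R, forall n, Pr [set w | M < `|f (k n) w|] <= e.
Hypothesis mG0 : forall r, measurable_fun setT (G0 r).
Hypothesis G0n : forall r w, `|G0 r w| <= 1.
Hypothesis cG0 : forall r, wcv P (fun n w => below (ratr r) (f (k n) w)) (G0 r).

Let bG0 r : bdd (G0 r). Proof. exact: bddP (G0n r). Qed.

Let bb x n : bdd (fun w => below x (f (k n) w)).
Proof. exact: bdd_comp (measurable_below x) (norm_below x) (mf (k n)). Qed.

Let limit_le r (l : R) B : measurable B ->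
  (forall n, Ex (fun w => below (ratr r) (f (k n) w) * \1_B w) <= l) -> Ex (fun w => G0 r w * \1_B w) <= l.
Proof.
move=> mB h; have c := @cG0 r _ mB; rewrite -(cvg_lim _ c)//.
by apply: limr_le; [apply/cvg_ex; eexists; exact: c|exact: nearW].
Qed.

Let limit_ge r (l : R) B : measurable B ->
  (forall n, l <= Ex (fun w => below (ratr r) (f (k n) w) * \1_B w)) -> l <= Ex (fun w => G0 r w * \1_B w).
Proof.
move=> mB h; have c := @cG0 r _ mB; rewrite -(cvg_lim _ c)//.
by apply: limr_ge; [apply/cvg_ex; eexists; exact: c|exact: nearW].
Qed.

Let G0_ge0 r : {ae P, forall w, 0 <= G0 r w}.
Proof.
apply: (ae_le_of_Ex (bdd_cst 0) (bG0 r)) => B mB; rewrite Ex0.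
by apply: limit_ge => // n; apply: Ex_ge0 => w; rewrite mulr_ge0// indicE.
Qed.

Let G0_mono r s : r <= s -> {ae P, forall w, G0 r w <= G0 s w}.
Proof.
move=> rs; apply: (ae_le_of_Ex (bG0 r) (bG0 s)) => B mB.
have bB : bdd (\1_B : Omega -> R) by exact: bdd_indic.
have cr := @cG0 r _ mB; have cs := @cG0 s _ mB.
rewrite -(cvg_lim _ cr)// -(cvg_lim _ cs)//; apply: ler_lim.
- by apply/cvg_ex; eexists; exact: cr.
- by apply/cvg_ex; eexists; exact: cs.
apply: nearW => n; apply: Ex_le => [||w]; [exact: bddM|exact: bddM|].
rewrite ler_wpM2r// ?indicE// /below ler_nat; case: (leP (f (k n) w) (ratr r)) => // fr.
by rewrite (le_trans fr)// ler_rat.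
Qed.

Let e1 (X : Omega -> R) : (fun w => X w * \1_setT w) = X.
Proof. by apply/funext => w; rewrite indicT mulr1. Qed.

(** On the exceptional set [N] every [G0 r] exceeds [e], so [e] times its probability is at most the
    mean of [G0 r]; tightness makes this mean at most [c * e] for [r] far to the left. *)
Let G0_low (e : R) : 0 < e -> {ae P, forall w, exists r, G0 r w <= e}.
Proof.
move=> e0; pose N := ~` \bigcup_r [set w | G0 r w <= e].
have mU : measurable (\bigcup_r [set w | G0 r w <= e]).
  by apply: bigcupT_measurable_rat => r; exact: measurable_le.
have mN : measurable N by exact: measurableC.
suff PN0 : Pr N <= 0.
  exists N; split=> //; first by rewrite PrE//; congr EFin; apply/eqP; rewrite eq_le PN0 Pr_ge0.
  by move=> w /= nr [r _ /= Gr]; apply: nr; exists r.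
apply/ler_addgt0Pr => c c0; rewrite add0r.
have ce : 0 < c * e by rewrite mulr_gt0.
have [M MP] := tight ce.
have [|r] := @rat_in_itvoo R (- M - 1) (- M); first by lra.
rewrite in_itv/= => /andP[_ rM].
have ExG : Ex (G0 r) <= c * e.
  rewrite -(e1 (G0 r)); apply: limit_le => // n; rewrite e1 below_indic.
  rewrite (_ : (fun w => _) = \1_[set w | f (k n) w <= ratr r]); last first.
    by apply/funext => w; rewrite -[LHS]indic_preimage.
  rewrite Ex_indic; last exact: measurable_le.
  apply: le_trans (MP n); apply: Pr_le; [exact: measurable_le|exact: measurable_norm_gt|].
  by move=> w /= fr; rewrite ltr_normr; apply/orP; right; rewrite ltrNr (le_lt_trans fr).
have bN : bdd (\1_N : Omega -> R) by exact: bdd_indic.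
rewrite -(ler_pM2r e0); apply: le_trans ExG; rewrite mulrC -Ex_indic// -ExZ//.
apply: Ex_le_ae => //; first by apply: bddM => //; exact: bdd_cst.
apply: filterS (G0_ge0 r) => w Gw; rewrite indicE; case: (boolP (w \in N)) => wN; rewrite ?mulr0// mulr1.
rewrite leNgt; apply/negP => Gle; move: wN; rewrite inE; apply.
by exists r => //=; exact: ltW.
Qed.

Let G0_high (e : R) : 0 < e -> {ae P, forall w, exists r, 1 - e <= G0 r w}.
Proof.
move=> e0; pose N := ~` \bigcup_r [set w | 1 - e <= G0 r w].
have mU : measurable (\bigcup_r [set w | 1 - e <= G0 r w]).
  by apply: bigcupT_measurable_rat => r; exact: measurable_ge.
have mN : measurable N by exact: measurableC.
suff PN0 : Pr N <= 0.
  exists N; split=> //; first by rewrite PrE//; congr EFin; apply/eqP; rewrite eq_le PN0 Pr_ge0.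
  by move=> w /= nr [r _ /= Gr]; apply: nr; exists r.
apply/ler_addgt0Pr => c c0; rewrite add0r.
have ce : 0 < c * e by rewrite mulr_gt0.
have [M MP] := tight ce.
have [|r] := @rat_in_itvoo R M (M + 1); first by lra.
rewrite in_itv/= => /andP[rM _].
have ExG : 1 - c * e <= Ex (G0 r).
  rewrite -(e1 (G0 r)); apply: limit_ge => // n; rewrite e1 below_indic.
  rewrite (_ : (fun w => _) = \1_[set w | f (k n) w <= ratr r]); last first.
    by apply/funext => w; rewrite -[LHS]indic_preimage.
  rewrite Ex_indic; last exact: measurable_le.
  have mM : measurable [set w | M < `|f (k n) w|] by exact: measurable_norm_gt.
  have PC : 1 - Pr [set w | M < `|f (k n) w|] <= Pr [set w | f (k n) w <= ratr r].
    rewrite -Pr_C//; apply: Pr_le; [exact: measurableC|exact: measurable_le|].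
    move=> w /= /negP; rewrite -leNgt => fM.
    by rewrite (le_trans (ler_norm _))// (le_trans fM)// ltW.
  by have := MP n; lra.
have bN : bdd (\1_N : Omega -> R) by exact: bdd_indic.
have b1G : bdd (fun w => 1 - G0 r w) by apply: bddB => //; exact: bdd_cst.
have ExG' : Ex (fun w => 1 - G0 r w) <= c * e by rewrite ExB ?Ex_cst; [lra|exact: bdd_cst|].
rewrite -(ler_pM2r e0); apply: le_trans ExG'; rewrite mulrC -Ex_indic// -ExZ//.
apply: Ex_le => // [|w]; first by apply: bddM => //; exact: bdd_cst.
rewrite indicE; case: (boolP (w \in N)) => wN; rewrite ?mulr0 ?mulr1; last first.
  by rewrite subr_ge0 (le_trans (ler_norm _)).
rewrite leNgt; apply/negP => Gle; move: wN; rewrite inE; apply.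
by exists r => //=; lra.
Qed.

(** Helly's selection with a random limit. Almost surely the weak limits [G0 r] form a distribution
    function on the rationals. At a continuity point of the mean [Phi] of [H], convergence on every
    event [B] follows by squeezing between rationals, since increments of [H] integrated over [B]
    are at most those of [Phi]; one set of points therefore serves all [B]. *)
Lemma determining_exists : exists Dset H (mu : R.-pker Omega ~> R),
  determining P f k Dset H /\ limiting_measure P H mu.
Proof.
pose good w := [/\ forall r, 0 <= G0 r w, forall r, G0 r w <= 1,
  forall r s, r <= s -> G0 r w <= G0 s w,
  forall e, 0 < e -> exists r, G0 r w <= e & forall e, 0 < e -> exists r, 1 - e <= G0 r w].
have inv0 n : 0 < n.+1%:R^-1 :> R by [].
have small (e : R) : 0 < e -> exists n : nat, n.+1%:R^-1 <= e.
  move=> e0; exists (Num.truncn e^-1).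
  by rewrite -[leRHS]invrK lef_pV2 ?posrE ?invr_gt0// ltW// truncnS_gt.
have good_ae : {ae P, forall w, good w}.
  have a1 := ae_forall_countable G0_ge0.
  have a2 : {ae P, forall w, forall rs : rat * rat, rs.1 <= rs.2 -> G0 rs.1 w <= G0 rs.2 w}.
    apply: ae_forall_countable => -[r s] /=; case: (leP r s) => rs; last by apply: aeW.
    by apply: filterS (G0_mono rs).
  have a3 := ae_forall_countable (fun n => G0_low (inv0 n)).
  have a4 := ae_forall_countable (fun n => G0_high (inv0 n)).
  apply: (filterS _ (filterI (filterI a1 a2) (filterI a3 a4))) => w [[h1 h2] [h3 h4]];
  split=> // [r|r s rs|e /small[n ne]|e /small[n ne]].
  - by rewrite (le_trans (ler_norm _)).
  - exact: (h2 (r, s)).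
  - by have [r hr] := h3 n; exists r; exact: le_trans ne.
  - by have [r hr] := h4 n; exists r; apply: le_trans hr; rewrite lerD2l lerN2.
have [A0 [mA0 PA0 good_sub]] := good_ae.
have goodC w : ~ A0 w -> good w by move=> nA; apply: contrapT => ng; apply: nA; exact: good_sub.
(* On the null set [A0] the distribution function of the point mass at 0 is substituted, so that a
   probability measure is defined for every [w]. *)
pose G r w := G0 r w * \1_(~` A0) w + (0 <= r)%R%:R * \1_A0 w : R.
have GA r w : A0 w -> G r w = (0 <= r)%R%:R.
  by move=> Aw; rewrite /G !indicE in_setC mem_set//= mulr0 mulr1 add0r.
have GnA r w : ~ A0 w -> G r w = G0 r w.
  by move=> nA; rewrite /G !indicE in_setC memNset//= mulr0 mulr1 addr0.
have mG r : measurable_fun setT (G r).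
  have mI1 : measurable_fun setT (\1_(~` A0) : Omega -> R).
    by apply: measurable_indic; exact: measurableC.
  have mI2 : measurable_fun setT (\1_A0 : Omega -> R) by exact: measurable_indic.
  by apply: measurable_funD; apply: measurable_funM => //; exact: measurable_cst.
have Gge0 r w : 0 <= G r w.
  by have [Aw|nA] := pselect (A0 w); [rewrite GA|rewrite GnA//; have [] := goodC w nA].
have Gle1 r w : G r w <= 1.
  by have [Aw|nA] := pselect (A0 w); [rewrite GA// lern1 leq_b1|rewrite GnA//; have [] := goodC w nA].
have Gmono r s w : r <= s -> G r w <= G s w.
  move=> rs; have [Aw|nA] := pselect (A0 w); last by rewrite !GnA//; have [_ _ + _ _] := goodC w nA; exact.
  by rewrite !GA// ler_nat; case: (leP 0 r) => // r0; rewrite (le_trans r0).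
have Glow w (e : R) : 0 < e -> exists r, G r w <= e.
  move=> e0; have [Aw|nA] := pselect (A0 w).
    by exists (- 1); rewrite GA//= ltW.
  by have [_ _ _ h _] := goodC w nA; have [r hr] := h e e0; exists r; rewrite GnA.
have Ghigh w (e : R) : 0 < e -> exists r, 1 - e <= G r w.
  move=> e0; have [Aw|nA] := pselect (A0 w).
    by exists 0; rewrite GA//= gerBl ltW.
  by have [_ _ _ _ h] := goodC w nA; have [r hr] := h e e0; exists r; rewrite GnA.
have [mu muE] := kernel_of_cdf mG Gge0 Gle1 Gmono Glow Ghigh.
pose H x w := right_inf G w x.
have H0 x w : 0 <= H x w by exact: right_inf_ge0.
have H1 x w : H x w <= 1 by exact: right_inf_le1.
have mH x : measurable_fun setT (H x) by exact: measurable_right_inf.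
have bH x : bdd (H x) by apply: (@bddP _ _ _ _ 1) => // w; rewrite ger0_norm.
have Hnd w : {homo H^~ w : x y / x <= y} by exact: right_inf_nd.
have bG r : bdd (G r) by apply: (@bddP _ _ _ _ 1) => // w; rewrite ger0_norm.
pose Phi x := Ex (H x).
have Phi_nd : {homo Phi : x y / x <= y} by move=> x y xy; apply: Ex_le => // w; exact: Hnd.
have [S [cS dS SP]] := dense_continuity_points Phi_nd.
exists S, H, mu; split; last by apply: aeW => w x; exact: muE.
split=> //.
- by split=> [x w|x //]; rewrite H0 H1.
- apply: aeW => w; split.
  + exact: Hnd.
  + by move=> x; exact: right_inf_rc.
  + exact: right_infNy.
  + exact: right_infy.
move=> x Sx B mB.
have bB : bdd (\1_B : Omega -> R) by exact: bdd_indic.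
have iH : P.-integrable B (EFin \o H x) by exact: integrableS (bdd_int P (bH x)).
have mI n : measurable ([set w | f (k n) w <= x] `&` B) by apply: measurableI => //; exact: measurable_le.
have -> : (\int[P]_(w in B) (H x w)%:E)%E = (Ex (fun w => H x w * \1_B w))%:E.
  by rewrite Ex_indicM// /Rintegral fineK//; exact: (integrable_fin_num _ iH).
apply/fine_cvgP; split; first by apply: nearW => n; rewrite PrE.
apply/cvgrPdist_le => e e0; have e2 : 0 < e / 2 by rewrite divr_gt0.
have [[y [yx Py]] [z [xz Pz]]] := SP x Sx _ e2.
have [r] := rat_in_itvoo yx; rewrite in_itv/= => /andP[yr rx].
have [s] := rat_in_itvoo xz; rewrite in_itv/= => /andP[xs sz].
have G0G t : Ex (fun w => G0 t w * \1_B w) = Ex (fun w => G t w * \1_B w).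
  apply: Ex_ae.
  - by apply: measurable_funM => //; exact: measurable_indic.
  - by apply: measurable_funM => //; exact: measurable_indic.
  exists A0; split=> // w /= h; apply: contrapT => nA; apply: h => _; by rewrite GnA.
have HB u v : u <= v -> Ex (fun w => H v w * \1_B w) - Ex (fun w => H u w * \1_B w) <= Phi v - Phi u.
  move=> uv; rewrite -!ExB//; [|exact: bddM..].
  apply: Ex_le => [||w]; first by apply: bddB; exact: bddM.
    exact: bddB.
  by rewrite -mulrBl ler_piMr ?subr_ge0 ?Hnd// indicE lern1 leq_b1.
have low : Ex (fun w => H x w * \1_B w) - e / 2 <= Ex (fun w => G0 r w * \1_B w).
  rewrite G0G; apply: (@le_trans _ _ (Ex (fun w => H y w * \1_B w))).
    by have := HB _ _ (ltW yx); lra.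
  apply: Ex_le => [||w]; [exact: bddM|exact: bddM|].
  by rewrite ler_wpM2r ?indicE//; exact: right_inf_le.
have high : Ex (fun w => G0 s w * \1_B w) <= Ex (fun w => H x w * \1_B w) + e / 2.
  rewrite G0G; apply: (@le_trans _ _ (Ex (fun w => H z w * \1_B w))); last first.
    by have := HB _ _ (ltW xz); lra.
  apply: Ex_le => [||w]; [exact: bddM|exact: bddM|].
  by rewrite ler_wpM2r ?indicE//; apply: le_right_inf => //; exact: ltW.
have cr := @cG0 r _ mB; have cs := @cG0 s _ mB.
move/cvgrPdist_le : cr => /(_ _ e2) nr; move/cvgrPdist_le : cs => /(_ _ e2) ns.
apply: (filterS _ (filterI nr ns)) => n [hr hs].
have PE : fine (P ([set w | f (k n) w <= x] `&` B)) = Ex (fun w => below x (f (k n) w) * \1_B w).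
  rewrite -[LHS]/(Pr _) -Ex_indic//; congr (expect _ _); apply/funext => w.
  rewrite indicI; congr (_ * _); rewrite indicE; congr (nat_of_bool _)%:R.
  by apply/idP/idP; rewrite inE.
have m1 : Ex (fun w => below (ratr r) (f (k n) w) * \1_B w) <= Ex (fun w => below x (f (k n) w) * \1_B w).
  apply: Ex_le => [||w]; [exact: bddM|exact: bddM|].
  rewrite ler_wpM2r// ?indicE// /below ler_nat; case: (leP (f (k n) w) (ratr r)) => // fr.
  by rewrite (le_trans fr)// ltW.
have m2 : Ex (fun w => below x (f (k n) w) * \1_B w) <= Ex (fun w => below (ratr s) (f (k n) w) * \1_B w).
  apply: Ex_le => [||w]; [exact: bddM|exact: bddM|].
  rewrite ler_wpM2r// ?indicE// /below ler_nat; case: (leP (f (k n) w) x) => // fr.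
  by rewrite (le_trans fr)// ltW.
rewrite /= PE; move: hr hs; rewrite !ler_norml; lra.
Qed.

End determining_exists.

(** * Weak L2 limits *)

Section weak_L2.
Context {d : measure_display} {Omega : measurableType d} {R : realType}.
Variable P : probability Omega R.
Local Notation Ex := (expect P).
Local Notation Pr := (prob P).

Lemma integrable_bddM (X h : Omega -> R) : bdd X -> P.-integrable setT (EFin \o h) ->
  P.-integrable setT (EFin \o (fun w => X w * h w)).
Proof.
move=> [mX [C XC]] ih; have mh : measurable_fun setT h.
  by apply/measurable_EFinP; case/integrableP : ih.
apply: (le_integrable measurableT (g := fun w => (C%:E * (h w)%:E)%E)).
- by apply/measurable_EFinP; exact: measurable_funM.
- move=> w _; rewrite -EFinM !abse_EFin lee_fin !normrM ler_wpM2r//.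
  exact: le_trans (ler_norm C).
- exact: integrableZl.
Qed.

Lemma integrable_of_sqr (h : Omega -> R) : measurable_fun setT h ->
  P.-integrable setT (fun w => (h w ^+ 2)%:E) -> P.-integrable setT (EFin \o h).
Proof.
move=> mh ih2; have i1 : P.-integrable setT (EFin \o (fun=> 1 : R)) by exact/bdd_int/bdd_cst.
apply: (le_integrable measurableT _ _ (integrableD measurableT i1 ih2)).
  exact/measurable_EFinP.
move=> w _; change (abse (h w)%:E <= abse (1 + h w ^+ 2)%:E)%E.
rewrite !abse_EFin lee_fin [leRHS]ger0_norm ?addr_ge0 ?sqr_ge0//.
rewrite -(ger0_norm (sqr_ge0 (h w))) normrX.
have := sqr_ge0 (`|h w| - 1); have := normr_ge0 (h w); nra.
Qed.

(** Clamping [h] at level [K] changes it by at most [h ^+ 2 / K], which changes the integrals by at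
    most [C * I2 / K], uniformly in [n]. *)
Lemma wcv_L2 (X : nat -> Omega -> R) (Y h : Omega -> R) (C : R) :
  (forall n, measurable_fun setT (X n)) -> (forall n w, `|X n w| <= C) ->
  measurable_fun setT Y -> (forall w, `|Y w| <= C) -> wcv P X Y ->
  measurable_fun setT h -> P.-integrable setT (fun w => (h w ^+ 2)%:E) ->
  Ex (fun w => X n w * h w) @[n --> \oo] --> Ex (fun w => Y w * h w).
Proof.
move=> mX XC mY YC XY mh ih2; have ih := integrable_of_sqr mh ih2.
have C0 : 0 <= C by rewrite (le_trans _ (YC point)).
pose I2 := Ex (fun w => h w ^+ 2).
have I20 : 0 <= I2 by apply: Ex_ge0 => w; exact: sqr_ge0.
apply/cvgrPdist_le => /= e e0; have e3 : 0 < e / 3 by rewrite divr_gt0.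
pose K := C * I2 / (e / 3) + 1.
have K0 : 0 < K by rewrite ltr_wpDl// divr_ge0 ?mulr_ge0// ltW.
have CIK : C * I2 / K <= e / 3.
  by rewrite ler_pdivrMr// [leRHS]mulrC -ler_pdivrMr// /K lerDl ler01.
pose hK w := Num.max (- K) (Num.min K (h w)).
have mhK : measurable_fun setT hK by exact: (measurableT_comp (measurable_clamp K)).
have bhK : bdd hK by apply: (bddP mhK) => w; apply: norm_clamp; exact: ltW.
have hKh w : `|h w - hK w| <= h w ^+ 2 / K.
  rewrite /hK; have [hK'|Kh] := leP `|h w| K.
    by rewrite clamp_id// subrr normr0 divr_ge0 ?sqr_ge0// ltW.
  rewrite ler_pdivlMr// (@le_trans _ _ (`|h w| * K))//.
    rewrite ler_wpM2r ?(ltW K0)//.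
    have [h0|h0] := leP 0 (h w).
      rewrite ger0_norm// in Kh; rewrite (min_idPl (ltW Kh)) max_r; last lra.
      by rewrite !ger0_norm//; lra.
    rewrite ltr0_norm// in Kh; rewrite (min_idPr _); last lra.
    rewrite max_l; last lra.
    by rewrite opprK ltr0_norm ?ler0_norm//; lra.
  by rewrite -[leRHS]ger0_norm ?sqr_ge0// normrX expr2 ler_wpM2l// ltW.
have approx (Z : Omega -> R) : measurable_fun setT Z -> (forall w, `|Z w| <= C) ->
    `|Ex (fun w => Z w * h w) - Ex (fun w => Z w * hK w)| <= e / 3.
  move=> mZ ZC; have bZ : bdd Z by exact: bddP ZC.
  have i1 := integrable_bddM bZ ih; have i2 := bdd_int P (bddM bZ bhK).
  have i3 : P.-integrable setT (EFin \o (fun w => Z w * h w - Z w * hK w)).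
    exact: (integrableB measurableT i1 i2).
  have i4 : P.-integrable setT (EFin \o (fun w => C / K * h w ^+ 2)).
    exact: (integrableZl measurableT (C / K) ih2).
  rewrite /expect -RintegralB//.
  apply: le_trans (le_normr_Rintegral measurableT i3) _.
  apply: (@le_trans _ _ (Rintegral P setT (fun w => C / K * h w ^+ 2))).
    apply: le_Rintegral => //; first exact: integrable_norm i3.
    move=> w _; rewrite -mulrBr normrM mulrAC -mulrA ler_pM//.
  by rewrite RintegralZl// mulrAC.
have := wcv_bdd mX XC mY YC XY bhK => /cvgrPdist_le /(_ _ e3); apply: filterS => n.
have := approx _ mY YC; have := approx _ (mX n) (XC n).
rewrite !ler_norml; lra.
Qed.

(** The sets where [c] leaves [[- C, C]] belong to [S], so the defining identity can be tested on
    them and shows that they are null. *)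
Lemma cond_exp_clamp (S : set (set Omega)) (X c : Omega -> R) (C : R) :
  S `<=` measurable -> measurable_fun setT X -> (forall w, `|X w| <= C) ->
  cond_exp_version P S X c ->
  [/\ measurable_wrt S (fun w => Num.max (- C) (Num.min C (c w))),
      {ae P, forall w, c w = Num.max (- C) (Num.min C (c w))} &
      forall A, S A -> Ex (fun w => Num.max (- C) (Num.min C (c w)) * \1_A w) = Ex (fun w => X w * \1_A w)].
Proof.
move=> Sm mX XC [Sc ic cX].
have mc : measurable_fun setT c by exact: measurable_wrt_fun Sc.
have bX : bdd X by exact: bddP XC.
pose B1 := [set w | C < c w]; pose B2 := [set w | c w < - C].
have mB1 : measurable B1 by exact: measurable_gt.
have mB2 : measurable B2 by exact: measurable_lt.
have SB1 : S B1.
  rewrite (_ : B1 = c @^-1` `]C, +oo[); first by apply: Sc; exact: measurable_itv.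
  by apply/seteqP; split=> w; rewrite /= in_itv/= andbT.
have SB2 : S B2.
  rewrite (_ : B2 = c @^-1` `]-oo, - C[); first by apply: Sc; exact: measurable_itv.
  by apply/seteqP; split=> w; rewrite /= in_itv/=.
have RB B : S B -> Rintegral P B c = Rintegral P B X by move=> SB; rewrite /Rintegral cX.
have iB B (Z : Omega -> R) : measurable B -> P.-integrable setT (EFin \o Z) -> P.-integrable B (EFin \o Z).
  by move=> mB; exact: integrableS.
have iX := bdd_int P bX.
have icst (r : R) : P.-integrable setT (EFin \o (fun=> r)) by exact/bdd_int/bdd_cst.
have P1 : P B1 = 0%E.
  apply: (@integral_le0_null _ _ _ _ _ (fun w => c w - C)) => // [|w|].
  - exact: (integrableB measurableT ic (icst C)).
  - by rewrite /B1/= subr_gt0.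
  - rewrite RintegralB//; [|exact: iB|exact: iB].
    rewrite RB// subr_le0; apply: le_Rintegral => //; [exact: iB|exact: iB|].
    by move=> w _; exact: le_trans (ler_norm _) (XC w).
have P2 : P B2 = 0%E.
  apply: (@integral_le0_null _ _ _ _ _ (fun w => - C - c w)) => // [|w|].
  - exact: (integrableB measurableT (icst (- C)) ic).
  - by rewrite /B2/= subr_gt0.
  - rewrite RintegralB//; [|exact: iB|exact: iB].
    rewrite RB// subr_le0; apply: le_Rintegral => //; [exact: iB|exact: iB|].
    by move=> w _; have := XC w; rewrite ler_norml => /andP[].
have cae : {ae P, forall w, c w = Num.max (- C) (Num.min C (c w))}.
  have : P.-negligible (B1 `|` B2) by apply: negligibleU; apply/negligibleP.
  apply: negligibleS => w /=; apply: contra_notP => /not_orP[].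
  rewrite /B1/B2/= => /negP; rewrite -leNgt => gC /negP; rewrite -leNgt => Cg.
  by rewrite (min_idPr gC) (max_idPr Cg).
split=> //; first exact: (measurable_wrt_comp (measurable_clamp C) Sc).
move=> A SA; have mA := Sm _ SA; rewrite Ex_indicM// [RHS]Ex_indicM// -RB//.
congr fine; apply: ae_eq_integral => //.
- apply/measurable_funTS/measurable_EFinP.
  exact: (measurableT_comp (measurable_clamp C)).
- exact/measurable_funTS/measurable_EFinP.
- by apply: filterS cae => w cw _; rewrite -cw.
Qed.

(** Conditional expectation is self-adjoint: testing that of [X n] on [B] amounts to testing [X n]
    against that of the indicator of [B]. The limit [Y], being [S]-measurable, is its own
    conditional expectation. *)
Lemma cond_exp_weak_L2 (S : set (set Omega)) (X c : nat -> Omega -> R) (Y : Omega -> R) (C : R) :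
  sigma_algebra setT S -> S `<=` measurable ->
  (forall n, measurable_fun setT (X n)) -> (forall n w, `|X n w| <= C) ->
  measurable_wrt S Y -> (forall w, `|Y w| <= C) -> wcv P X Y ->
  (forall n, cond_exp_version P S (X n) (c n)) -> weak_L2_conv P c Y.
Proof.
move=> aS Sm mX XC SY YC XY cv h mh ih2.
have C0 : 0 <= C by rewrite (le_trans _ (YC point)).
have mY : measurable_fun setT Y by exact: measurable_wrt_fun SY.
pose c' n w := Num.max (- C) (Num.min C (c n w)).
have cP n := cond_exp_clamp Sm (mX n) (XC n) (cv n).
have Sc' n : measurable_wrt S (c' n) by case: (cP n).
have mc' n : measurable_fun setT (c' n) by exact: measurable_wrt_fun (Sc' n).
have c'C n w : `|c' n w| <= C by exact: norm_clamp.
have bc' n : bdd (c' n) by exact: bddP (c'C n).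
have bX n : bdd (X n) by exact: bddP (XC n).
have bY : bdd Y by exact: bddP YC.
have wc' : wcv P c' Y.
  move=> B mB; have bB : bdd (\1_B : Omega -> R) by exact: bdd_indic.
  have [||g [Sg g1 gB]] := @cond_exp_exists _ _ _ P S (\1_B : Omega -> R) 1 aS Sm.
  - exact: measurable_indic.
  - by move=> w; rewrite indicE normr_nat lern1 leq_b1.
  have bg : bdd g by apply: (@bddP _ _ _ _ 1) => //; exact: measurable_wrt_fun Sg.
  have proj (Z : Omega -> R) : bdd Z -> measurable_wrt S Z ->
      Ex (fun w => Z w * \1_B w) = Ex (fun w => Z w * g w).
    move=> bZ SZ; apply/eqP; rewrite -subr_eq0 -ExB; [|exact: bddM..]; apply/eqP.
    transitivity (Ex (fun w => (\1_B w - g w) * Z w)).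
      by congr (expect _ _); apply/funext => w; ring.
    apply: (Ex_orthogonal (S := S)) => //; first exact: bddB.
    move=> A SA mA; have bA : bdd (\1_A : Omega -> R) by exact: bdd_indic.
    under eq_fun do rewrite mulrBl.
    by rewrite ExB; [rewrite gB// subrr|exact: bddM..].
  rewrite (proj Y)//.
  have E n : Ex (fun w => c' n w * g w) = Ex (fun w => X n w * g w).
    apply/eqP; rewrite -subr_eq0 -ExB; [|exact: bddM..]; apply/eqP.
    transitivity (Ex (fun w => (c' n w - X n w) * g w)).
      by congr (expect _ _); apply/funext => w; ring.
    apply: (Ex_orthogonal (S := S)) => //; first exact: bddB.
    move=> A SA mA; have bA : bdd (\1_A : Omega -> R) by exact: bdd_indic.
    under eq_fun do rewrite mulrBl.
    rewrite ExB; [|exact: bddM..].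
    by have [_ _ ->//] := cP n; rewrite subrr.
  have -> : (fun n => Ex (fun w => c' n w * \1_B w)) = fun n => Ex (fun w => X n w * g w).
    by apply/funext => n; rewrite -E proj.
  exact: (wcv_bdd mX XC mY YC XY).
have ih := integrable_of_sqr mh ih2.
have fE (Z : Omega -> R) : bdd Z -> (\int[P]_w (Z w * h w)%:E)%E = (Ex (fun w => Z w * h w))%:E.
  by move=> bZ; rewrite /expect /Rintegral fineK//; exact: (integrable_fin_num _ (integrable_bddM bZ ih)).
rewrite fE//.
have -> : (fun n => (\int[P]_w (c n w * h w)%:E)%E) = (fun n => (Ex (fun w => c' n w * h w))%:E).
  apply/funext => n; rewrite -fE//; apply: ae_eq_integral => //.
  - by apply/measurable_EFinP; apply: measurable_funM => //; case: (cv n) => /(measurable_wrt_fun Sm).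
  - by apply/measurable_EFinP; apply: measurable_funM.
  - by have [_ + _] := cP n; apply: filterS => w cw _; rewrite {1}cw.
apply: cvg_EFin; first exact: nearW.
exact: (wcv_L2 mc' c'C mY YC wc').
Qed.

End weak_L2.

(** * Equivalence of the conditions *)

Section assembly.
Context {d : measure_display} {Omega : measurableType d} {R : realType}.
Variable P : probability Omega R.
Local Notation Ex := (expect P).
Local Notation Pr := (prob P).
Variable f : nat -> Omega -> R.
Hypothesis mf : forall n, measurable_fun setT (f n).

Lemma prop_iP k D : prop_i P f k D <-> prop_i' P f k D.
Proof.
have ST := tail_measurable mf.
have mA m (D' : nat -> Omega -> R) (eps : R) : good_centering P f D' ->
    forall N, measurable [set w | eps < `|avg f m N w - D' N w|].
  move=> [SD _] N; apply: measurable_norm_gt; apply: measurable_funB.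
    exact: measurable_avg.
  exact: measurable_wrt_fun (SD N).
split=> -[ik gD h]; split=> // m mk eps eps0.
  by move=> g; apply: cond_prob_conv => //; [exact: mA|exact: h].
apply: (cond_prob_conv_inv (tail_sigma_algebra f) ST); first exact: mA.
exact: h.
Qed.

Lemma tail_sigma_subseq k : strict_incr k -> tail_sigma (fun n => f (k n)) `<=` tail_sigma f.
Proof.
move=> ik A TA n _; move: (TA n I); apply: smallest_sub; first exact: smallest_sigma_algebra.
move=> _ [m nm [B mB <-]]; apply: sub_gen_smallest; exists (k m) => /=; last by exists B.
exact: leq_trans nm (strict_incr_ge _ ik).
Qed.

Lemma cond_i_ii : cond_i P f -> cond_ii P f.
Proof.
move=> [k [D [ik [TD _] h]]]; pose F n := f (k n).
have mF n : measurable_fun setT (F n) by exact: mf.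
have mD N : measurable_fun setT (D N) by exact: measurable_wrt_fun (tail_measurable mf) (TD N).
have lln psi : strict_incr psi -> conv_in_prob P (fun N w => avg F psi N w - D N w).
  by move=> ipsi; apply: (h (k \o psi)); exists psi.
(* Half-lines with rational ends and balls are enumerated in a single sequence, so that one
   extraction serves both; numbers that code nothing get the dummy [below 0]. *)
pose u (q : nat) : R -> R := match (unpickle q : option (rat + nat)%type) with
  | Some (inl r) => below (ratr r) | Some (inr M) => inball M | None => below 0 end.
have mu' q : measurable_fun setT (u q).
  by rewrite /u; case: (unpickle q) => [[r|M]|];
    [exact: measurable_below|exact: measurable_inball|exact: measurable_below].
have u1 q x : `|u q x| <= 1.
  by rewrite /u; case: (unpickle q) => [[r|M]|]; [exact: norm_below|exact: norm_inball|exact: norm_below].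
have [k1 [Y [ik1 Yq]]] := extraction P (C := fun=> 1) mF mu' u1.
have mY q : measurable_fun setT (Y q).
  by have [SY _ _] := Yq q; exact: measurable_wrt_fun (tail_measurable mF) SY.
have Y1 q w : `|Y q w| <= 1 by have [_ + _] := Yq q; exact.
have ikk1 : strict_incr (k \o k1) by exact: strict_incr_comp.
have cG (r : rat) : wcv P (fun n w => below (ratr r) (f ((k \o k1) n) w)) (Y (pickle (inl r : rat + nat)%type)).
  by have [_ _] := Yq (pickle (inl r : rat + nat)%type); rewrite /u pickleK.
have cb (M : nat) : wcv P (fun n w => inball M (f ((k \o k1) n) w)) (Y (pickle (inr M : rat + nat)%type)).
  by have [_ _] := Yq (pickle (inr M : rat + nat)%type); rewrite /u pickleK.
have tight (e : R) : 0 < e -> exists M : R, forall n, Pr [set w | M < `|f ((k \o k1) n) w|] <= e.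
  by move=> e0; have [M MP] := tight_of_lln mF mD lln e0; exists M => n; exact: MP.
have [Dset [H [mu [dk lmu]]]] := @determining_exists _ _ _ P f (k \o k1) _ mf ikk1 tight
  (fun r => mY (pickle (inl r : rat + nat)%type)) (fun r => Y1 (pickle (inl r : rat + nat)%type)) (@cG).
exists (k \o k1), Dset, H, mu.
suff /second_moment_convP[] : conv_in_prob P (fun N w => second_moment mu N w / N%:R) by [].
(* The weak limit of nonnegative functions is nonnegative only almost everywhere; the positive part
   makes it so at every point. *)
pose bb M w := Num.max 0 (Y (pickle (inr M : rat + nat)%type) w).
have mbb M : measurable_fun setT (bb M) by exact: measurable_maxr.
have cbb M : wcv P (fun n w => inball M (f ((k \o k1) n) w)) (bb M).
  have Y0 : {ae P, forall w, 0 <= Y (pickle (inr M : rat + nat)%type) w}.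
    apply: ae_le_of_Ex => //; [exact: bdd_cst|exact: bddP (Y1 _)|move=> B mB].
    have c := cb M B mB; rewrite Ex0 -(cvg_lim _ c)//; apply: limr_ge; first by apply/cvg_ex; eexists; exact: c.
    by apply: nearW => n; apply: Ex_ge0 => w; rewrite mulr_ge0// indicE.
  move=> B mB; have -> : Ex (fun w => bb M w * \1_B w) = Ex (fun w => Y (pickle (inr M : rat + nat)%type) w * \1_B w).
    apply: Ex_ae; [by apply: measurable_funM => //; exact: measurable_indic..|].
    by apply: filterS Y0 => w Y0 _; rewrite /bb max_r.
  exact: cb.
apply: (@second_moment_conv _ _ _ P (fun n => f ((k \o k1) n)) D _ mD _ (second_moment mu) bb) => //.
- by move=> psi ipsi; apply: (lln (k1 \o psi)); exact: strict_incr_comp.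
- exact: measurable_second_moment.
- exact: second_moment_ge0.
- exact: second_moment_le.
- move=> N; exact: (wcv_second_moment mf dk lmu).
- by move=> M w; rewrite /bb le_max lexx.
- by move=> M w; rewrite /bb ge_max ler01/= (le_trans (ler_norm _)).
Qed.

(** The additional extraction supplies the centers [D N]. Weak limits persist along subsequences, so
    [second_moment mu N] and [D N] remain the limits along the final one. *)
Lemma cond_ii_moreover : cond_ii P f -> moreover_part P f.
Proof.
move=> [k [Dset [H [mu [dk lmu tc cc]]]]].
have cV : conv_in_prob P (fun N w => second_moment mu N w / N%:R) by exact/second_moment_convP.
have [ik _ _ _ _] := dk; pose F n := f (k n).
have mF n : measurable_fun setT (F n) by exact: mf.
have [k1 [D [ik1 Dq]]] := extraction P (C := fun q => q%:R) mF measurable_trunc norm_trunc.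
have SD N : measurable_wrt (tail_sigma f) (D N).
  by have [SD _ _] := Dq N => Y mY; apply: (tail_sigma_subseq ik); exact: SD.
have DN N w : `|D N w| <= N%:R by have [_ + _] := Dq N; exact.
have cD N : wcv P (fun n w => trunc N (f (k (k1 n)) w)) (D N) by have [] := Dq N.
have mD N : measurable_fun setT (D N) by exact: measurable_wrt_fun (tail_measurable mf) (SD N).
have cv N : wcv P (fun n w => trunc_sqr N (f (k (k1 n)) w)) (second_moment mu N).
  exact: (wcv_subseq ik1 (@wcv_second_moment _ _ _ _ _ _ _ _ _ mf dk lmu N)).
have mF1 n : measurable_fun setT (f (k (k1 n))) by exact: mf.
have [phi [iphi lln]] := hereditary_lln mF1 (measurable_second_moment mu) (second_moment_ge0 mu)
  (second_moment_le mu) mD DN cv cD cV.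
have pi : prop_i P f (k \o k1 \o phi) D.
  split; first by do 2!apply: strict_incr_comp => //.
    by split=> //; apply: aeW => w N _.
  by move=> m [psi [ipsi ->]]; exact: lln.
exists (k \o k1 \o phi), D; split=> //.
- exact/prop_iP.
- move=> N N0 c cP; apply: (cond_exp_weak_L2 (tail_sigma_algebra f) (tail_measurable mf) _ _ (SD N) (DN N) _ cP).
  + by move=> n; exact: (measurableT_comp (measurable_trunc N)).
  + by move=> n w; exact: norm_trunc.
  + exact: (wcv_subseq iphi (cD N)).
- exact: (center_over_sqrt mF1 (measurable_second_moment mu) (second_moment_ge0 mu)
    (second_moment_le mu) mD DN cv cD cV).
Qed.

End assembly.

Theorem theorem3p1 (d : measure_display) (Omega : measurableType d) (R : realType)
    (P : probability Omega R) (f : nat -> Omega -> R)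
    (mf : forall n, measurable_fun setT (f n)) :
  [/\ cond_i P f <-> cond_i' P f,
      cond_i P f <-> cond_ii P f &
      cond_i P f -> moreover_part P f].
Proof.
split.
- by split=> -[k [D h]]; exists k, D; apply/prop_iP.
- split=> [|/(cond_ii_moreover mf)[k [D [h _ _ _]]]]; first exact: cond_i_ii.
  by exists k, D.
- by move=> /(cond_i_ii mf); exact: cond_ii_moreover.
Qed.
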